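(* Let $(N,h)$ be a conformally compact manifold of non-positive sectional curvature, and let $M$ be a compact manifold with boundary. Let $u:M\to N$ be an immersion mapping $\partial M$ to $\partial N$, $M^\circ$ to $N^\circ$, and transversal to $\partial N$. Equip $M^\circ$ with the induced metric $u^*h$. Then $u$ is biharmonic if and only if it is minimal.
   Context: $M^\circ$ and $\partial M$ denote the interior and boundary of a compact manifold with boundary $M$ (similarly for $N$). Boundary defining functions. A boundary defining function (bdf) for $N$ is a smooth function $x:N\to[0,+\infty)$ with $x^{-1}(0)=\partial N$ and $dx$ nowhere vanishing along $\partial N$ (similarly for $M$). Polyhomogeneity. An index set is a subset $\mathcal{E}\subset\mathbb{C}\times\mathbb{N}$ such that $(\alpha,l)\in\mathcal{E}$ implies $(\alpha+k,l')\in\mathcal{E}$ for all $k\in\mathbb{N}$, $l'\le l$, and such that for every $\delta\in\mathbb{R}$ the set $\{(\alpha,l)\in\mathcal{E}:\Re(\alpha)\le\delta\}$ is finite. A polyhomogeneous function on $M$ with index set $\mathcal{E}$ is a smooth function $f$ on $M^\circ$ with an asymptotic expansion $f\sim\sum_{(\alpha,l)\in\mathcal{E}}f_{\alpha,l}\,x^{\alpha}(\log x)^l$ at $\partial M$, with $x$ a bdf and $f_{\alpha,l}\in C^\infty(M)$; this means that for every $\delta\in\mathbb{R}$ the difference $f-\sum_{\Re(\alpha)\le\delta}f_{\alpha,l}x^\alpha(\log x)^l$, together with all its iterated derivatives along vector fields tangent to $\partial M$, lies in $x^\delta L^\infty(M)$. Convention: when no index set is specified, polyhomogeneous functions are real-valued,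 bounded, with index set contained in $\mathbb{R}\times\mathbb{N}$ (no negative powers, no complex powers, no leading logarithms). Polyhomogeneous metrics, maps, etc. are those locally described by such functions. A conformally compact metric on $N$ (a compact manifold with boundary) is a smooth Riemannian metric $h$ on $N^\circ$ such that for some (hence every) bdf $x$ the rescaling $x^2h$ extends to a polyhomogeneous Riemannian metric on the whole of $N$. Non-positive sectional curvature refers to $h$ on $N^\circ$. Maps $u:M\to N$ are polyhomogeneous (components in smooth local coordinates are polyhomogeneous; smooth maps are a special case) and $C^1$ up to the boundary; $u$ is an immersion if $du_p$ is injective for every $p\in M$ (including $p\in\partial M$). Harmonic and biharmonic maps. On $M^\circ$ with metric $g=u^*h$, view $du$ as a section of $T^*M^\circ\otimes u^*TN^\circ$, with the connection $\nabla$ induced by the Levi-Civita connections of $g$ and (pulled back) of $h$. The tension field is $\tau(u)=\operatorname{tr}_g\nabla du$. The Jacobi operator is $J_u=\Delta+\operatorname{tr}_gR_h(du,\cdot)du$ on sections of $u^*TN^\circ$, where $\Delta=(u^*\nabla^h)^*(u^*\nabla^h)$ is the (positive) rough Laplacian and $R_h$ is the Riemann tensor, with sign such that $\langle R_h(v,w)v,w\rangle$ equals minus the sectional curvature for orthonormal $v,w$. The map $u$ is biharmonic if $J_u(\tau(u))=0$ on $M^\circ$. The immersion is minimal if its mean curvature vanishes on $M^\circ$. *)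

(* Defs.v *)
(* Every manifold below is given by an explicit smooth atlas, and tensors are
   given by their components in the charts of that atlas. *)
From Stdlib Require List.
From HB Require Import structures.
From mathcomp Require Import all_boot all_order all_algebra.
From mathcomp Require Import all_classical all_reals all_analysis.

Set Implicit Arguments.
Unset Strict Implicit.
Unset Printing Implicit Defensive.
Import Order.TTheory GRing.Theory Num.Theory.
Import numFieldNormedType.Exports.
Local Open Scope classical_set_scope.
Local Open Scope ring_scope.

Section Calculus.
Context {R : realType} {n : nat}.
Local Notation V := 'rV[R]_n.

Definition partial (i : 'I_n) (f : V -> R) : V -> R :=
  fun p => 'D_(delta_mx 0 i) f p.

(* C^k on an open set W; [f] is total, but only its values on W matter. *)
Fixpoint Ck (k : nat) (W : set V) (f : V -> R) : Prop :=
  (forall p, W p -> {for p, continuous f}) /\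
  (if k is k'.+1 then
     forall i, (forall p, W p -> derivable f p (delta_mx 0 i)) /\
               Ck k' W (partial i f)
   else True).

Definition smooth (W : set V) (f : V -> R) : Prop := forall k, Ck k W f.

(* First coordinate, the local boundary defining function.  In dimension 0
   there is no boundary, whence the dummy value 1. *)
Definition bcoord (p : V) : R := oapp (fun i : 'I_n => p 0 i) 1 (insub 0%N).

Definition halfspace : set V := [set p | 0 <= bcoord p].

(* F is an extension of f|_U to a neighbourhood of p in R^n, of the regularity
   prescribed by C.  Here U is relatively open in the half-space. *)
Definition local_ext (C : set V -> (V -> R) -> Prop) (U : set V) (f : V -> R)
    (p : V) (F : V -> R) : Prop :=
  exists W : set V,
    [/\ open W, W p, C W F & forall q, W q -> U q -> F q = f q].

Definition smooth_upto (U : set V) (f : V -> R) : Prop :=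
  forall p, U p -> exists F, local_ext smooth U f p F.

(* The metric components near a point form a matrix-valued function g;
   'christoffel g p k i j' is Gamma^k_{ij}. *)
Definition christoffel (g : V -> 'M[R]_n) (p : V) (k i j : 'I_n) : R :=
  2^-1 * \sum_l invmx (g p) k l *
    (partial i (fun q => g q j l) p + partial j (fun q => g q i l) p
     - partial l (fun q => g q i j) p).

(* R^a_{bcd}, where R(d_c, d_d) d_b = sum_a R^a_{bcd} d_a and
   R(X, Y) = [nabla_X, nabla_Y] - nabla_[X, Y]. *)
Definition riemann_coef (g : V -> 'M[R]_n) (p : V) (a b c d : 'I_n) : R :=
  let G := christoffel g in
  partial c (fun q => G q a d b) p - partial d (fun q => G q a c b) p
  + \sum_e (G p a c e * G p e d b - G p a d e * G p e c b).

(* R(v, w) z at p *)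
Definition riemann (g : V -> 'M[R]_n) (p : V) (v w z : V) : V :=
  \row_a \sum_b \sum_c \sum_d
    riemann_coef g p a b c d * z 0 b * v 0 c * w 0 d.

Definition inner (A : 'M[R]_n) (v w : V) : R := (v *m A *m w^T) 0 0.

Definition posdef (A : 'M[R]_n) : Prop :=
  A^T = A /\ forall v : V, v != 0 -> 0 < inner A v v.

Definition sectional (g : V -> 'M[R]_n) (p : V) (v w : V) : R :=
  - inner (g p) (riemann g p v w v) w /
  (inner (g p) v v * inner (g p) w w - inner (g p) v w ^+ 2).

Definition lie (X : V -> V) (f : V -> R) : V -> R :=
  fun q => \sum_i X q 0 i * partial i f q.

Definition tangent_field (X : V -> V) : Prop :=
  (forall i, smooth_upto halfspace (fun q => X q 0 i)) /\
  (forall q, bcoord q = 0 -> bcoord (X q) = 0).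

Definition index_set (E : set (R * nat)) : Prop :=
  (forall a l, E (a, l) ->
     forall k l', (l' <= l)%N -> E (a + k%:R, l')) /\
  (forall d : R, finite_set (E `&` [set e | e.1 <= d])).

(* Truncated expansion; the boundary defining function is the coordinate
   [bcoord].  The sum is finite when E is an index set. *)
Definition phg_partial_sum (E : set (R * nat)) (c : R * nat -> V -> R) (d : R) :
    V -> R := fun q =>
  \sum_(e \in E `&` [set e | e.1 <= d])
     c e q * (bcoord q `^ e.1) * (ln (bcoord q)) ^+ e.2.

(* Near p the restriction of f to U /\ {bcoord > 0} is polyhomogeneous,
   bounded, with real exponents.  Away from the boundary this is smoothness. *)
Definition phg_at (U : set V) (f : V -> R) (p : V) : Prop :=
  exists (E : set (R * nat)) (W : set V) (c : R * nat -> V -> R),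
    let D := [set q | [/\ W q, U q & 0 < bcoord q]] in
    [/\ index_set E, open W /\ W p,
        smooth D f /\ (exists C : R, forall q, D q -> `|f q| <= C),
        (forall e, E e -> smooth_upto (W `&` halfspace) (c e)) &
        forall (d : R) (Xs : seq (V -> V)),
          List.Forall tangent_field Xs ->
          exists C : R, forall q, D q ->
            `|foldr lie (fun q' => f q' - phg_partial_sum E c d q') Xs q|
              <= C * (bcoord q `^ d)].

End Calculus.

Arguments halfspace {R} n.

(* A chart with values in the half-space of R^n; [cpsi] is the inverse of
   [cphi], and both maps are junk outside [cdom], [cimg]. *)
Record chart (R : realType) (T : topologicalType) (n : nat) := Chart {
  cdom : set T;
  cimg : set 'rV[R]_n;
  cphi : T -> 'rV[R]_n;
  cpsi : 'rV[R]_n -> T;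
  cdom_open : open cdom;
  cimg_open : exists2 O : set 'rV[R]_n, open O & cimg = O `&` halfspace n;
  cphi_img : forall p, cdom p -> cimg (cphi p);
  cpsi_dom : forall q, cimg q -> cdom (cpsi q);
  cphiK : forall p, cdom p -> cpsi (cphi p) = p;
  cpsiK : forall q, cimg q -> cphi (cpsi q) = q;
  cphi_cont : {within cdom, continuous cphi};
  cpsi_cont : {within cimg, continuous cpsi} }.

(* [local_rep k k' u] is u read in the charts k, k'; it is meaningful on
   [local_dom k k' u]. *)
Definition local_dom (R : realType) (S T : topologicalType) (m n : nat)
    (k : chart R S m) (k' : chart R T n) (u : S -> T) : set 'rV[R]_m :=
  [set q | cimg k q /\ cdom k' (u (cpsi k q))].

Definition local_rep (R : realType) (S T : topologicalType) (m n : nat)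
    (k : chart R S m) (k' : chart R T n) (u : S -> T) : 'rV[R]_m -> 'rV[R]_n :=
  fun q => cphi k' (u (cpsi k q)).

Definition rowfun (R : realType) (m n : nat) (f : 'rV[R]_m -> 'rV[R]_n)
    (a : 'I_n) : 'rV[R]_m -> R := fun q => f q 0 a.

(* Compact n-manifold with (possibly empty) boundary.  Second countability is
   automatic. *)
Record cmanifold (R : realType) (n : nat) := CManifold {
  carrier :> topologicalType;
  atlas : set (chart R carrier n);
  carrier_hausdorff : hausdorff_space carrier;
  carrier_compact : compact [set: carrier];
  atlas_cover : forall p : carrier, exists2 k, atlas k & cdom k p;
  atlas_smooth : forall k k', atlas k -> atlas k' ->
    forall a, smooth_upto (local_dom k k' id) (rowfun (local_rep k k' id) a) }.

Definition boundary (R : realType) (n : nat) (M : cmanifold R n) : set M :=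
  [set p | exists k, [/\ atlas k, cdom k p & bcoord (cphi k p) = 0]].

Definition manifold_interior (R : realType) (n : nat) (M : cmanifold R n) :
  set M := ~` boundary (M := M).

Definition chart_at (R : realType) (n : nat) (M : cmanifold R n) (p : M)
  (k : chart R M n) : Prop := atlas k /\ cdom k p.

Section Metrics.
Context {R : realType} {n : nat} (N : cmanifold R n).

(* Components of a covariant 2-tensor in each chart, as functions of the
   coordinates. *)
Definition components := chart R N n -> 'rV[R]_n -> 'M[R]_n.

Definition chart_interior (k : chart R N n) : set 'rV[R]_n :=
  cimg k `&` [set q | 0 < bcoord q].

(* The Jacobian matrix 'J f p acts on row vectors on the right, so that
   tangent vectors transform by v |-> v *m 'J f p. *)
Definition riemannian_metric (h : components) : Prop :=
  [/\ forall k, atlas k -> forall q, chart_interior k q -> posdef (h k q),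
      forall k, atlas k -> forall a b,
        smooth (chart_interior k) (fun q => h k q a b) &
      forall (p : N) k k', manifold_interior p -> chart_at p k ->
        chart_at p k' ->
        let A := 'J (local_rep k k' id) (cphi k p) in
        h k (cphi k p) = A *m h k' (cphi k' p) *m A^T].

Definition boundary_defining (x : N -> R) : Prop :=
  [/\ forall k, atlas k -> smooth_upto (cimg k) (fun q => x (cpsi k q)),
      forall p, 0 <= x p,
      forall p, x p = 0 <-> boundary p &
      forall (p : N) k F, boundary p -> chart_at p k ->
        local_ext smooth (cimg k) (fun q => x (cpsi k q)) (cphi k p) F ->
        exists i, partial i F (cphi k p) != 0].

(* [hbar] is x^2 h, extended to the whole chart including boundary points. *)
Definition conformally_compact (h : components) : Prop :=
  riemannian_metric h /\
  exists x : N -> R, boundary_defining x /\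
    forall k, atlas k -> exists hbar : 'rV[R]_n -> 'M[R]_n,
      [/\ forall q, cimg k q -> posdef (hbar q),
          forall a b, {within cimg k, continuous (fun q => hbar q a b)},
          forall q, chart_interior k q ->
            hbar q = x (cpsi k q) ^+ 2 *: h k q &
          forall a b q, cimg k q -> phg_at (cimg k) (fun q' => hbar q' a b) q].

Definition nonpositive_curvature (h : components) : Prop :=
  forall k, atlas k -> forall q, chart_interior k q ->
  forall v w : 'rV[R]_n, row_free (col_mx v w) -> sectional (h k) q v w <= 0.

End Metrics.

(* Local formulas for a map u : R^m -> R^n with metric components h on the
   target.  Indices i, j, k, l refer to the source and a, b, c to the target. *)
Section LocalMap.
Context {R : realType} {m n : nat}.
Variables (h : 'rV[R]_n -> 'M[R]_n) (u : 'rV[R]_m -> 'rV[R]_n).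

Definition du (i : 'I_m) : 'rV[R]_m -> 'rV[R]_n :=
  fun p => \row_a partial i (rowfun u a) p.

(* g = u^* h *)
Definition pullback (p : 'rV[R]_m) : 'M[R]_m :=
  \matrix_(i, j) inner (h (u p)) (du i p) (du j p).

Definition trace_g (p : 'rV[R]_m) (B : 'I_m -> 'I_m -> 'rV[R]_n) : 'rV[R]_n :=
  \sum_i \sum_j invmx (pullback p) i j *: B i j.

(* (u^* nabla^h)_{d_i} S for a section S of u^* TN *)
Definition nabla_along (S : 'rV[R]_m -> 'rV[R]_n) (i : 'I_m) :
    'rV[R]_m -> 'rV[R]_n := fun p =>
  \row_a (partial i (rowfun S a) p +
    \sum_b \sum_c christoffel h (u p) a b c * du i p 0 b * S p 0 c).

(* Component (i, j) of nabla eta, for eta a section of T^*M (x) u^* TN with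
   components eta j, w.r.t. the Levi-Civita connection of g and u^* nabla^h. *)
Definition nabla_form (eta : 'I_m -> 'rV[R]_m -> 'rV[R]_n) (i j : 'I_m) :
    'rV[R]_m -> 'rV[R]_n := fun p =>
  nabla_along (eta j) i p - \sum_k christoffel pullback p k i j *: eta k p.

Definition tension : 'rV[R]_m -> 'rV[R]_n := fun p =>
  trace_g p (fun i j => nabla_form du i j p).

(* Formal adjoint of u^* nabla^h : S |-> nabla S, i.e. minus the divergence. *)
Definition nabla_adjoint (eta : 'I_m -> 'rV[R]_m -> 'rV[R]_n) :
    'rV[R]_m -> 'rV[R]_n := fun p =>
  - trace_g p (fun i j => nabla_form eta i j p).

Definition rough_laplacian (S : 'rV[R]_m -> 'rV[R]_n) : 'rV[R]_m -> 'rV[R]_n :=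
  nabla_adjoint (nabla_along S).

Definition jacobi (S : 'rV[R]_m -> 'rV[R]_n) : 'rV[R]_m -> 'rV[R]_n := fun p =>
  rough_laplacian S p +
  trace_g p (fun i j => riemann h (u p) (du i p) (S p) (du j p)).

(* h-orthogonal projection onto the complement of the image of du *)
Definition normal_part (p : 'rV[R]_m) (w : 'rV[R]_n) : 'rV[R]_n :=
  w - \sum_k \sum_l
        (invmx (pullback p) k l * inner (h (u p)) w (du k p)) *: du l p.

Definition second_fundamental_form (i j : 'I_m) : 'rV[R]_m -> 'rV[R]_n :=
  fun p => normal_part p (nabla_along (du j) i p).

Definition mean_curvature : 'rV[R]_m -> 'rV[R]_n := fun p =>
  m%:R^-1 *: trace_g p (fun i j => second_fundamental_form i j p).

End LocalMap.

Section Maps.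
Context {R : realType} {m n : nat} (M : cmanifold R m) (N : cmanifold R n).

Definition phg_C1_map (u : M -> N) : Prop :=
  continuous u /\
  forall (p : M) k k', chart_at p k -> chart_at (u p) k' ->
  forall a : 'I_n,
    let f := rowfun (local_rep k k' u) a in
    phg_at (local_dom k k' u) f (cphi k p) /\
    exists F, local_ext (Ck 1) (local_dom k k' u) f (cphi k p) F.

(* A is the matrix of du_p in the charts k, k': the Jacobian at p of a C^1
   extension across the boundary, which does not depend on the extension. *)
Definition differential_at (u : M -> N) (p : M) (k : chart R M m)
    (k' : chart R N n) (A : 'M[R]_(m, n)) : Prop :=
  exists F : 'rV[R]_m -> 'rV[R]_n,
    (forall a, local_ext (Ck 1) (local_dom k k' u)
                 (rowfun (local_rep k k' u) a) (cphi k p) (rowfun F a)) /\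
    A = 'J F (cphi k p).

Definition immersion (u : M -> N) : Prop :=
  forall (p : M) k k' A, chart_at p k -> chart_at (u p) k' ->
    differential_at u p k k' A -> row_free A.

(* du_p (T_p M) + T_{u p} (boundary N) = T_{u p} N at every p with u p in the
   boundary of N *)
Definition transversal_to_boundary (u : M -> N) : Prop :=
  forall (p : M) k k' A, boundary (u p) -> chart_at p k -> chart_at (u p) k' ->
    differential_at u p k k' A ->
    forall w : 'rV[R]_n, exists (v : 'rV[R]_m) (z : 'rV[R]_n),
      bcoord z = 0 /\ w = v *m A + z.

Definition biharmonic (h : components N) (u : M -> N) : Prop :=
  forall (p : M) k k', manifold_interior p -> chart_at p k ->
    chart_at (u p) k' ->
    let f := local_rep k k' u in
    jacobi (h k') f (tension (h k') f) (cphi k p) = 0.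

Definition minimal (h : components N) (u : M -> N) : Prop :=
  forall (p : M) k k', manifold_interior p -> chart_at p k ->
    chart_at (u p) k' ->
    mean_curvature (h k') (local_rep k k' u) (cphi k p) = 0.

End Maps.

(* Main.v *)
(* Let [tau] be the tension field of u, which is m times the mean curvature and
   is normal to u because the domain carries the induced metric.  If u is
   biharmonic and N non-positively curved, the Bochner formula together with
   [<tau, d_i u> = 0] gives [Lap F >= (2/m) F^2] for [F = |tau|^2].  This
   Keller-Osserman type inequality forces F to vanish, whatever the behaviour
   of F at the boundary: put [w = x o u] for a boundary defining function x of
   N, and [phi = 1 + e log w] on the compact set where [w >= exp(-1/e)].  At a
   maximum of [F phi^2] one finds [(2/m - e C) F phi^2 <= e (14 C m + 1)], and
   [e -> 0] yields [F = 0].  The constant C comes from the estimates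
   [|dx|_h <= C x] and [Hess_h x >= - C x h], which hold on the interior of N
   because [x d(x^2 h)] is bounded.  This boundedness is not part of the
   definition of polyhomogeneity: a product of operators [x d_i - b]
   annihilates a bounded polyhomogeneous function up to a remainder with bounded
   iterated [x d_i] derivatives, and a Landau type inequality along the flow of
   [x d_i] then bounds the first derivative. *)
Require Import Defs.
From HB Require Import structures.
From mathcomp Require Import all_boot all_order all_algebra.
From mathcomp Require Import all_classical all_reals all_analysis.
From mathcomp Require Import ring lra.
Set Implicit Arguments.
Unset Strict Implicit.
Unset Printing Implicit Defensive.
Import Order.TTheory GRing.Theory Num.Theory.
Import numFieldNormedType.Exports.
Local Open Scope classical_set_scope.
Local Open Scope ring_scope.

(** The weight is built so that no information on F near the boundary of M is needed. [phi] vanishes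
    where w = exp(-1/e), so a positive maximum of F phi^2 is attained where phi > 0, inside the
    interior of M, and for e -> 0 the weight tends to 1 at each fixed interior point. The square on
    phi is what absorbs the term linear in dx(tau)/x: -2 phi t <= 1 + phi^2 t^2 with t = dx(tau)/x,
    and t^2 <= C F returns the quantity C F phi^2 that is being estimated. The maximum lives on M
    while the tensor calculus lives in charts, hence the proof that |tau|^2 is independent of
    charts. The same fact makes it enough to know the estimates on x in one chart around each point
    of N. The regularity step is delicate because an index set may contain exponents <= 0 and
    logarithms there: single terms in the expansion of a bounded function need not be bounded, so no
    termwise bound of the derivative is available. Only the finitely many terms with exponent <= 0
    and the remainder of order x^0 are used. *)

Section RowVectors.
Context {R : realType}.

Lemma coord_norm_le n (v : 'rV[R]_n) i : `|v 0 i| <= `|v|.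
Proof.
rewrite [leRHS]/Num.Def.normr /= mx_normrE.
exact: (le_bigmax _ (fun ij => `|v ij.1 ij.2|) (0, i)).
Qed.

Lemma rV_norm_le n (v : 'rV[R]_n) e :
  0 <= e -> (forall i, `|v 0 i| <= e) -> `|v| <= e.
Proof.
move=> e0 H; rewrite [leLHS]/Num.Def.normr /= mx_normrE.
by apply: (bigmax_le _ e0) => -[i j] _ /=; rewrite (ord1 i).
Qed.

Lemma continuous_rV (T : topologicalType) n (f : T -> 'rV[R]_n) (p : T) :
  (forall a, {for p, continuous (fun q => f q 0 a)}) -> {for p, continuous f}.
Proof.
move=> H; apply/cvgrPdist_le => e e0.
near=> q; apply: rV_norm_le; first exact: ltW.
move=> i; rewrite !mxE; move: i; near: q; apply: filter_forall => i.
by have /cvgrPdist_le := H i; apply.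
Unshelve. all: by end_near. Qed.

Lemma open_closed_ball n (W : set 'rV[R]_n) p : open W -> W p ->
  exists2 r : R, 0 < r & forall q, `|q - p| <= r -> W q.
Proof.
move=> oW Wp; have /nbhs_ballP[r /= r0 H] := open_nbhs_nbhs (conj oW Wp).
exists (r / 2); first by rewrite divr_gt0.
move=> q qr; apply: H; rewrite mx_norm_ball /ball_ /= distrC.
by apply: le_lt_trans qr _; rewrite ltr_pdivrMr // ltr_pMr // ltr1n.
Qed.

Lemma norm_delta_le n (i : 'I_n) : `|delta_mx 0 i : 'rV[R]_n| <= 1.
Proof.
apply: rV_norm_le => // j; rewrite mxE eqxx /=.
by case: (j == i); rewrite ?normr1 ?normr0.
Qed.

End RowVectors.

(** * Mean value theorems and Fréchet differentiability *)

Section MeanValue.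
Context {R : realType}.

Lemma derive_line (V W : normedModType R) (f : V -> W) (p e : V) s :
  derivable f (p + s *: e) e ->
  is_derive s 1 (fun t => f (p + t *: e)) ('D_e f (p + s *: e)).
Proof.
move=> df; have E : (fun h : R => h^-1 *: (((fun t => f (p + t *: e)) \o shift s)
      (h *: 1) - f (p + s *: e))) =
   (fun h => h^-1 *: ((f \o shift (p + s *: e)) (h *: e) - f (p + s *: e))).
  apply/funext => h /=; congr (_ *: (f _ - _)).
  by rewrite [_ *: 1]mulr1 scalerDl addrCA.
split; first by rewrite /derivable E.
by rewrite /derive E.
Qed.

(** Both signs of [a] occur later, hence the symmetric range for [s] instead of an interval with
    endpoint 0. *)
Lemma line_mean_value (V : normedModType R) (f : V -> R) (p e : V) (a : R) :
  (forall s : R, `|s| <= `|a| -> derivable f (p + s *: e) e) ->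
  exists2 s : R, `|s| <= `|a| & f (p + a *: e) - f p = a * 'D_e f (p + s *: e).
Proof.
move=> df; pose g (t : R) : R := f (p + t *: e); pose dg (t : R) : R := 'D_e f (p + t *: e).
have dgP (s : R) : `|s| <= `|a| -> is_derive s 1 g (dg s).
  by move=> sa; apply: derive_line; apply: df.
have cg A : (forall s, A s -> `|s| <= `|a|) -> {within A, continuous g}.
  move=> HA; apply: continuous_in_subspaceT => s /set_mem/HA/dgP ds.
  apply: differentiable_continuous; apply/derivable1_diffP.
  exact: ex_derive.
have g0 : g 0 = f p by rewrite /g scale0r addr0.
have [a0|a0] := leP 0 a.
  have [||s] := @MVT_segment _ g dg 0 a a0.
  - move=> x; rewrite in_itv /= => /andP[x0 xa]; apply: dgP.
    by rewrite !ger0_norm ?(ltW x0) ?(ltW xa).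
  - by apply: cg => x; rewrite /= in_itv /= => /andP[x0 xa]; rewrite !ger0_norm.
  - rewrite in_itv /= => /andP[x0 xa] E; exists s; first by rewrite !ger0_norm.
    by rewrite -/(g a) -g0 E subr0 mulrC.
have [||s] := @MVT_segment _ g dg a 0 (ltW a0).
- move=> x; rewrite in_itv /= => /andP[x0 xa]; apply: dgP.
  by rewrite !ltr0_norm // lerN2 ltW.
- apply: cg => x; rewrite /= in_itv /= => /andP[x0 xa].
  by rewrite ler0_norm // ltr0_norm // lerN2.
- rewrite in_itv /= => /andP[x0 xa] E; exists s.
    by rewrite ler0_norm // ltr0_norm // lerN2.
  by rewrite -/(g a) -g0 -opprB E sub0r mulrN opprK mulrC.
Qed.

(** The coordinates are changed one at a time: [tr k] keeps the first k coordinates of [v],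
    consecutive truncations differ along one axis, and there the one-variable theorem applies. In
    the sup norm a truncation cannot leave the ball of radius [|v|]. *)
Lemma hadamard n (f : 'rV[R]_n -> R) (p v : 'rV[R]_n) :
  (forall q i, `|q - p| <= `|v| -> derivable f q (delta_mx 0 i)) ->
  exists2 xi : 'I_n -> 'rV[R]_n, (forall i, `|xi i - p| <= `|v|) &
    f (p + v) - f p = \sum_i v 0 i * partial i f (xi i).
Proof.
move=> df; pose tr k : 'rV[R]_n := \row_i (if (i < k)%N then v 0 i else 0).
have trS (i : 'I_n) : tr i.+1 = tr i + v 0 i *: delta_mx 0 i.
  apply/rowP => j; rewrite !mxE ltnS eqxx /= leq_eqVlt -val_eqE.
  case: eqP => [/val_inj ->|_] /=; first by rewrite ltnn add0r mulr1.
  by rewrite mulr0 addr0.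
have near_p (i : 'I_n) s : `|s| <= `|v 0 i| ->
    `|p + tr i + s *: delta_mx 0 i - p| <= `|v|.
  move=> si; rewrite addrAC [p + _]addrC addrK; apply: rV_norm_le => // j.
  rewrite !mxE eqxx /=; have [->|/negPf ji] := eqVneq j i.
    by rewrite ltnn add0r mulr1 (le_trans si) // coord_norm_le.
  rewrite mulr0 addr0; case: ifP => _; rewrite ?normr0 //.
  exact: coord_norm_le.
have /choice[xi xiP] : forall i : 'I_n, exists x : 'rV[R]_n, `|x - p| <= `|v| /\
    f (p + tr i.+1) - f (p + tr i) = v 0 i * partial i f x.
  move=> i; have [s si E] := @line_mean_value _ f (p + tr i) (delta_mx 0 i)
    (v 0 i) (fun s si => df _ i (near_p i s si)).
  exists (p + tr i + s *: delta_mx 0 i); split; first exact: near_p.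
  by rewrite trS addrA E.
exists xi => [i|]; first by have [] := xiP i.
under eq_bigr do rewrite -(proj2 (xiP _)).
rewrite -(big_mkord xpredT (fun i => f (p + tr i.+1) - f (p + tr i))).
rewrite (telescope_sumr (fun i => f (p + tr i))) //.
congr (f _ - f _).
  by congr (_ + _); apply/rowP => j; rewrite mxE ltn_ord.
by rewrite [tr 0%N](_ : _ = 0) ?addr0 //; apply/rowP => j; rewrite !mxE ltn0.
Qed.

End MeanValue.

Section Differentiability.
Context {R : realType}.

Lemma CkS k n (W : set 'rV[R]_n) f :
  Ck k.+1 W f -> forall p i, W p ->
  is_derive p (delta_mx 0 i) f (partial i f p).
Proof. by move=> [_ H] p i Wp; apply: derivableP; apply: (H i).1. Qed.

(** The candidate for the Fréchet differential when [c] lists the partial derivatives; it is made a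
    linear map so that uniqueness of the differential applies to it. *)
Definition lincomb n (c : 'I_n -> R) (v : 'rV[R]_n) : R := \sum_i v 0 i * c i.

Lemma lincomb_is_linear n (c : 'I_n -> R) : linear (lincomb c).
Proof.
move=> a u v; rewrite /lincomb scaler_sumr -big_split /=.
by apply: eq_bigr => i _; rewrite !mxE mulrDl -mulrA.
Qed.

HB.instance Definition _ n (c : 'I_n -> R) :=
  GRing.isLinear.Build R 'rV[R]_n R _ (lincomb c) (lincomb_is_linear c).

Lemma continuous_sum (T : topologicalType) (I : Type) (s : seq I) (P : pred I)
    (F : I -> T -> R) (p : T) :
  (forall i, P i -> {for p, continuous (F i)}) ->
  {for p, continuous (fun q => \sum_(i <- s | P i) F i q)}.
Proof.
move=> cF; rewrite /prop_for /continuous_at.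
elim: s => [|i s IH]; first by rewrite big_nil; under eq_fun do rewrite big_nil; exact: cvg_cst.
rewrite big_cons; under eq_fun do rewrite big_cons; case: ifP => // Pi.
by apply: cvgD; [exact: cF|exact: IH].
Qed.

Lemma continuous_at_cst (T : topologicalType) (c : R) (p : T) :
  {for p, continuous (fun=> c)}.
Proof. exact: cvg_cst. Qed.

Lemma continuous_atM (T : topologicalType) (f g : T -> R) (p : T) :
  {for p, continuous f} -> {for p, continuous g} ->
  {for p, continuous (fun q => f q * g q)}.
Proof. exact: cvgM. Qed.

Lemma lincomb_continuous n (c : 'I_n -> R) : continuous (lincomb c).
Proof.
move=> v; apply: continuous_sum => i _.
apply: continuous_atM; last exact: continuous_at_cst.
exact: coord_continuous.
Qed.

(** [hadamard] writes the increment with partial derivatives taken near [p]; their continuity allows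
    the points to be moved to [p] at the cost of a small multiple of [|h|]. *)
Lemma C1_expansion n (V := 'rV[R]_n : normedModType R) (W : set V)
    (f : V -> R) (p : V) : open W -> Ck 1 W f -> W p ->
  f \o shift p = cst (f p) + lincomb (fun i => partial i f p) +o_ (0 : V) id.
Proof.
move=> oW C1f Wp; apply/eqaddoP => e e0.
have [r r0 rW] := open_closed_ball oW Wp.
have n0 : 0 < n%:R + 1 :> R by rewrite ltr_wpDl.
(* Dividing by n + 1 instead of n also covers dimension 0. *)
pose e' := e / (n%:R + 1); have e'0 : 0 < e' by rewrite divr_gt0.
have cp : \forall q \near p, forall i, `|partial i f p - partial i f q| <= e'.
  near=> q => i; move: i; near: q; apply: filter_forall => i.
  have [_ /(_ i)[_ [/(_ _ Wp)]]] := C1f.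
  by move=> /cvgrPdist_le/(_ _ e'0).
have /nbhs_ballP[r' /= r'0 r'P] := cp.
have rr'0 : 0 < Num.min r r' by rewrite lt_min r0.
apply: filterS (nbhsx_ballx (0 : V) _ rr'0) => h.
rewrite mx_norm_ball /ball_ /= sub0r normrN lt_min => /andP[/ltW hr hr'].
have [q i qh|xi xih E] := @hadamard _ _ f p h.
  by apply: ex_derive; apply: (CkS C1f); apply: rW; apply: le_trans qh hr.
rewrite !fctE /= [h + p]addrC opprD addrA E -sumrB.
have -> : e * `|h| = (n%:R * e' + e') * `|h|.
  by congr (_ * _); rewrite /e'; field; rewrite gt_eqF.
apply: le_trans (ler_norm_sum _ _ _) _.
apply: (@le_trans _ _ (\sum_(i < n) e' * `|h|)).
  apply: ler_sum => i _; rewrite -mulrBr normrM mulrC ler_pM ?coord_norm_le //.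
  rewrite distrC; apply: r'P => /=; rewrite mx_norm_ball /ball_ /= distrC.
  exact: le_lt_trans (xih i) hr'.
have -> : \sum_(i < n) e' * `|h| = n%:R * e' * `|h|.
  by rewrite sumr_const card_ord -[LHS]mulr_natl mulrA.
by rewrite ler_wpM2r // lerDl ltW.
Unshelve. all: by end_near. Qed.

Lemma C1_differentiable n (W : set 'rV[R]_n) f p : open W -> Ck 1 W f -> W p ->
  differentiable f p.
Proof.
move=> oW C1f Wp; have E := C1_expansion oW C1f Wp.
have D := diff_unique (@lincomb_continuous n (fun i => partial i f p)) E.
apply/diff_locallyP; rewrite D; split => //; exact: lincomb_continuous.
Qed.

Lemma C1_diff n (W : set 'rV[R]_n) f p : open W -> Ck 1 W f -> W p ->
  forall v, 'd f p v = \sum_i v 0 i * partial i f p.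
Proof.
move=> oW C1f Wp v; have E := C1_expansion oW C1f Wp.
by rewrite (diff_unique (@lincomb_continuous n (fun i => partial i f p)) E).
Qed.

Lemma C1_differentiable_rV m n (W : set 'rV[R]_m) (f : 'rV[R]_m -> 'rV[R]_n) p :
  open W -> (forall a, Ck 1 W (rowfun f a)) -> W p -> differentiable f p.
Proof.
move=> oW C1f Wp.
have -> : f = \sum_(a < n) (fun q => rowfun f a q *: delta_mx 0 a).
  apply/funext => q; rewrite fct_sumE; exact: row_sum_delta.
apply: differentiable_sum => a; apply: differentiableZl.
exact: C1_differentiable (C1f a) Wp.
Qed.

Lemma jacobianE m n (W : set 'rV[R]_m) (f : 'rV[R]_m -> 'rV[R]_n) p i a :
  open W -> (forall a, Ck 1 W (rowfun f a)) -> W p ->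
  'J f p i a = partial i (rowfun f a) p.
Proof.
move=> oW C1f Wp; have df := C1_differentiable_rV oW C1f Wp.
have := deriveEjacobian (delta_mx 0 i) df; rewrite -rowE => /rowP/(_ a).
by rewrite mxE => <-; rewrite derive_mx ?mxE //; apply: diff_derivable.
Qed.

Lemma partial_comp m n (W : set 'rV[R]_m) (O : set 'rV[R]_n)
    (f : 'rV[R]_m -> 'rV[R]_n) phi p i :
  open W -> open O -> (forall a, Ck 1 W (rowfun f a)) -> Ck 1 O phi ->
  W p -> O (f p) ->
  partial i (phi \o f) p =
    \sum_a partial a phi (f p) * partial i (rowfun f a) p.
Proof.
move=> oW oO C1f C1phi Wp Ofp; have df := C1_differentiable_rV oW C1f Wp.
have dphi := C1_differentiable oO C1phi Ofp.
rewrite /partial deriveE; last exact: differentiable_comp.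
rewrite diff_comp //= (C1_diff oO C1phi Ofp); apply: eq_bigr => a _.
rewrite mulrC; congr (_ * _); rewrite -deriveE // derive_mx ?mxE //.
exact: diff_derivable.
Qed.

Lemma partial_comp_derivable m n (W : set 'rV[R]_m) (O : set 'rV[R]_n)
    (f : 'rV[R]_m -> 'rV[R]_n) phi p i :
  open W -> open O -> (forall a, Ck 1 W (rowfun f a)) -> Ck 1 O phi ->
  W p -> O (f p) -> derivable (phi \o f) p (delta_mx 0 i).
Proof.
move=> oW oO C1f C1phi Wp Ofp; apply: diff_derivable.
apply: differentiable_comp; first exact: C1_differentiable_rV oW C1f Wp.
exact: C1_differentiable C1phi Ofp.
Qed.

End Differentiability.

(** * Closure properties of C^k functions *)

Section CkClosure.
Context {R : realType} {n : nat}.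
Local Notation V := 'rV[R]_n.
Implicit Types (W : set V) (f g : V -> R) (k : nat).

Lemma continuous_atD (T : topologicalType) (f g : T -> R) (p : T) :
  {for p, continuous f} -> {for p, continuous g} ->
  {for p, continuous (fun q => f q + g q)}.
Proof. exact: cvgD. Qed.

Lemma continuous_atV (T : topologicalType) (f : T -> R) (p : T) :
  f p != 0 -> {for p, continuous f} -> {for p, continuous (fun q => (f q)^-1)}.
Proof. exact: cvgV. Qed.

Lemma Ck_continuous k W f p : Ck k W f -> W p -> {for p, continuous f}.
Proof. by case: k => [|k] [cf _] Wp; exact: cf. Qed.

Lemma Ck_partial k W f i : Ck k.+1 W f -> Ck k W (partial i f).
Proof. by move=> [_ /(_ i)[]]. Qed.

Lemma Ck_derivable k W f i p :
  Ck k.+1 W f -> W p -> derivable f p (delta_mx 0 i).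
Proof. by move=> [_ /(_ i)[H _]] Wp; exact: H. Qed.

Lemma Ck_sub k W W' f : W' `<=` W -> Ck k W f -> Ck k W' f.
Proof.
move=> sW; elim: k f => [|k IH] f [cf H]; split=> //; try by move=> p /sW/cf.
by move=> i; split=> [p /sW|]; [case: (H i) => + _; exact|exact: IH (H i).2].
Qed.

Lemma Ck_pred k W f : Ck k.+1 W f -> Ck k W f.
Proof.
elim: k f => [|k IH] f [cf H]; split=> // i; split; first exact: (H i).1.
exact: IH (H i).2.
Qed.

Lemma Ck_le j k W f : (j <= k)%N -> Ck k W f -> Ck j W f.
Proof.
elim: k => [|k IH]; first by rewrite leqn0 => /eqP ->.
by rewrite leq_eqVlt => /predU1P[-> //|/IH] H /Ck_pred.
Qed.

Lemma open_near_eq W p f g : open W -> W p -> (forall q, W q -> f q = g q) ->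
  {near p, f =1 g}.
Proof.
by move=> oW Wp fg; have := open_nbhs_nbhs (conj oW Wp); apply: filterS => q /fg.
Qed.

Lemma near_eq_continuous f g p :
  {near p, f =1 g} -> {for p, continuous f} -> {for p, continuous g}.
Proof.
move=> fg cf; rewrite /prop_for /continuous_at -(nbhs_singleton fg).
exact: cvg_trans (near_eq_cvg fg) cf.
Qed.

Lemma Ck_eq k W f g : open W -> (forall q, W q -> f q = g q) ->
  Ck k W f -> Ck k W g.
Proof.
move=> oW; elim: k f g => [|k IH] f g fg [cf H]; split=> //.
- by move=> p Wp; apply: near_eq_continuous (cf p Wp); exact: open_near_eq fg.
- by move=> p Wp; apply: near_eq_continuous (cf p Wp); exact: open_near_eq fg.
move=> i; split=> [p Wp|].
  by apply: near_eq_derivable ((H i).1 p Wp); exact: open_near_eq fg.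
apply: (IH (partial i f)); last exact: (H i).2.
by move=> q Wq; apply: near_eq_derive; exact: open_near_eq fg.
Qed.

(** The inductive step of every closure rule below: the proposed derivatives [g i] have to match
    those of [f] on W only, because [Ck] on an open set ignores all values outside it. *)
Lemma CkS_is_derive k W f (g : 'I_n -> V -> R) : open W ->
  (forall p, W p -> {for p, continuous f}) ->
  (forall p i, W p -> is_derive p (delta_mx 0 i) f (g i p)) ->
  (forall i, Ck k W (g i)) -> Ck k.+1 W f.
Proof.
move=> oW cf df Cg; split=> // i; split=> [p Wp|].
  by have [] := df p i Wp.
by apply: (Ck_eq oW) (Cg i) => // p Wp; have [_ <-] := df p i Wp.
Qed.

Lemma Ck_cst k W c : Ck k W (fun=> c).
Proof.
elim: k c => [|k IH] c; split=> //; try by move=> p _; exact: continuous_at_cst.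
move=> i; split=> [p _|]; first exact: derivable_cst.
by rewrite [partial _ _](_ : _ = fun=> 0) //; apply/funext => p; exact: derive_cst.
Qed.

Lemma CkD k W f g : open W -> Ck k W f -> Ck k W g ->
  Ck k W (fun q => f q + g q).
Proof.
move=> oW; elim: k f g => [|k IH] f g Cf Cg.
  by split=> // p Wp; apply: continuous_atD; [exact: Cf.1|exact: Cg.1].
apply: (@CkS_is_derive k W _ (fun i q => partial i f q + partial i g q)) => //.
- by move=> p Wp; apply: continuous_atD; [exact: Cf.1|exact: Cg.1].
- by move=> p i Wp; exact: is_deriveD (CkS Cf i Wp) (CkS Cg i Wp).
- by move=> i; apply: IH; exact: Ck_partial.
Qed.

Lemma CkM k W f g : open W -> Ck k W f -> Ck k W g ->
  Ck k W (fun q => f q * g q).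
Proof.
move=> oW; elim: k f g => [|k IH] f g Cf Cg.
  by split=> // p Wp; apply: continuous_atM; [exact: Cf.1|exact: Cg.1].
apply: (@CkS_is_derive k W _
  (fun i q => f q * partial i g q + g q * partial i f q)) => //.
- by move=> p Wp; apply: continuous_atM; [exact: Cf.1|exact: Cg.1].
- move=> p i Wp.
  have Df := CkS Cf i Wp.
  have Dg := CkS Cg i Wp.
  exact: is_deriveM Df Dg.
- move=> i; apply: CkD => //.
    by apply: IH; [exact: Ck_pred|exact: Ck_partial].
  by apply: IH; [exact: Ck_pred|exact: Ck_partial].
Qed.

Lemma CkV k W f : open W -> (forall q, W q -> f q != 0) -> Ck k W f ->
  Ck k W (fun q => (f q)^-1).
Proof.
move=> oW f0; elim: k => [|k IH] Cf.
  by split=> // p Wp; apply: continuous_atV; [exact: f0|exact: Cf.1].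
apply: (@CkS_is_derive k W _
  (fun i q => - ((f q)^-1 * (f q)^-1) * partial i f q)) => //.
- by move=> p Wp; apply: continuous_atV; [exact: f0|exact: Cf.1].
- move=> p i Wp; have D := CkS Cf i Wp.
  split; first by apply: derivableV; [exact: f0|exact: ex_derive].
  rewrite deriveV; [|exact: f0|exact: ex_derive].
  by rewrite derive_val -invfM -expr2.
- move=> i; apply: CkM => //; last exact: Ck_partial.
  rewrite [X in Ck _ _ X](_ : _ = fun q => -1 * ((f q)^-1 * (f q)^-1)).
    apply: CkM => //; first exact: Ck_cst.
    by apply: CkM => //; apply: IH; exact: Ck_pred.
  by apply/funext => q; rewrite mulN1r.
Qed.

Lemma Ck_coord k W i : Ck k W (fun q => q 0 i).
Proof.
have cc p : {for p, continuous (fun q : V => q 0 i)} by exact: coord_continuous.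
case: k => [|k]; split=> // j.
have D p : is_derive p (delta_mx 0 j) (fun q : V => q 0 i) (i == j)%:R.
  split; first by apply: diff_derivable; exact: differentiable_coord.
  have := derive_mx (@derivable_id R V p (delta_mx 0 j)).
  rewrite derive_id => /rowP/(_ i); rewrite !mxE eqxx /= => ->.
  by [].
split=> [p _|]; first exact: (@ex_derive _ _ _ _ _ _ _ (D p)).
rewrite [partial _ _](_ : _ = fun=> (i == j)%:R); first exact: Ck_cst.
by apply/funext => p; have [_ <-] := D p.
Qed.

End CkClosure.

Section CkComposition.
Context {R : realType}.

Lemma is_derive_comp1 n (W : set 'rV[R]_n) f p i (F : R -> R) dF :
  open W -> Ck 1 W f -> W p -> is_derive (f p) 1 F dF ->
  is_derive p (delta_mx 0 i) (F \o f) (dF * partial i f p).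
Proof.
move=> oW Cf Wp [dF1 dF2]; have df := C1_differentiable oW Cf Wp.
have dF' := (derivable1_diffP F (f p)).1 dF1.
split; first by apply: diff_derivable; exact: differentiable_comp.
rewrite deriveE; last exact: differentiable_comp.
by rewrite diff_comp //= deriv1E // derive1E dF2 -deriveE // [LHS]mulrC.
Qed.

Lemma continuous_at_comp1 n (f : 'rV[R]_n -> R) p (F : R -> R) dF :
  {for p, continuous f} -> is_derive (f p) 1 F dF ->
  {for p, continuous (F \o f)}.
Proof.
move=> cf [dF1 _]; apply: continuous_comp => //.
by apply: differentiable_continuous; apply/derivable1_diffP.
Qed.

Lemma Ck_ln n k (W : set 'rV[R]_n) f : open W -> (forall q, W q -> 0 < f q) ->
  Ck k W f -> Ck k W (fun q => ln (f q)).
Proof.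
move=> oW f0; case: k => [|k] Cf.
  split=> // p Wp; apply: continuous_at_comp1 (Cf.1 p Wp) _.
  exact: is_derive1_ln (f0 p Wp).
apply: (@CkS_is_derive _ _ k W _ (fun i q => (f q)^-1 * partial i f q)) => //.
- move=> p Wp; apply: continuous_at_comp1 (Cf.1 p Wp) _.
  exact: is_derive1_ln (f0 p Wp).
- move=> p i Wp; apply: (is_derive_comp1 i oW (Ck_le (ltn0Sn k) Cf) Wp).
  exact: is_derive1_ln (f0 p Wp).
- move=> i; apply: CkM => //; last exact: Ck_partial.
  by apply: CkV => //; [move=> q /f0; exact: lt0r_neq0|exact: Ck_pred].
Qed.

Lemma Ck_powR n k (W : set 'rV[R]_n) f (a : R) :
  open W -> (forall q, W q -> 0 < f q) ->
  Ck k W f -> Ck k W (fun q => f q `^ a).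
Proof.
move=> oW f0; elim: k a => [|k IH] a Cf.
  split=> // p Wp; apply: (continuous_at_comp1 (F := fun x => x `^ a)
    (Cf.1 p Wp)).
  exact: is_derive1_powR (f0 p Wp).
apply: (@CkS_is_derive _ _ k W _
   (fun i q => a * f q `^ (a - 1) * partial i f q)) => //.
- move=> p Wp; apply: (continuous_at_comp1 (F := fun x => x `^ a)
    (Cf.1 p Wp)).
  exact: is_derive1_powR (f0 p Wp).
- move=> p i Wp; apply: (is_derive_comp1 (F := fun x => x `^ a) i oW
    (Ck_le (ltn0Sn k) Cf) Wp).
  exact: is_derive1_powR (f0 p Wp).
- move=> i; apply: CkM => //; last exact: Ck_partial.
  by apply: CkM => //; [exact: Ck_cst|apply: IH; exact: Ck_pred].
Qed.

Lemma Ck_sum n k (W : set 'rV[R]_n) (I : Type) (s : seq I) (P : pred I)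
    (F : I -> 'rV[R]_n -> R) : open W -> (forall i, P i -> Ck k W (F i)) ->
  Ck k W (fun q => \sum_(i <- s | P i) F i q).
Proof.
move=> oW CF; elim: s => [|i s IH].
  by apply: (Ck_eq oW) (Ck_cst k W 0) => q _; rewrite big_nil.
case: (boolP (P i)) => Pi.
  apply: (Ck_eq oW) (CkD oW (CF i Pi) IH) => q _.
  by rewrite big_cons Pi.
by apply: (Ck_eq oW) IH => q _; rewrite big_cons (negPf Pi).
Qed.

Lemma Ck_comp m n k (W : set 'rV[R]_m) (O : set 'rV[R]_n)
    (f : 'rV[R]_m -> 'rV[R]_n) phi : open W -> open O ->
  (forall q, W q -> O (f q)) -> (forall a, Ck k W (rowfun f a)) -> Ck k O phi ->
  Ck k W (phi \o f).
Proof.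
move=> oW oO fO.
have cont k' phi' p : (forall a, Ck k' W (rowfun f a)) -> Ck k' O phi' ->
    W p -> {for p, continuous (phi' \o f)}.
  move=> Cf Cphi Wp; apply: continuous_comp.
    by apply: continuous_rV => a; exact: Ck_continuous (Cf a) Wp.
  by apply: Ck_continuous Cphi _; exact: fO.
elim: k phi => [|k IH] phi Cf Cphi; first by split=> // p; exact: cont.
apply: (@CkS_is_derive _ _ k W _ (fun i q =>
   \sum_a partial a phi (f q) * partial i (rowfun f a) q)) => //.
- by move=> p; exact: cont.
- have C1f a := Ck_le (ltn0Sn k) (Cf a); have C1p := Ck_le (ltn0Sn k) Cphi.
  move=> p i Wp; split.
    exact: partial_comp_derivable oW oO C1f C1p Wp (fO p Wp).
  exact: (partial_comp i oW oO C1f C1p Wp (fO p Wp)).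
- move=> i; apply: Ck_sum => // a _; apply: CkM => //.
    by apply: IH => [b|]; [exact: Ck_pred|exact: Ck_partial].
  exact: Ck_partial.
Qed.

Lemma derivable_translate n (f : 'rV[R]_n -> R) (c q e : 'rV[R]_n) :
  derivable f (q + c) e -> derivable (fun x => f (x + c)) q e.
Proof.
rewrite /derivable.
by under [X in cvg (X @ _)]eq_fun => h do rewrite /= addrA.
Qed.

Lemma derive_translate n (f : 'rV[R]_n -> R) (c q e : 'rV[R]_n) :
  'D_e (fun x => f (x + c)) q = 'D_e f (q + c).
Proof.
rewrite /derive; have -> : (fun h : R => h^-1 *: (((fun x => f (x + c)) \o shift q)
    (h *: e) - f (q + c))) =
  (fun h => h^-1 *: ((f \o shift (q + c)) (h *: e) - f (q + c))); last by [].
by apply/funext => h /=; rewrite addrA.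
Qed.

(** The mean value theorem is used twice, along i for the increment [G] in direction j, then along j
    for [partial i f]. *)
Lemma second_difference n (W : set 'rV[R]_n) f p i j (s : R) :
  Ck 2 W f -> 0 < s ->
  (forall q, `|q - p| <= 2 * s -> W q) ->
  exists2 q, `|q - p| <= 2 * s &
    f (p + s *: delta_mx 0 i + s *: delta_mx 0 j) - f (p + s *: delta_mx 0 i)
    - f (p + s *: delta_mx 0 j) + f p = s * (s * partial j (partial i f) q).
Proof.
move=> Cf s0 sW; pose ei : 'rV[R]_n := delta_mx 0 i.
pose ej : 'rV[R]_n := delta_mx 0 j.
have near2 a b : `|a| <= s -> `|b| <= s -> `|p + a *: ei + b *: ej - p| <= 2 * s.
  move=> ha hb; rewrite addrAC [p + _]addrC addrK mulr_natl mulr2n.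
  apply: le_trans (ler_normD _ _) _; rewrite !normrZ.
  apply: lerD; rewrite -[leRHS]mulr1; apply: ler_pM => //; exact: norm_delta_le.
have near1 a : `|a| <= s -> `|p + a *: ei - p| <= 2 * s.
  by move=> ha; rewrite -[p + _](addr0 _) -(scale0r ej) near2 // normr0 ltW.
have ss : `|s| <= s by rewrite ger0_norm // ltW.
pose G x := f (x + s *: ej) - f x.
have dG (a : R) : `|a| <= `|s| -> derivable G (p + a *: ei) ei.
  rewrite (gtr0_norm s0) => ha; apply: derivableB.
    by apply: derivable_translate; apply: Ck_derivable Cf _; apply/sW/near2.
  by apply: Ck_derivable Cf _; apply/sW/near1.
have [a ha Ea] := line_mean_value dG; rewrite (gtr0_norm s0) in ha.
have dP (b : R) : `|b| <= `|s| -> derivable (partial i f) (p + a *: ei + b *: ej) ej.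
  rewrite (gtr0_norm s0) => hb.
  by apply: Ck_derivable (Ck_partial i Cf) _; apply/sW/near2.
have [b hb Eb] := line_mean_value dP; rewrite (gtr0_norm s0) in hb.
exists (p + a *: ei + b *: ej); first exact: near2.
rewrite -Eb; move: Ea; rewrite deriveB.
- rewrite derive_translate => <-; rewrite /G -/ei -/ej.
  by rewrite opprB addrA [_ - f _ + f p]addrC; ring.
- by apply: derivable_translate; apply: Ck_derivable Cf _; apply/sW/near2.
- by apply: Ck_derivable Cf _; apply/sW/near1.
Qed.

(** The second difference is symmetric in i and j, so the two mixed derivatives take a common value
    at two points close to [p]; continuity of both then bounds their difference at [p] by any e >
    0. *)
Lemma partialC n (W : set 'rV[R]_n) f p i j : open W -> Ck 2 W f -> W p ->
  partial i (partial j f) p = partial j (partial i f) p.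
Proof.
move=> oW Cf Wp; apply/eqP; rewrite -subr_eq0 -normr_le0.
apply/ler_addgt0Pr => e e0; rewrite add0r.
have [r r0 rW] := open_closed_ball oW Wp.
have cc i' j' : exists2 d, 0 < d & forall q, `|q - p| <= d ->
    `|partial i' (partial j' f) p - partial i' (partial j' f) q| <= e / 2.
  have c : {for p, continuous (partial i' (partial j' f))}.
    exact: Ck_continuous (Ck_partial i' (Ck_partial j' Cf)) Wp.
  have /cvgrPdist_le/(_ (e / 2)) := c; rewrite divr_gt0 // => /(_ isT) H.
  have /nbhs_ballP[d /= d0 dP] := H; exists (d / 2); first by rewrite divr_gt0.
  move=> q qd; apply: dP; rewrite /= mx_norm_ball /ball_ /= distrC.
  by apply: le_lt_trans qd _; rewrite ltr_pdivrMr // ltr_pMr // ltr1n.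
have [d d0 dP] := cc i j; have [d' d'0 d'P] := cc j i.
have [s s0 s2] : exists2 s : R, 0 < s & 2 * s = Num.min r (Num.min d d').
  exists (Num.min r (Num.min d d') / 2); last by rewrite mulrC divfK.
  by rewrite divr_gt0 // !lt_min r0 d0.
have sW q : `|q - p| <= 2 * s -> W q.
  by rewrite s2 le_min => /andP[+ _]; exact: rW.
have [q qs Eq] := second_difference i j Cf s0 sW.
have [q' qs' Eq'] := second_difference j i Cf s0 sW.
have E : partial i (partial j f) q' = partial j (partial i f) q.
  apply: (mulfI (lt0r_neq0 s0)); apply: (mulfI (lt0r_neq0 s0)).
  apply: etrans (esym Eq') _; apply: etrans _ Eq.
  by rewrite [p + _ + _]addrAC; congr (_ + _); exact: addrAC.
move: qs qs'; rewrite s2 !le_min => /and3P[_ _ /d'P h1] /and3P[_ /dP h2 _].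
move: E h1 h2; move: (partial j (partial i f) p) (partial i (partial j f) p).
move: (partial j (partial i f) q) (partial i (partial j f) q').
move=> c _ a b -> h1 h2; apply: le_trans (ler_distD c _ _) _.
by rewrite [leRHS]splitr lerD // distrC.
Qed.

End CkComposition.


Section PartialRules.
Context {R : realType} {n : nat}.
Local Notation V := 'rV[R]_n.
Variables (W : set V) (p : V) (i : 'I_n).
Implicit Types (f g : V -> R).

Lemma partial_cst c : partial i (fun=> c) p = 0.
Proof. exact: derive_cst. Qed.

Lemma partial_coord j : partial i (fun q : V => q 0 j) p = (j == i)%:R.
Proof.
have := derive_mx (@derivable_id R V p (delta_mx 0 i)).
by rewrite derive_id => /rowP/(_ j); rewrite !mxE eqxx /= => ->.
Qed.

Lemma partialD f g : Ck 1 W f -> Ck 1 W g -> W p ->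
  partial i (fun q => f q + g q) p = partial i f p + partial i g p.
Proof. move=> Cf Cg Wp.
by have [_ <-] := is_deriveD (CkS Cf i Wp) (CkS Cg i Wp). Qed.

Lemma partialM f g : Ck 1 W f -> Ck 1 W g -> W p ->
  partial i (fun q => f q * g q) p = f p * partial i g p + g p * partial i f p.
Proof.
move=> Cf Cg Wp.
have Df := CkS Cf i Wp.
have Dg := CkS Cg i Wp.
have D := is_deriveM Df Dg.
exact: (@derive_val _ _ _ _ _ _ _ D).
Qed.

Lemma partialZ c f : Ck 1 W f -> W p ->
  partial i (fun q => c * f q) p = c * partial i f p.
Proof.
by move=> Cf Wp; rewrite (partialM (Ck_cst 1 W c) Cf Wp) partial_cst mulr0 addr0.
Qed.

Lemma partialV f : Ck 1 W f -> W p -> f p != 0 ->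
  partial i (fun q => (f q)^-1) p = - partial i f p / f p ^+ 2.
Proof.
move=> Cf Wp f0; rewrite /partial (deriveV f0 (@ex_derive _ _ _ _ _ _ _ (CkS Cf i Wp))).
by rewrite [LHS]mulrC mulrN mulNr.
Qed.

Lemma partial_sum (I : Type) (s : seq I) (P : pred I) (F : I -> V -> R) :
  open W -> (forall j, P j -> Ck 1 W (F j)) -> W p ->
  partial i (fun q => \sum_(j <- s | P j) F j q) p =
  \sum_(j <- s | P j) partial i (F j) p.
Proof.
move=> oW CF Wp; elim: s => [|j s IH].
  rewrite big_nil -[RHS](partial_cst 0).
  by rewrite (_ : (fun q => _) = fun=> 0) //; apply/funext => q; rewrite big_nil.
rewrite big_cons -IH; case: (boolP (P j)) => Pj.
  rewrite -partialD //; [|exact: CF|exact: Ck_sum].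
  by congr (partial i _ p); apply/funext => q; rewrite big_cons Pj.
by congr (partial i _ p); apply/funext => q; rewrite big_cons (negPf Pj).
Qed.

End PartialRules.

Section CkBasics.
Context {R : realType} {n : nat}.
Local Notation V := 'rV[R]_n.
Implicit Types (W : set V) (f g : V -> R).

Lemma partialE i f p : partial i f p = 'D_(delta_mx 0 i) f p.
Proof. by []. Qed.

Lemma partial_near i f g p : {near p, f =1 g} -> partial i f p = partial i g p.
Proof. exact: near_eq_derive. Qed.

End CkBasics.

Opaque Ck partial.

(** * First and second derivative tests at a maximum *)

Section MaximumTest.
Context {R : realType} {n : nat}.
Variables (W : set 'rV[R]_n) (f : 'rV[R]_n -> R) (p : 'rV[R]_n).
Hypotheses (oW : open W) (Cf : Ck 2 W f) (Wp : W p).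
Hypothesis max_p : forall q, W q -> f q <= f p.

Lemma segment_in_open (v : 'rV[R]_n) :
  exists2 d : R, 0 < d & forall t, `|t| <= d -> W (p + t *: v).
Proof.
have [r r0 rW] := open_closed_ball oW Wp.
have v0 : 0 < `|v| + 1 by rewrite ltr_wpDl.
exists (r / (`|v| + 1)); first by rewrite divr_gt0.
move=> t; rewrite ler_pdivlMr // => ht; apply: rW.
rewrite addrC addKr normrZ; apply: le_trans ht.
by rewrite ler_wpM2l // lerDl.
Qed.

Lemma critical_at_max i : partial i f p = 0.
Proof.
pose e : 'rV[R]_n := delta_mx 0 i.
have [d d0 dW] := segment_in_open e.
have inW t : t \in `](- d), d[%R -> W (p + t *: e).
  by rewrite in_itv /= => /andP[h1 h2]; apply: dW; rewrite ler_norml !ltW.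
have D t : W (p + t *: e) ->
    is_derive t 1 (fun t => f (p + t *: e)) ('D_e f (p + t *: e)).
  by move=> Wt; apply: derive_line; exact: Ck_derivable Cf Wt.
have c0 : 0 \in `](- d), d[%R by rewrite in_itv /= oppr_lt0 d0.
have := @derive1_at_max _ (fun t : R => f (p + t *: e)) (- d) d 0.
case=> // [|t /inW/D[]//|t /inW Wt|_ H].
- by rewrite lerNl (le_trans _ (ltW d0)) // oppr_le0 ltW.
- by rewrite scale0r addr0; exact: max_p.
by have [_] := D 0 (inW 0 c0); rewrite H scale0r addr0 partialE => <-.
Qed.

(** Otherwise the directional derivative [G], which is 0 at [p], would have positive derivative
    along [v], hence be positive just after [p], and [f] would increase along the segment leaving
    [p]. *)
Lemma hessian_at_max (v : 'rV[R]_n) :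
  \sum_i \sum_j v 0 i * v 0 j * partial i (partial j f) p <= 0.
Proof.
rewrite leNgt; apply/negP => H0.
have C1f := Ck_pred Cf.
pose G q := \sum_j v 0 j * partial j f q.
have DG q : W q -> 'D_v f q = G q.
  move=> Wq; rewrite deriveE; last exact: C1_differentiable C1f Wq.
  exact: (C1_diff oW C1f Wq).
have C1G : Ck 1 W G.
  by apply: (Ck_sum _ oW) => j _; exact: CkM oW (Ck_cst _ _ _) (Ck_partial j Cf).
have Gp : G p = 0 by rewrite /G big1 // => j _; rewrite critical_at_max mulr0.
have dG : derivable G p v.
  by apply: diff_derivable; exact: C1_differentiable C1G Wp.
have EG : 'D_v G p = \sum_i \sum_j v 0 i * v 0 j * partial i (partial j f) p.
  rewrite deriveE; last exact: C1_differentiable C1G Wp.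
  rewrite (C1_diff oW C1G Wp); apply: eq_bigr => i _.
  rewrite /G (partial_sum _ _ oW _ Wp) => [|j _]; last first.
    exact: CkM oW (Ck_cst _ _ _) (Ck_partial j Cf).
  rewrite mulr_sumr; apply: eq_bigr => j _.
  by rewrite (partialZ _ _ (Ck_partial j Cf) Wp) mulrA.
clearbody G; rewrite -EG in H0.
have [d d0 dW] := segment_in_open v.
pose g t := G (p + t *: v).
have [dg1 dg2] : is_derive (0 : R) (1 : R) g ('D_v G p).
  have E0 : p + 0 *: v = p by rewrite scale0r addr0.
  by have D0 := @derive_line _ _ _ G p v 0; rewrite E0 in D0; exact: D0.
move: dg1; rewrite /derivable; set q := (X in cvg (X @ _)) => cq.
have qH : q @ 0^' --> 'D_v G p by rewrite -dg2; exact: cq.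
have /cvgr_gt/(_ _ H0)[e /= e0 eP] := qH.
pose a := Num.min d (e / 2).
have a0 : 0 < a by rewrite lt_min d0 divr_gt0.
have ad : a <= d by rewrite ge_min lexx.
have ae : a < e.
  by rewrite gt_min ltr_pdivrMr // [X in _ || X]ltr_pMr // ltr1n orbT.
have gpos t : 0 < t -> t <= a -> 0 < g t.
  move=> t0 ta; have := eP t; rewrite /= sub0r normrN gtr0_norm //.
  move=> /(_ (le_lt_trans ta ae) (lt0r_neq0 t0)).
  rewrite /q /= addr0 [_ *: 1]mulr1 /g scale0r addr0 Gp subr0.
  by rewrite -[_ *: _]/(_ * _) pmulr_rgt0 // invr_gt0.
pose F t := f (p + t *: v).
have dF t : 0 <= t -> t <= a -> is_derive t (1 : R) F (g t).
  move=> t0 ta; have Wt : W (p + t *: v).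
    by apply: dW; rewrite ger0_norm // (le_trans ta).
  have D0 : derivable f (p + t *: v) v.
    by apply: diff_derivable; exact: (C1_differentiable oW C1f Wt).
  by have := derive_line D0; rewrite (DG _ Wt).
have dF' t : t \in `]0, a[%R -> is_derive t (1 : R) F (g t).
  by rewrite in_itv /= => /andP[t0 ta]; apply: dF; exact: ltW.
have [|c] := MVT a0 dF'.
  apply: continuous_in_subspaceT => t /set_mem; rewrite /= in_itv /=.
  move=> /andP[t0 ta]; have [dFt _] := dF t t0 ta.
  by apply: differentiable_continuous; apply/derivable1_diffP.
rewrite in_itv /= => /andP[c0 ca] E.
have : 0 < F a - F 0 by rewrite E subr0 mulr_gt0 // gpos // ltW.
rewrite subr_gt0 ltNge /F scale0r addr0 max_p //.
by apply: dW; rewrite gtr0_norm.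
Qed.

End MaximumTest.

(** * Germs of smooth functions *)

Section SmoothAt.
Context {R : realType}.

(** Germs relieve the tensor calculus of carrying domains. One neighbourhood serves all orders of
    differentiability, and finitely many germs share one by [smooth_at_family]. *)
Variant smooth_at n (f : 'rV[R]_n -> R) (p : 'rV[R]_n) : Prop :=
  SmoothAt A of open A & A p & smooth A f.

Lemma smooth_at_nbhs n (f : 'rV[R]_n -> R) p :
  smooth_at f p -> \forall q \near p, smooth_at f q.
Proof.
move=> [A oA Ap sf]; have := open_nbhs_nbhs (conj oA Ap).
by apply: filterS => q Aq; exact: SmoothAt oA Aq sf.
Qed.

Lemma smooth_at_family n (I : finType) (F : I -> 'rV[R]_n -> R) p :
  (forall i, smooth_at (F i) p) ->
  exists A : set 'rV[R]_n, [/\ open A, A p & forall i, smooth A (F i)].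
Proof.
move=> sF; have /choice[A AP] : forall i, exists A : set 'rV[R]_n,
    [/\ open A, A p & smooth A (F i)].
  by move=> i; have [A oA Ap sA] := sF i; exists A.
have : nbhs p (fun q => forall i, A i q).
  near=> q => i; move: i; near: q; apply: filter_forall => i.
  by have [oA Ap _] := AP i; exact: open_nbhs_nbhs.
rewrite nbhsE => -[B [oB Bp] sB]; exists B; split=> // i k.
by have [_ _ sA] := AP i; apply: Ck_sub (sA k) => q /sB.
Unshelve. all: by end_near. Qed.

Lemma smooth_at_pair n (f g : 'rV[R]_n -> R) p :
  smooth_at f p -> smooth_at g p ->
  exists A : set 'rV[R]_n, [/\ open A, A p, smooth A f & smooth A g].
Proof.
move=> sf sg; have [[]|A [oA Ap sA]] :=
  @smooth_at_family n bool (fun b => if b then f else g) p.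
- exact: sf.
- exact: sg.
by exists A; split=> //; [exact: (sA true)|exact: (sA false)].
Qed.

Lemma smooth_at_eq n (f g : 'rV[R]_n -> R) p : {near p, f =1 g} ->
  smooth_at f p -> smooth_at g p.
Proof.
move=> fg [A oA Ap sf].
have : nbhs p (A `&` [set q | f q = g q]).
  by apply: filterI => //; exact: open_nbhs_nbhs.
rewrite nbhsE => -[B [oB Bp] sB]; apply: (SmoothAt oB Bp) => k.
have Cf : Ck k B f by apply: Ck_sub (sf k) => q /sB[].
by apply: (Ck_eq oB _ Cf) => q /sB[].
Qed.

Lemma smooth_at_continuous n (f : 'rV[R]_n -> R) p :
  smooth_at f p -> {for p, continuous f}.
Proof. by move=> [A oA Ap sf]; exact: Ck_continuous (sf 0%N) Ap. Qed.

Lemma smooth_at_continuous_rV m n (f : 'rV[R]_m -> 'rV[R]_n) p :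
  (forall a, smooth_at (rowfun f a) p) -> {for p, continuous f}.
Proof. by move=> sf; apply: continuous_rV => a; exact: (smooth_at_continuous (sf a)). Qed.

Lemma smooth_at_cst n (c : R) (p : 'rV[R]_n) : smooth_at (fun=> c) p.
Proof. by apply: (SmoothAt openT) => // k; exact: Ck_cst. Qed.

Lemma smooth_at_coord n i (p : 'rV[R]_n) : smooth_at (fun q => q 0 i) p.
Proof. by apply: (SmoothAt openT) => // k; exact: Ck_coord. Qed.

Lemma smooth_atD n (f g : 'rV[R]_n -> R) p : smooth_at f p -> smooth_at g p ->
  smooth_at (fun q => f q + g q) p.
Proof.
move=> sf sg; have [A [oA Ap sAf sAg]] := smooth_at_pair sf sg.
by apply: (SmoothAt oA Ap) => k; exact: CkD oA (sAf k) (sAg k).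
Qed.

Lemma smooth_atM n (f g : 'rV[R]_n -> R) p : smooth_at f p -> smooth_at g p ->
  smooth_at (fun q => f q * g q) p.
Proof.
move=> sf sg; have [A [oA Ap sAf sAg]] := smooth_at_pair sf sg.
by apply: (SmoothAt oA Ap) => k; exact: CkM oA (sAf k) (sAg k).
Qed.

Lemma smooth_atZ n c (f : 'rV[R]_n -> R) p : smooth_at f p ->
  smooth_at (fun q => c * f q) p.
Proof. by move=> sf; exact: smooth_atM (smooth_at_cst c p) sf. Qed.

Lemma smooth_atN n (f : 'rV[R]_n -> R) p : smooth_at f p ->
  smooth_at (fun q => - f q) p.
Proof.
move=> /(smooth_atZ (-1)); rewrite (_ : (fun q => _) = (fun q => - f q)) //.
by apply/funext => q; rewrite mulN1r.
Qed.

Lemma smooth_atB n (f g : 'rV[R]_n -> R) p : smooth_at f p -> smooth_at g p ->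
  smooth_at (fun q => f q - g q) p.
Proof. by move=> sf sg; exact: smooth_atD sf (smooth_atN sg). Qed.

Lemma smooth_at_sum n (I : Type) (s : seq I) (P : pred I)
    (F : I -> 'rV[R]_n -> R) p : (forall i, P i -> smooth_at (F i) p) ->
  smooth_at (fun q => \sum_(i <- s | P i) F i q) p.
Proof.
move=> sF; elim: s => [|i s IH].
  rewrite (_ : (fun q => _) = fun=> 0); first exact: smooth_at_cst.
  by apply/funext => q; rewrite big_nil.
case: (boolP (P i)) => Pi.
  rewrite (_ : (fun q => _) = fun q => F i q + \sum_(j <- s | P j) F j q).
    exact: smooth_atD (sF i Pi) IH.
  by apply/funext => q; rewrite big_cons Pi.
rewrite (_ : (fun q => _) = fun q => \sum_(j <- s | P j) F j q) //.
by apply/funext => q; rewrite big_cons (negPf Pi).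
Qed.

Lemma smooth_at_prod n (I : Type) (s : seq I) (P : pred I)
    (F : I -> 'rV[R]_n -> R) p : (forall i, P i -> smooth_at (F i) p) ->
  smooth_at (fun q => \prod_(i <- s | P i) F i q) p.
Proof.
move=> sF; elim: s => [|i s IH].
  rewrite (_ : (fun q => _) = fun=> 1); first exact: smooth_at_cst.
  by apply/funext => q; rewrite big_nil.
case: (boolP (P i)) => Pi.
  rewrite (_ : (fun q => _) = fun q => F i q * \prod_(j <- s | P j) F j q).
    exact: smooth_atM (sF i Pi) IH.
  by apply/funext => q; rewrite big_cons Pi.
rewrite (_ : (fun q => _) = fun q => \prod_(j <- s | P j) F j q) //.
by apply/funext => q; rewrite big_cons (negPf Pi).
Qed.

Lemma smooth_at_ln n (f : 'rV[R]_n -> R) p : 0 < f p -> smooth_at f p ->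
  smooth_at (fun q => ln (f q)) p.
Proof.
move=> f0 sf; have [A oA Ap sAf] := sf.
have : nbhs p (A `&` [set q | 0 < f q]).
  apply: filterI; first exact: open_nbhs_nbhs.
  exact: (cvgr_gt (f p) (smooth_at_continuous sf)).
rewrite nbhsE => -[B [oB Bp] sB]; apply: (SmoothAt oB Bp) => k.
apply: (Ck_ln oB); first by move=> q /sB[].
by apply: Ck_sub (sAf k) => q /sB[].
Qed.

Lemma smooth_atV n (f : 'rV[R]_n -> R) p : f p != 0 -> smooth_at f p ->
  smooth_at (fun q => (f q)^-1) p.
Proof.
move=> f0 sf; have [A oA Ap sAf] := sf.
have : nbhs p (A `&` [set q | f q != 0]).
  apply: filterI; first exact: open_nbhs_nbhs.
  exact: (cvgr_neq0 (f p) (smooth_at_continuous sf) f0).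
rewrite nbhsE => -[B [oB Bp] sB]; apply: (SmoothAt oB Bp) => k.
apply: (CkV oB); first by move=> q /sB[].
by apply: Ck_sub (sAf k) => q /sB[].
Qed.

Lemma smooth_at_partial n (f : 'rV[R]_n -> R) p i :
  smooth_at f p -> smooth_at (partial i f) p.
Proof.
by move=> [A oA Ap sAf]; apply: (SmoothAt oA Ap) => k; exact: Ck_partial.
Qed.

Lemma smooth_at_comp m n (f : 'rV[R]_m -> 'rV[R]_n) phi p :
  (forall a, smooth_at (rowfun f a) p) -> smooth_at phi (f p) ->
  smooth_at (fun q => phi (f q)) p.
Proof.
move=> sf sphi; have [U oU Up sU] := sphi.
have [A [oA Ap sA]] := smooth_at_family sf.
have : nbhs p (A `&` f @^-1` U).
  apply: filterI; first exact: open_nbhs_nbhs.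
  apply: (smooth_at_continuous_rV sf); exact: open_nbhs_nbhs.
rewrite nbhsE => -[B [oB Bp] sB]; apply: (SmoothAt oB Bp) => k.
apply: (@Ck_comp _ _ _ k B U f phi oB oU); [by move=> q /sB[]| |exact: sU].
by move=> a; apply: Ck_sub (sA a k) => q /sB[].
Qed.

End SmoothAt.

Section SmoothAtPartial.
Context {R : realType}.

Lemma near_partial_eq n (f g : 'rV[R]_n -> R) (p : 'rV[R]_n) i :
  (\forall q \near p, f q = g q) ->
  \forall q \near p, partial i f q = partial i g q.
Proof. by move=> /nbhs_interior; apply: filterS => q; exact: partial_near. Qed.

Variables (n : nat) (i : 'I_n).
Implicit Types (f g : 'rV[R]_n -> R) (p : 'rV[R]_n).

Lemma smooth_partialD f g p : smooth_at f p -> smooth_at g p ->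
  partial i (fun q => f q + g q) p = partial i f p + partial i g p.
Proof.
move=> sf sg; have [A [oA Ap sAf sAg]] := smooth_at_pair sf sg.
exact: partialD (sAf 1%N) (sAg 1%N) Ap.
Qed.

Lemma smooth_partialM f g p : smooth_at f p -> smooth_at g p ->
  partial i (fun q => f q * g q) p = f p * partial i g p + g p * partial i f p.
Proof.
move=> sf sg; have [A [oA Ap sAf sAg]] := smooth_at_pair sf sg.
exact: partialM (sAf 1%N) (sAg 1%N) Ap.
Qed.

Lemma smooth_partialZ c f p : smooth_at f p ->
  partial i (fun q => c * f q) p = c * partial i f p.
Proof. by move=> [A oA Ap sAf]; exact: partialZ (sAf 1%N) Ap. Qed.

Lemma smooth_partialV f p : smooth_at f p -> f p != 0 ->
  partial i (fun q => (f q)^-1) p = - partial i f p / f p ^+ 2.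
Proof. by move=> [A oA Ap sAf]; exact: partialV (sAf 1%N) Ap. Qed.

Lemma smooth_partial_comp1 f p (F : R -> R) dF : smooth_at f p ->
  is_derive (f p) 1 F dF -> partial i (fun q => F (f q)) p = dF * partial i f p.
Proof.
move=> [A oA Ap sAf] HF.
by have [_ E] := is_derive_comp1 i oA (sAf 1%N) Ap HF; rewrite -E partialE.
Qed.

Lemma smooth_partial_sum (I : finType) (P : pred I) (F : I -> 'rV[R]_n -> R) p :
  (forall j, smooth_at (F j) p) ->
  partial i (fun q => \sum_(j | P j) F j q) p = \sum_(j | P j) partial i (F j) p.
Proof.
move=> sF; have [A [oA Ap sA]] := smooth_at_family sF.
by apply: (partial_sum _ _ oA) => // j _; exact: (sA j 1%N).
Qed.

Lemma smooth_partialC j f p : smooth_at f p ->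
  partial i (partial j f) p = partial j (partial i f) p.
Proof. by move=> [A oA Ap sAf]; exact: partialC oA (sAf 2%N) Ap. Qed.

Lemma smooth_partial_comp k (f : 'rV[R]_n -> 'rV[R]_k) phi p :
  (forall a, smooth_at (rowfun f a) p) -> smooth_at phi (f p) ->
  partial i (fun q => phi (f q)) p =
    \sum_a partial a phi (f p) * partial i (rowfun f a) p.
Proof.
move=> sf [U oU Up sU]; have [A [oA Ap sA]] := smooth_at_family sf.
exact: (partial_comp i oA oU (fun a => sA a 1%N) (sU 1%N) Ap Up).
Qed.

Lemma smooth_jacobianE k (f : 'rV[R]_n -> 'rV[R]_k) p a :
  (forall a, smooth_at (rowfun f a) p) ->
  'J f p i a = partial i (rowfun f a) p.
Proof.
move=> sf; have [A [oA Ap sA]] := smooth_at_family sf.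
exact: (jacobianE i a oA (fun a => sA a 1%N) Ap).
Qed.

Lemma smooth_critical_at_max f p : smooth_at f p ->
  (\forall q \near p, f q <= f p) -> partial i f p = 0.
Proof.
move=> [A oA Ap sAf] maxp; have : nbhs p (A `&` [set q | f q <= f p]).
  by apply: filterI => //; exact: open_nbhs_nbhs.
rewrite nbhsE => -[B [oB Bp] sB].
apply: (@critical_at_max _ _ B f p oB _ Bp); last by move=> q /sB[].
by apply: Ck_sub (sAf 2%N) => q /sB[].
Qed.

Lemma smooth_hessian_at_max f p (v : 'rV[R]_n) : smooth_at f p ->
  (\forall q \near p, f q <= f p) ->
  \sum_i \sum_j v 0 i * v 0 j * partial i (partial j f) p <= 0.
Proof.
move=> [A oA Ap sAf] maxp; have : nbhs p (A `&` [set q | f q <= f p]).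
  by apply: filterI => //; exact: open_nbhs_nbhs.
rewrite nbhsE => -[B [oB Bp] sB].
apply: (@hessian_at_max _ _ B f p oB _ Bp); last by move=> q /sB[].
by apply: Ck_sub (sAf 2%N) => q /sB[].
Qed.

End SmoothAtPartial.

(** * Inner products *)

Section InnerProducts.
Context {R : realType}.

Section Bilinear.
Variables (n : nat) (A : 'M[R]_n).
Implicit Types (v w z : 'rV[R]_n).

Lemma innerE v w : inner A v w = \sum_a \sum_b v 0 a * A a b * w 0 b.
Proof.
rewrite /inner -mulmxA mxE; apply: eq_bigr => a _; rewrite !mxE mulr_sumr.
by apply: eq_bigr => b _; rewrite !mxE mulrA.
Qed.

Lemma innerDl v w z : inner A (v + w) z = inner A v z + inner A w z.
Proof. by rewrite /inner !mulmxDl mxE. Qed.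

Lemma innerDr v w z : inner A z (v + w) = inner A z v + inner A z w.
Proof. by rewrite /inner linearD /= mulmxDr mxE. Qed.

Lemma innerZl c v w : inner A (c *: v) w = c * inner A v w.
Proof. by rewrite /inner -!scalemxAl mxE. Qed.

Lemma innerZr c v w : inner A v (c *: w) = c * inner A v w.
Proof. by rewrite /inner linearZ /= -scalemxAr mxE. Qed.

Lemma inner0l w : inner A 0 w = 0.
Proof. by rewrite /inner !mul0mx mxE. Qed.

Lemma inner0r w : inner A w 0 = 0.
Proof. by rewrite /inner trmx0 mulmx0 mxE. Qed.

Lemma innerNl v w : inner A (- v) w = - inner A v w.
Proof. by rewrite -scaleN1r innerZl mulN1r. Qed.

Lemma innerNr v w : inner A v (- w) = - inner A v w.
Proof. by rewrite -scaleN1r innerZr mulN1r. Qed.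

Lemma innerBl v w z : inner A (v - w) z = inner A v z - inner A w z.
Proof. by rewrite innerDl innerNl. Qed.

Lemma innerBr v w z : inner A z (v - w) = inner A z v - inner A z w.
Proof. by rewrite innerDr innerNr. Qed.

Lemma inner_suml (I : Type) (s : seq I) (P : pred I) (F : I -> 'rV[R]_n) w :
  inner A (\sum_(i <- s | P i) F i) w = \sum_(i <- s | P i) inner A (F i) w.
Proof. exact: (big_morph (fun v => inner A v w) (fun v z => innerDl v z w) (inner0l w)). Qed.

Lemma inner_sumr (I : Type) (s : seq I) (P : pred I) (F : I -> 'rV[R]_n) w :
  inner A w (\sum_(i <- s | P i) F i) = \sum_(i <- s | P i) inner A w (F i).
Proof. exact: (big_morph (fun v => inner A w v) (fun v z => innerDr v z w) (inner0r w)). Qed.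

Lemma inner_delta i j : inner A (delta_mx 0 i) (delta_mx 0 j) = A i j.
Proof. by rewrite /inner -rowE trmx_delta -colE !mxE. Qed.

Lemma innerC v w : A^T = A -> inner A v w = inner A w v.
Proof.
move=> sA; rewrite /inner -[in LHS](trmxK (v *m A *m w^T)) mxE.
by rewrite !trmx_mul trmxK sA mulmxA.
Qed.

Lemma posdef_inner_ge0 v : posdef A -> 0 <= inner A v v.
Proof.
by move=> [_ pA]; have [->|/pA/ltW//] := eqVneq v 0; rewrite inner0l.
Qed.

Lemma posdef_inner_eq0 v : posdef A -> inner A v v = 0 -> v = 0.
Proof.
move=> [_ pA] v0; apply: contrapT => /eqP/pA; rewrite v0 ltxx; exact/negP.
Qed.

End Bilinear.

Lemma inner_congr m n (A : 'M[R]_n) (P : 'M[R]_(m, n)) (v w : 'rV[R]_m) :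
  inner (P *m A *m P^T) v w = inner A (v *m P) (w *m P).
Proof. by rewrite /inner trmx_mul !mulmxA. Qed.

Lemma posdef_congr m n (A : 'M[R]_n) (P : 'M[R]_(m, n)) :
  row_free P -> posdef A -> posdef (P *m A *m P^T).
Proof.
move=> fP [sA pA]; split=> [|v v0]; first by rewrite !trmx_mul trmxK sA mulmxA.
rewrite inner_congr; apply: pA; apply: contra_neq v0 => vP0.
by apply: (row_free_inj fP); rewrite vP0 mul0mx.
Qed.

Lemma posdef_unit n (A : 'M[R]_n) : posdef A -> A \in unitmx.
Proof.
move=> pA; rewrite -row_free_unit; apply: inj_row_free => v vA0.
by apply: (posdef_inner_eq0 pA); rewrite /inner vA0 mul0mx mxE.
Qed.

(** Gaussian elimination: [L] clears the first row and column and leaves the Schur complement [S],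
    which is again positive definite as the restriction of a congruent form. The rows of [P] are an
    orthonormal frame, the device by which every metric trace below is estimated. *)
Lemma posdef_orthonormal n (A : 'M[R]_n) : posdef A ->
  exists P : 'M[R]_n, P *m A *m P^T = 1%:M.
Proof.
elim: n A => [|n IH] A pA; first by exists 0; rewrite [LHS]flatmx0 [RHS]flatmx0.
rewrite -[n.+1]/(1 + n)%N in A pA *.
pose a := A 0 0.
have a0 : 0 < a.
  rewrite /a -inner_delta; apply: pA.2; apply/eqP => /rowP/(_ 0).
  by rewrite !mxE eqxx /= => /eqP; rewrite oner_eq0.
pose b : 'rV[R]_n := ursubmx A.
have sA : A^T = A := pA.1.
have E : A = block_mx a%:M b b^T (drsubmx A).
  rewrite -[LHS]submxK; congr block_mx.
    rewrite [LHS]mx11_scalar; congr (_%:M); rewrite !mxE.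
    by congr (A _ _); apply: val_inj.
  by rewrite /b trmx_ursub sA.
pose L : 'M[R]_(1 + n) := block_mx 1%:M 0 (- a^-1 *: b^T) 1%:M.
pose S : 'M[R]_n := drsubmx A - a^-1 *: (b^T *m b).
have EL : L *m A *m L^T = block_mx a%:M 0 0 S.
  rewrite E tr_block_mx !mulmx_block !trmx1 !trmx0 !mul1mx !mul0mx !addr0.
  rewrite !mulmx1 !mulmx0 !addr0 !linearZ /= trmxK.
  have z1 : - a^-1 *: b^T *m a%:M + b^T = 0.
    rewrite mul_mx_scalar scalerA mulrN divff ?gt_eqF // scaleN1r.
    by rewrite addNr.
  rewrite z1 mul0mx scaler0 add0r mul_scalar_mx scalerA mulNr mulVf ?gt_eqF //.
  by rewrite scaleN1r addNr -scalemxAl scaleNr addrC.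
have uL : row_free L.
  rewrite row_free_unit unitmxE det_lblock !det1 mulr1; exact: unitr1.
have pS : posdef S.
  pose Q : 'M[R]_(n, 1 + n) := row_mx 0 1%:M.
  have fQ : row_free Q.
    apply: inj_row_free => v; rewrite mul_mx_row mulmx0 mulmx1 => /eqP.
    by rewrite row_mx_eq0 => /andP[_ /eqP].
  have := posdef_congr fQ (posdef_congr uL pA).
  rewrite EL /Q mul_row_block !mul0mx !mul1mx ?mulmx0 ?add0r ?addr0.
  by rewrite tr_row_mx mul_row_col trmx1 mulmx1 ?mul0mx ?add0r.
have [P' EP'] := IH S pS.
pose s := Num.sqrt a.
have s0 : 0 < s by rewrite sqrtr_gt0.
pose P0 : 'M[R]_(1 + n) := block_mx (s^-1)%:M 0 0 P'.
exists (P0 *m L).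
have -> : P0 *m L *m A *m (P0 *m L)^T = P0 *m (L *m A *m L^T) *m P0^T.
  by rewrite trmx_mul !mulmxA.
rewrite EL tr_block_mx !mulmx_block !trmx0 !mul0mx !mulmx0 !addr0 !add0r EP'.
rewrite tr_scalar_mx -!scalar_mxM !mul0mx.
have -> : s^-1 * a * s^-1 = 1.
  rewrite -[a in LHS](sqr_sqrtr (ltW a0)) -/s expr2 mulKf ?gt_eqF //.
  by rewrite divff ?gt_eqF.
by rewrite -scalar_mx_block.
Qed.

Lemma orthonormal_inv n (A P : 'M[R]_n) : P *m A *m P^T = 1%:M ->
  invmx A = P^T *m P.
Proof.
move=> E; have uP : P \in unitmx.
  by have /mulmx1_unit[] : P *m (A *m P^T) = 1%:M by rewrite mulmxA.
have E2 : A *m P^T *m P = 1%:M.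
  by apply: mulmx1C; rewrite mulmxA.
have uA : A \in unitmx.
  by have /mulmx1_unit[] : A *m (P^T *m P) = 1%:M by rewrite mulmxA.
by rewrite -[LHS]mulmx1 -E2 -!mulmxA mulKmx.
Qed.

(** Since the inverse of [A] is [P^T *m P], a trace with respect to the metric becomes a sum over
    the frame, whose terms can be bounded one by one. *)
Lemma invmx_trace n (A P : 'M[R]_n) (F : 'I_n -> 'I_n -> R) :
  P *m A *m P^T = 1%:M ->
  \sum_i \sum_j invmx A i j * F i j =
  \sum_c \sum_i \sum_j P c i * P c j * F i j.
Proof.
move=> /orthonormal_inv ->; rewrite exchange_big /= [RHS]exchange_big /=.
rewrite exchange_big /=; apply: eq_bigr => i _; rewrite exchange_big /=.
apply: eq_bigr => j _; rewrite mxE mulr_suml; apply: eq_bigr => c _.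
by rewrite !mxE.
Qed.

Lemma invmx_sym n (A : 'M[R]_n) : A^T = A -> (invmx A)^T = invmx A.
Proof. by move=> sA; rewrite trmx_inv sA. Qed.

Lemma independent_pair n (v w : 'rV[R]_n) : v != 0 ->
  (forall c, w <> c *: v) -> row_free (col_mx v w).
Proof.
move=> v0 nw; apply: inj_row_free => u; rewrite -[u]hsubmxK mul_row_col.
rewrite [lsubmx u]mx11_scalar [rsubmx u]mx11_scalar !mul_scalar_mx.
set x := lsubmx u 0 0; set y := rsubmx u 0 0 => E.
have y0 : y = 0.
  apply: contrapT => /eqP y0; apply: (nw (- (x / y))).
  apply: (scalerI y0); rewrite scalerA mulrN mulrCA divff // mulr1 scaleNr.
  by apply/eqP; rewrite -addr_eq0 addrC E.
move: E; rewrite y0 scale0r addr0 => /eqP; rewrite scaler_eq0 (negPf v0) orbF.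
by move=> /eqP ->; rewrite !raddf0 row_mx0.
Qed.

(** Positivity of the denominator in [sectional]: the expression is |v|^2 times the squared norm of
    the component of [w] orthogonal to [v]. *)
Lemma cauchy_schwarz_strict n (A : 'M[R]_n) (v w : 'rV[R]_n) : posdef A ->
  v != 0 -> (forall c, w <> c *: v) ->
  0 < inner A v v * inner A w w - inner A v w ^+ 2.
Proof.
move=> pA v0 nw; have vv0 : 0 < inner A v v := pA.2 v v0.
pose c := inner A v w / inner A v v.
have z0 : w - c *: v != 0.
  by apply/eqP => /eqP; rewrite subr_eq0 => /eqP; exact: nw.
have := pA.2 _ z0; rewrite innerBl !innerBr !innerZl !innerZr.
rewrite (innerC w v pA.1) => H.
have -> : inner A v v * inner A w w - inner A v w ^+ 2 =
  inner A v v * (inner A w w - c * inner A v w -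
    (c * inner A v w - c * (c * inner A v v))).
  by rewrite /c; field; rewrite gt_eqF.
exact: mulr_gt0.
Qed.

End InnerProducts.

(** * Levi-Civita connection *)

Section MetricGerms.
Context {R : realType}.

Definition smooth_rV m n (S : 'rV[R]_m -> 'rV[R]_n) (p : 'rV[R]_m) : Prop :=
  forall a, smooth_at (rowfun S a) p.

Definition smooth_mx n k (A : 'rV[R]_n -> 'M[R]_k) (p : 'rV[R]_n) : Prop :=
  forall a b, smooth_at (fun q => A q a b) p.

Definition metric_at n (h : 'rV[R]_n -> 'M[R]_n) (p : 'rV[R]_n) : Prop :=
  (\forall q \near p, posdef (h q)) /\ smooth_mx h p.

Lemma smooth_mx_near n k (A : 'rV[R]_n -> 'M[R]_k) p :
  smooth_mx A p -> \forall q \near p, smooth_mx A q.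
Proof.
move=> sA; near=> q => a b; move: a b; near: q.
by apply: filter_forall => a; apply: filter_forall => b; exact: smooth_at_nbhs (sA a b).
Unshelve. all: by end_near. Qed.

Lemma smooth_rV_near m n (S : 'rV[R]_m -> 'rV[R]_n) p :
  smooth_rV S p -> \forall q \near p, smooth_rV S q.
Proof.
move=> sS; near=> q => a; move: a; near: q.
by apply: filter_forall => a; exact: smooth_at_nbhs (sS a).
Unshelve. all: by end_near. Qed.

Lemma metric_at_near n (h : 'rV[R]_n -> 'M[R]_n) p :
  metric_at h p -> \forall q \near p, metric_at h q.
Proof.
move=> [/nbhs_interior ph /smooth_mx_near sh]; near=> q.
by split; near: q.
Unshelve. all: by end_near. Qed.

Lemma smooth_det n k (A : 'rV[R]_n -> 'M[R]_k) p : smooth_mx A p ->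
  smooth_at (fun q => \det (A q)) p.
Proof.
move=> sA; apply: smooth_at_sum => s _; apply: smooth_atZ.
by apply: smooth_at_prod => i _; exact: sA.
Qed.

(** Cramer's rule. It agrees with [invmx] only where the determinant is nonzero, which is a
    neighbourhood of [p]; elsewhere [invmx] has a default value. *)
Lemma smooth_invmx n k (A : 'rV[R]_n -> 'M[R]_k) p : smooth_mx A p ->
  A p \in unitmx -> smooth_mx (fun q => invmx (A q)) p.
Proof.
move=> sA; rewrite unitmxE unitfE => d0 a b; have sd := smooth_det sA.
apply: (@smooth_at_eq _ _ (fun q => (\det (A q))^-1 * \adj (A q) a b)).
  have H : \forall q \near p, \det (A q) != 0.
    exact: (cvgr_neq0 (\det (A p)) (smooth_at_continuous sd) d0).
  by apply: filterS H => q dq; rewrite /= /invmx unitmxE unitfE dq [RHS]mxE.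
apply: smooth_atM; first exact: smooth_atV.
rewrite (_ : (fun q => _) = (fun q => (-1) ^+ (b + a) *
  \det (row' b (col' a (A q))))); last by apply/funext => q; rewrite mxE.
apply: smooth_atZ; apply: smooth_det => i j.
rewrite (_ : (fun q => _) = fun q => A q (lift b i) (lift a j)).
  exact: sA.
by apply/funext => q; rewrite !mxE.
Qed.

End MetricGerms.

(** Lowering an index that was raised by the inverse metric. With [D] the bracket of metric
    derivatives in [christoffel] this gives the symbols of the first kind in [inner_chris]. *)
Lemma contract_invmx (R : realType) n (A : 'M[R]_n) (D : 'I_n -> R) k :
  A^T = A -> A \in unitmx ->
  \sum_l (\sum_s invmx A l s * D s) * A l k = D k.
Proof.
move=> sA uA; pose d : 'rV[R]_n := \row_s D s.
have -> : D k = (d *m invmx A *m A) 0 k by rewrite mulmxKV // mxE.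
rewrite mxE; apply: eq_bigr => l _; congr (_ * _); rewrite mxE.
apply: eq_bigr => s _; rewrite mxE mulrC; congr (_ * _).
by rewrite -[in LHS](invmx_sym sA) mxE.
Qed.

Section Christoffel.
Context {R : realType} {n : nat}.
Variables (h : 'rV[R]_n -> 'M[R]_n) (p : 'rV[R]_n).
Hypothesis hp : metric_at h p.

Definition chris (g : 'rV[R]_n -> 'M[R]_n) (q : 'rV[R]_n) (i j : 'I_n) : 'rV[R]_n :=
  \row_k christoffel g q k i j.

Let ph : posdef (h p). Proof. exact: nbhs_singleton hp.1. Qed.

Lemma metric_near_sym a b : \forall q \near p, h q a b = h q b a.
Proof.
apply: filterS hp.1 => q [sq _].
by rewrite -[in LHS]sq mxE.
Qed.

Lemma partial_metric_sym c a b :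
  partial c (fun q => h q a b) p = partial c (fun q => h q b a) p.
Proof. by apply: partial_near; exact: metric_near_sym. Qed.

Lemma smooth_christoffel k i j : smooth_at (fun q => christoffel h q k i j) p.
Proof.
have sh := hp.2; apply: smooth_atZ; apply: smooth_at_sum => l _.
apply: smooth_atM; first exact: (smooth_invmx sh (posdef_unit ph)).
apply: smooth_atB; last exact: smooth_at_partial.
by apply: smooth_atD; exact: smooth_at_partial.
Qed.

Lemma chrisC i j : chris h p i j = chris h p j i.
Proof.
apply/rowP => k; rewrite !mxE; congr (_ * _); apply: eq_bigr => l _.
congr (_ * (_ - _)); first exact: addrC.
exact: partial_metric_sym.
Qed.

Lemma inner_chris i j k : inner (h p) (chris h p i j) (delta_mx 0 k) =
  2^-1 * (partial i (fun q => h q j k) p + partial j (fun q => h q i k) p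
          - partial k (fun q => h q i j) p).
Proof.
rewrite innerE (eq_bigr (fun l => chris h p i j 0 l * h p l k)); last first.
  move=> l _; rewrite (bigD1 k isT) /= [X in _ * X]mxE !eqxx mulr1 big1 ?addr0 //.
  by move=> b bk; rewrite [X in _ * X]mxE (negPf bk) andbF mulr0.
rewrite -(contract_invmx (fun l => partial i (fun q => h q j l) p +
  partial j (fun q => h q i l) p - partial l (fun q => h q i j) p) k ph.1
  (posdef_unit ph)) mulr_sumr.
by apply: eq_bigr => l _; rewrite mxE mulrA.
Qed.

(** In the sum of the two symbols of the first kind the derivatives along a and b cancel, and those
    along c add up. *)
Lemma christoffel_compat c a b : partial c (fun q => h q a b) p =
  inner (h p) (chris h p c a) (delta_mx 0 b) +
  inner (h p) (delta_mx 0 a) (chris h p c b).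
Proof.
rewrite (innerC (delta_mx 0 a) _ ph.1) !inner_chris.
rewrite (partial_metric_sym b c a) (partial_metric_sym a c b).
rewrite (partial_metric_sym c b a).
move: (partial c _ p) (partial b _ p) (partial a _ p) => x y z; by field.
Qed.

End Christoffel.

(** * Pull-back of the Levi-Civita connection along a map *)

Section PullbackConnection.
Context {R : realType} {m n : nat}.
Variables (h : 'rV[R]_n -> 'M[R]_n) (u : 'rV[R]_m -> 'rV[R]_n).
Implicit Types (S T : 'rV[R]_m -> 'rV[R]_n) (p : 'rV[R]_m).

Definition dmx p : 'M[R]_(m, n) := \matrix_(i, a) partial i (rowfun u a) p.

(** Freeness is asked near [p] and not only at [p]: the condition is then visibly open, and the
    induced metric is positive definite on a neighbourhood, as required for differentiating its
    inverse. *)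
Record local_immersion p : Prop := LocalImmersion {
  immersion_smooth : smooth_rV u p;
  immersion_metric : metric_at h (u p);
  immersion_free : \forall q \near p, row_free (dmx q) }.

Lemma rowfun_du S i a : rowfun (du S i) a = partial i (rowfun S a).
Proof. by apply/funext => q; rewrite /rowfun mxE. Qed.

Lemma row_dmx i p : row i (dmx p) = du u i p.
Proof. by apply/rowP => a; rewrite !mxE. Qed.

Lemma pullbackE p : pullback h u p = dmx p *m h (u p) *m (dmx p)^T.
Proof.
apply/matrixP => i j; rewrite mxE -!row_dmx !rowE -inner_congr.
exact: inner_delta.
Qed.

Lemma smooth_du S i p : smooth_rV S p -> smooth_rV (du S i) p.
Proof. by move=> sS a; rewrite rowfun_du; exact: smooth_at_partial. Qed.

Lemma continuous_smooth_rV S p : smooth_rV S p -> {for p, continuous S}.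
Proof. by move=> sS; apply: continuous_rV => a; exact: smooth_at_continuous (sS a). Qed.

Lemma near_pull (P : 'rV[R]_n -> Prop) p : smooth_rV u p ->
  (\forall y \near u p, P y) -> \forall q \near p, P (u q).
Proof. by move=> su HP; apply: (continuous_smooth_rV su). Qed.

Lemma local_immersion_near p :
  local_immersion p -> \forall q \near p, local_immersion q.
Proof.
move=> [su mh fu]; near=> q; split; near: q.
- exact: smooth_rV_near.
- by apply: near_pull => //; exact: metric_at_near.
- exact: nbhs_interior fu.
Unshelve. all: by end_near. Qed.

Lemma smooth_inner S T p : smooth_rV u p -> smooth_mx h (u p) ->
  smooth_rV S p -> smooth_rV T p ->
  smooth_at (fun q => inner (h (u q)) (S q) (T q)) p.
Proof.
move=> su sh sS sT; rewrite (_ : (fun q => _) = fun q =>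
  \sum_a \sum_b rowfun S a q * h (u q) a b * rowfun T b q); last first.
  by apply/funext => q; rewrite innerE.
apply: smooth_at_sum => a _; apply: smooth_at_sum => b _.
apply: smooth_atM; last exact: sT.
by apply: smooth_atM; [exact: sS|exact: smooth_at_comp su (sh a b)].
Qed.

Lemma pullback_metric p : local_immersion p -> metric_at (pullback h u) p.
Proof.
move=> [su mh fu]; split; last first.
  move=> i j; rewrite (_ : (fun q => _) =
      fun q => inner (h (u q)) (du u i q) (du u j q)); last first.
    by apply/funext => q; rewrite mxE.
  by apply: smooth_inner => //; [exact: mh.2|exact: smooth_du|exact: smooth_du].
have ph := near_pull su mh.1.
near=> q; rewrite pullbackE; apply: posdef_congr; first by near: q.
by near: q.
Unshelve. all: by end_near. Qed.

Lemma nabla_alongE S i p : nabla_along h u S i p =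
  du S i p + \sum_b \sum_c (du u i p 0 b * S p 0 c) *: chris h (u p) b c.
Proof.
apply/rowP => a; rewrite !mxE summxE; congr (_ + _).
apply: eq_bigr => b _; rewrite summxE; apply: eq_bigr => c _.
by rewrite [RHS]mxE [X in _ = _ * X]mxE [RHS]mulrC mulrA.
Qed.

Lemma smooth_nabla_along S i p : local_immersion p -> smooth_rV S p ->
  smooth_rV (nabla_along h u S i) p.
Proof.
move=> [su mh fu] sS a.
rewrite (_ : rowfun _ a = fun q => partial i (rowfun S a) q +
    \sum_b \sum_c christoffel h (u q) a b c * rowfun (du u i) b q * rowfun S c q).
  apply: smooth_atD; first exact: smooth_at_partial.
  apply: smooth_at_sum => b _; apply: smooth_at_sum => c _.
  apply: smooth_atM => //; apply: smooth_atM.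
    exact: smooth_at_comp su (smooth_christoffel mh a b c).
  exact: (smooth_du i su b).
by apply/funext => q; rewrite /rowfun mxE.
Qed.

(** The product rule gives three groups of terms: [X] and [Y] differentiate the sections, [Z]
    differentiates h along u. By [christoffel_compat] the group [Z] is the sum of the Christoffel
    corrections of the two covariant derivatives. *)
Lemma partial_inner S T i p : smooth_rV u p -> metric_at h (u p) ->
  smooth_rV S p -> smooth_rV T p ->
  partial i (fun q => inner (h (u q)) (S q) (T q)) p =
  inner (h (u p)) (nabla_along h u S i p) (T p) +
  inner (h (u p)) (S p) (nabla_along h u T i p).
Proof.
move=> su mh sS sT; have [ph sh] := mh.
have shu a b : smooth_at (fun q => h (u q) a b) p.
  exact: smooth_at_comp su (sh a b).
rewrite (_ : (fun q => _) = fun q =>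
  \sum_a \sum_b rowfun S a q * h (u q) a b * rowfun T b q); last first.
  by apply/funext => q; rewrite innerE.
rewrite smooth_partial_sum => [|a]; last first.
  apply: smooth_at_sum => b _; apply: smooth_atM; last exact: sT.
  by apply: smooth_atM; [exact: sS|exact: shu].
rewrite !nabla_alongE innerDl innerDr inner_suml inner_sumr.
pose X a b := rowfun T b p * (h (u p) a b * partial i (rowfun S a) p).
pose Y a b := rowfun S a p * h (u p) a b * partial i (rowfun T b) p.
pose Z a b := rowfun T b p * (rowfun S a p *
  \sum_c partial c (fun q => h q a b) (u p) * partial i (rowfun u c) p).
have -> : \sum_a partial i (fun q => \sum_b rowfun S a q * h (u q) a b * rowfun T b q) p
   = \sum_a \sum_b (Y a b + (Z a b + X a b)).
  apply: eq_bigr => a _; rewrite smooth_partial_sum => [|b]; last first.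
    apply: smooth_atM; last exact: sT.
    by apply: smooth_atM; [exact: sS|exact: shu].
  apply: eq_bigr => b _; rewrite (smooth_partialM i _ (sT b)); last first.
    by apply: smooth_atM; [exact: sS|exact: shu].
  congr (_ + _); rewrite (smooth_partialM i (sS a) (shu a b)) mulrDr.
  congr (_ * (_ * _) + _).
  exact: (smooth_partial_comp i su (sh a b)).
have EX : inner (h (u p)) (du S i p) (T p) = \sum_a \sum_b X a b.
  rewrite innerE; apply: eq_bigr => a _; apply: eq_bigr => b _.
  by rewrite [in LHS]mxE /X /rowfun mulrC [_ * h _ _ _]mulrC.
have EY : inner (h (u p)) (S p) (du T i p) = \sum_a \sum_b Y a b.
  rewrite innerE; apply: eq_bigr => a _; apply: eq_bigr => b _.
  by rewrite [in LHS]mxE.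
have EZ : \sum_(c < n) inner (h (u p)) (\sum_a (du u i p 0 c * S p 0 a) *:
      chris h (u p) c a) (T p) + \sum_(c < n) inner (h (u p)) (S p)
      (\sum_b (du u i p 0 c * T p 0 b) *: chris h (u p) c b) =
    \sum_a \sum_b Z a b.
  rewrite -big_split /=.
  transitivity (\sum_c \sum_a \sum_b du u i p 0 c * S p 0 a * T p 0 b *
    partial c (fun q => h q a b) (u p)).
    apply: eq_bigr => c _; rewrite inner_suml inner_sumr.
    have -> : \sum_b inner (h (u p)) (S p) ((du u i p 0 c * T p 0 b) *: chris h (u p) c b)
      = \sum_b \sum_a du u i p 0 c * S p 0 a * T p 0 b *
          inner (h (u p)) (delta_mx 0 a) (chris h (u p) c b).
      apply: eq_bigr => b _; rewrite {1}(row_sum_delta (S p)) inner_suml.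
      by apply: eq_bigr => a _; rewrite innerZl innerZr; ring.
    rewrite [X in _ + X]exchange_big -big_split /=; apply: eq_bigr => a _.
    rewrite {1}(row_sum_delta (T p)) inner_sumr -big_split /=.
    apply: eq_bigr => b _.
    by rewrite innerZl innerZr (christoffel_compat mh); ring.
  rewrite exchange_big /=; apply: eq_bigr => a _; rewrite exchange_big /=.
  apply: eq_bigr => b _; rewrite /Z !mulr_sumr; apply: eq_bigr => c _.
  by rewrite mxE /rowfun; ring.
rewrite addrACA EX EY EZ -!big_split /=; apply: eq_bigr => a _.
rewrite -!big_split /=; apply: eq_bigr => b _.
by move: (X a b) (Y a b) (Z a b) => x y z; ring.
Qed.

End PullbackConnection.

(* Unification otherwise unfolds these constants down to limits of difference
   quotients. *)
HB.lock Definition pd (R : realType) n (i : 'I_n) (f : 'rV[R]_n -> R) :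
  'rV[R]_n -> R := partial i f.
HB.lock Definition dvec (R : realType) m n (S : 'rV[R]_m -> 'rV[R]_n) (i : 'I_m) :
  'rV[R]_m -> 'rV[R]_n := du S i.
HB.lock Definition nab (R : realType) m n (h : 'rV[R]_n -> 'M[R]_n)
    (u S : 'rV[R]_m -> 'rV[R]_n) (i : 'I_m) : 'rV[R]_m -> 'rV[R]_n :=
  nabla_along h u S i.
HB.lock Definition gam (R : realType) n (h : 'rV[R]_n -> 'M[R]_n) (p : 'rV[R]_n)
  (i j : 'I_n) : 'rV[R]_n := chris h p i j.
HB.lock Definition pull (R : realType) m n (h : 'rV[R]_n -> 'M[R]_n)
  (u : 'rV[R]_m -> 'rV[R]_n) : 'rV[R]_m -> 'M[R]_m := pullback h u.

Arguments pd {R n}.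
Arguments dvec {R m n}.
Arguments nab {R m n}.
Arguments gam {R n}.
Arguments pull {R m n}.

Section Locked.
Context {R : realType} {m n : nat}.
Variables (h : 'rV[R]_n -> 'M[R]_n) (u : 'rV[R]_m -> 'rV[R]_n).
Implicit Types (S T : 'rV[R]_m -> 'rV[R]_n) (p : 'rV[R]_m).

Lemma duL : @du R m n = dvec.
Proof. by rewrite dvec.unlock. Qed.

Lemma nablaL : nabla_along h u = nab h u.
Proof. by rewrite nab.unlock. Qed.

Lemma pullbackL : pullback h u = pull h u.
Proof. by rewrite pull.unlock. Qed.

Lemma christoffelL k (g : 'rV[R]_k -> 'M[R]_k) q a i j :
  christoffel g q a i j = gam g q i j 0 a.
Proof. by rewrite gam.unlock mxE. Qed.

Lemma partialL k : @partial R k = pd.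
Proof. by rewrite pd.unlock. Qed.

Lemma pullE : pull h u = fun q =>
  \matrix_(i, j) inner (h (u q)) (dvec u i q) (dvec u j q).
Proof. by rewrite pull.unlock dvec.unlock. Qed.

Lemma rowfun_dvec S i a : rowfun (dvec S i) a = pd i (rowfun S a).
Proof. by rewrite dvec.unlock pd.unlock; exact: rowfun_du. Qed.

Lemma nabE S i p : nab h u S i p =
  dvec S i p + \sum_b \sum_c (dvec u i p 0 b * S p 0 c) *: gam h (u p) b c.
Proof. by rewrite nab.unlock dvec.unlock gam.unlock; exact: nabla_alongE. Qed.

Lemma smooth_pd k i (f : 'rV[R]_k -> R) q : smooth_at f q -> smooth_at (pd i f) q.
Proof. by rewrite pd.unlock; exact: smooth_at_partial. Qed.

Lemma smooth_dvec S i p : smooth_rV S p -> smooth_rV (dvec S i) p.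
Proof. by rewrite dvec.unlock; exact: smooth_du. Qed.

Lemma smooth_nab S i p : local_immersion h u p -> smooth_rV S p ->
  smooth_rV (nab h u S i) p.
Proof. by rewrite nab.unlock; exact: smooth_nabla_along. Qed.

Lemma smooth_gam k (g : 'rV[R]_k -> 'M[R]_k) q a i j : metric_at g q ->
  smooth_at (fun q => gam g q i j 0 a) q.
Proof.
move=> mg; rewrite (_ : (fun q => _) = (fun q => christoffel g q a i j)).
  exact: smooth_christoffel.
by apply/funext => q'; rewrite christoffelL.
Qed.

Lemma pull_metric p : local_immersion h u p -> metric_at (pull h u) p.
Proof. by rewrite pull.unlock; exact: pullback_metric. Qed.

Lemma pull_dmx p : pull h u p = dmx u p *m h (u p) *m (dmx u p)^T.
Proof. by rewrite pull.unlock; exact: pullbackE. Qed.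

Lemma row_dmxL i p : row i (dmx u p) = dvec u i p.
Proof. by rewrite dvec.unlock; exact: row_dmx. Qed.

Lemma pd_inner S T i p : smooth_rV u p -> metric_at h (u p) ->
  smooth_rV S p -> smooth_rV T p ->
  pd i (fun q => inner (h (u q)) (S q) (T q)) p =
  inner (h (u p)) (nab h u S i p) (T p) + inner (h (u p)) (S p) (nab h u T i p).
Proof. by rewrite pd.unlock nab.unlock; exact: partial_inner. Qed.

Lemma gamC k (g : 'rV[R]_k -> 'M[R]_k) q i j : metric_at g q ->
  gam g q i j = gam g q j i.
Proof. by rewrite gam.unlock => mg; exact: chrisC. Qed.

Lemma inner_gam k (g : 'rV[R]_k -> 'M[R]_k) q i j l : metric_at g q ->
  inner (g q) (gam g q i j) (delta_mx 0 l) =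
  2^-1 * (pd i (fun q => g q j l) q + pd j (fun q => g q i l) q
          - pd l (fun q => g q i j) q).
Proof. by rewrite gam.unlock pd.unlock => mg; exact: inner_chris. Qed.

End Locked.

Section LockedPartial.
Context {R : realType} {n : nat}.
Variable i : 'I_n.
Implicit Types (f g : 'rV[R]_n -> R) (p : 'rV[R]_n).

Lemma pd_near f g p : {near p, f =1 g} -> pd i f p = pd i g p.
Proof. by rewrite pd.unlock; exact: partial_near. Qed.

Lemma pdD f g p : smooth_at f p -> smooth_at g p ->
  pd i (fun q => f q + g q) p = pd i f p + pd i g p.
Proof. by rewrite pd.unlock; exact: smooth_partialD. Qed.

Lemma pdM f g p : smooth_at f p -> smooth_at g p ->
  pd i (fun q => f q * g q) p = f p * pd i g p + g p * pd i f p.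
Proof. by rewrite pd.unlock; exact: smooth_partialM. Qed.

Lemma pdZ c f p : smooth_at f p ->
  pd i (fun q => c * f q) p = c * pd i f p.
Proof. by rewrite pd.unlock; exact: smooth_partialZ. Qed.

Lemma pdV f p : smooth_at f p -> f p != 0 ->
  pd i (fun q => (f q)^-1) p = - pd i f p / f p ^+ 2.
Proof. by rewrite pd.unlock; exact: smooth_partialV. Qed.

Lemma pd_cst (c : R) p : pd i (fun=> c) p = 0.
Proof. by rewrite pd.unlock; exact: partial_cst. Qed.

Lemma pd_coord j p : pd i (fun q => q 0 j) p = (j == i)%:R.
Proof. by rewrite pd.unlock; exact: partial_coord. Qed.

Lemma pd_ln f p : smooth_at f p -> 0 < f p ->
  pd i (fun q => ln (f q)) p = (f p)^-1 * pd i f p.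
Proof.
rewrite pd.unlock => sf f0.
exact: (smooth_partial_comp1 i sf (is_derive1_ln f0)).
Qed.

Lemma pd_powR a f p : smooth_at f p -> 0 < f p ->
  pd i (fun q => f q `^ a) p = a * f p `^ (a - 1) * pd i f p.
Proof.
rewrite pd.unlock => sf f0.
exact: (smooth_partial_comp1 i sf (is_derive1_powR a f0)).
Qed.

Lemma pd_sum (I : finType) (P : pred I) (F : I -> 'rV[R]_n -> R) p :
  (forall j, smooth_at (F j) p) ->
  pd i (fun q => \sum_(j | P j) F j q) p = \sum_(j | P j) pd i (F j) p.
Proof. by rewrite pd.unlock; exact: smooth_partial_sum. Qed.

Lemma pdC j f p : smooth_at f p -> pd i (pd j f) p = pd j (pd i f) p.
Proof. by rewrite pd.unlock; exact: smooth_partialC. Qed.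

Lemma pd_comp k (f : 'rV[R]_n -> 'rV[R]_k) phi p :
  smooth_rV f p -> smooth_at phi (f p) ->
  pd i (fun q => phi (f q)) p = \sum_a pd a phi (f p) * pd i (rowfun f a) p.
Proof. by rewrite pd.unlock; exact: smooth_partial_comp. Qed.

Lemma jacobian_pd k (f : 'rV[R]_n -> 'rV[R]_k) p a : smooth_rV f p ->
  'J f p i a = pd i (rowfun f a) p.
Proof. by rewrite pd.unlock; exact: smooth_jacobianE. Qed.

Lemma pd_at_max f p : smooth_at f p ->
  (\forall q \near p, f q <= f p) -> pd i f p = 0.
Proof. by rewrite pd.unlock; exact: smooth_critical_at_max. Qed.

Lemma hessian_pd_at_max f p (v : 'rV[R]_n) : smooth_at f p ->
  (\forall q \near p, f q <= f p) ->
  \sum_i \sum_j v 0 i * v 0 j * pd i (pd j f) p <= 0.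
Proof. by rewrite pd.unlock; exact: smooth_hessian_at_max. Qed.

End LockedPartial.

(** * Tension field of an isometric immersion *)

HB.lock Definition tens (R : realType) m n (h : 'rV[R]_n -> 'M[R]_n)
  (u : 'rV[R]_m -> 'rV[R]_n) : 'rV[R]_m -> 'rV[R]_n := tension h u.
HB.lock Definition nform (R : realType) m n (h : 'rV[R]_n -> 'M[R]_n)
  (u : 'rV[R]_m -> 'rV[R]_n) (eta : 'I_m -> 'rV[R]_m -> 'rV[R]_n) (i j : 'I_m) :
  'rV[R]_m -> 'rV[R]_n := nabla_form h u eta i j.
Arguments tens {R m n}.
Arguments nform {R m n}.

Section Tension.
Context {R : realType} {m n : nat}.
Variables (h : 'rV[R]_n -> 'M[R]_n) (u : 'rV[R]_m -> 'rV[R]_n).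
Implicit Types (S T : 'rV[R]_m -> 'rV[R]_n) (p : 'rV[R]_m).
Local Notation g := (pull h u).
Local Notation nabla := (nab h u).

Lemma trace_gE p (B : 'I_m -> 'I_m -> 'rV[R]_n) :
  trace_g h u p B = \sum_i \sum_j invmx (g p) i j *: B i j.
Proof. by rewrite /trace_g pullbackL. Qed.

Lemma nformE eta i j p : nform h u eta i j p =
  nabla (eta j) i p - \sum_k gam g p i j 0 k *: eta k p.
Proof.
rewrite nform.unlock /nabla_form nablaL pullbackL; apply: congr1; apply: congr1.
by apply: eq_bigr => k _; rewrite christoffelL.
Qed.

Lemma tensE p : tens h u p =
  \sum_i \sum_j invmx (g p) i j *: nform h u (dvec u) i j p.
Proof. by rewrite tens.unlock nform.unlock /tension trace_gE duL. Qed.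

Lemma inner_pullback p v w :
  inner (g p) v w = inner (h (u p)) (v *m dmx u p) (w *m dmx u p).
Proof. by rewrite pull_dmx inner_congr. Qed.

Lemma mul_dmx p v : v *m dmx u p = \sum_k v 0 k *: dvec u k p.
Proof.
rewrite [in LHS](row_sum_delta v) mulmx_suml; apply: eq_bigr => k _.
by rewrite -scalemxAl -rowE row_dmxL.
Qed.

Section AtPoint.
Variable p : 'rV[R]_m.
Hypothesis up : local_immersion h u p.
Let su := immersion_smooth up.
Let mh := immersion_metric up.
Let mg := pull_metric up.
Let ph : posdef (h (u p)). Proof. exact: nbhs_singleton mh.1. Qed.
Let pg : posdef (g p). Proof. exact: nbhs_singleton mg.1. Qed.

(** Second partial derivatives of u commute, and the Christoffel symbols of h are symmetric. *)
Lemma nab_dvecC i j : nab h u (dvec u j) i p = nab h u (dvec u i) j p.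
Proof.
have E : dvec (dvec u j) i p = dvec (dvec u i) j p.
  apply/rowP => a; rewrite -[LHS]/(rowfun _ a p) -[RHS]/(rowfun _ a p).
  by rewrite 4!rowfun_dvec; exact: (pdC i j (su a)).
rewrite !nabE E exchange_big /=; apply: congr1.
apply: eq_bigr => c _; apply: eq_bigr => b _.
by rewrite (gamC _ _ mh) mulrC.
Qed.

Lemma pd_pull k i j : pd k (fun q => g q i j) p =
  inner (h (u p)) (nabla (dvec u i) k p) (dvec u j p) +
  inner (h (u p)) (nabla (dvec u j) k p) (dvec u i p).
Proof.
rewrite (_ : (fun q => _) = fun q => inner (h (u q)) (dvec u i q) (dvec u j q)).
  rewrite (pd_inner _ su mh (smooth_dvec i su) (smooth_dvec j su)).
  by apply: congr1; exact: innerC ph.1.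
by apply/funext => q; rewrite pullE mxE.
Qed.

(** Expanding the three derivatives of the induced metric on the right yields six terms; by
    [nab_dvecC] four cancel in pairs and the other two are equal. *)
Lemma koszul i j k : inner (h (u p)) (nabla (dvec u j) i p) (dvec u k p) =
  inner (g p) (gam g p i j) (delta_mx 0 k).
Proof.
rewrite (inner_gam _ _ _ mg) !pd_pull.
rewrite (nab_dvecC k j) (nab_dvecC k i) (nab_dvecC j i).
move: (inner _ (nabla (dvec u j) i p) (dvec u k p)) => x.
move: (inner _ (nabla (dvec u k) i p) (dvec u j p)) => y.
by move: (inner _ (nabla (dvec u k) j p) (dvec u i p)) => z; field.
Qed.

Lemma inner_dvec_gam i j k :
  inner (h (u p)) (\sum_l gam g p i j 0 l *: dvec u l p) (dvec u k p) =
  inner (g p) (gam g p i j) (delta_mx 0 k).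
Proof.
by rewrite inner_pullback mul_dmx -rowE row_dmxL.
Qed.

(** What [nform] subtracts is exactly the tangential part found in [koszul]. The assumption that the
    domain carries the induced metric enters the argument here. *)
Lemma nform_normal i j k :
  inner (h (u p)) (nform h u (dvec u) i j p) (dvec u k p) = 0.
Proof. by rewrite nformE innerBl koszul inner_dvec_gam subrr. Qed.

Lemma tens_normal k : inner (h (u p)) (tens h u p) (dvec u k p) = 0.
Proof.
rewrite tensE inner_suml big1 // => i _; rewrite inner_suml big1 // => j _.
by rewrite innerZl nform_normal mulr0.
Qed.

(** The coefficients of the tangential projection are, by [koszul], the Christoffel symbols of the
    induced metric. *)
Lemma second_fundamental_formE i j :
  second_fundamental_form h u i j p = nform h u (dvec u) i j p.
Proof.
rewrite /second_fundamental_form /normal_part nablaL pullbackL duL nformE.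
apply: congr1; apply: congr1; rewrite exchange_big /=.
apply: eq_bigr => l _; rewrite -scaler_suml; congr (_ *: _).
have -> : gam g p i j 0 l = (gam g p i j *m g p *m invmx (g p)) 0 l.
  by rewrite (mulmxK (posdef_unit pg)).
rewrite mxE; apply: eq_bigr => k _; rewrite koszul mulrC; congr (_ * _).
by rewrite /inner trmx_delta -colE mxE.
Qed.

Lemma mean_curvatureE : mean_curvature h u p = m%:R^-1 *: tens h u p.
Proof.
rewrite /mean_curvature trace_gE tensE; congr (_ *: _).
apply: eq_bigr => i _; apply: eq_bigr => j _.
by rewrite second_fundamental_formE.
Qed.

Lemma smooth_inv_pull i j : smooth_at (fun q => invmx (g q) i j) p.
Proof. exact: (smooth_invmx mg.2 (posdef_unit pg)). Qed.

Lemma smooth_nform (eta : 'I_m -> 'rV[R]_m -> 'rV[R]_n) i j :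
  (forall k, smooth_rV (eta k) p) -> smooth_rV (nform h u eta i j) p.
Proof.
move=> se a; rewrite (_ : rowfun _ a = fun q => rowfun (nabla (eta j) i) a q -
    \sum_k gam g q i j 0 k * rowfun (eta k) a q).
  apply: smooth_atB; first exact: (smooth_nab i up (se j) a).
  apply: smooth_at_sum => k _; apply: smooth_atM; last exact: se.
  exact: smooth_gam.
apply/funext => q; rewrite /rowfun nformE [LHS]mxE [X in _ + X = _]mxE summxE.
by apply: congr1; apply: congr1; apply: eq_bigr => k _; rewrite mxE.
Qed.

Lemma smooth_tens : smooth_rV (tens h u) p.
Proof.
move=> a; rewrite (_ : rowfun _ a = fun q =>
    \sum_i \sum_j invmx (g q) i j * rowfun (nform h u (dvec u) i j) a q).
  apply: smooth_at_sum => i _; apply: smooth_at_sum => j _.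
  apply: smooth_atM; first exact: smooth_inv_pull.
  by apply: smooth_nform => k; exact: smooth_dvec.
apply/funext => q; rewrite /rowfun tensE summxE; apply: eq_bigr => i _.
by rewrite summxE; apply: eq_bigr => j _; rewrite mxE.
Qed.

End AtPoint.

End Tension.

(** * Curvature and the Bochner inequality *)

HB.lock Definition rcoef (R : realType) n (h : 'rV[R]_n -> 'M[R]_n)
  (p : 'rV[R]_n) (a b c d : 'I_n) : R := riemann_coef h p a b c d.
HB.lock Definition riem (R : realType) n (h : 'rV[R]_n -> 'M[R]_n)
  (p v w z : 'rV[R]_n) : 'rV[R]_n := riemann h p v w z.
Arguments rcoef {R n}.
Arguments riem {R n}.

Section Curvature.
Context {R : realType} {n : nat}.
Variables (h : 'rV[R]_n -> 'M[R]_n) (p : 'rV[R]_n).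
Implicit Types (v w z : 'rV[R]_n).

Lemma riemE v w z : riem h p v w z =
  \row_a \sum_b \sum_c \sum_d rcoef h p a b c d * z 0 b * v 0 c * w 0 d.
Proof. by rewrite riem.unlock rcoef.unlock. Qed.

Lemma rcoefN a b c d : rcoef h p a b c d = - rcoef h p a b d c.
Proof.
rewrite rcoef.unlock /riemann_coef partialL.
rewrite opprD opprB; congr (_ + _); rewrite -sumrN.
by apply: eq_bigr => e _; rewrite opprB.
Qed.

Lemma riem_same v z : riem h p v v z = 0.
Proof.
apply/rowP => a; rewrite riemE mxE [RHS]mxE big1 // => b _.
apply/eqP; rewrite -[_ == 0](mulrn_eq0 _ 2) mulr2n.
rewrite {1}exchange_big /= -big_split /= big1 // => c _.
rewrite -big_split /= big1 // => d _.
by rewrite rcoefN; ring.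
Qed.

(** Serves to bring an orthonormal frame inside the curvature, so that the trace in the Jacobi
    operator becomes a sum of terms of the form R(v, w)v. *)
Lemma riem_comb (I : finType) (P Q : I -> R) (V W : I -> 'rV[R]_n) w :
  riem h p (\sum_i P i *: V i) w (\sum_j Q j *: W j) =
  \sum_i \sum_j (P i * Q j) *: riem h p (V i) w (W j).
Proof.
apply/rowP => a; rewrite riemE mxE summxE.
under [RHS]eq_bigr => i _ do rewrite summxE.
transitivity (\sum_i \sum_j \sum_b \sum_c \sum_d
   (P i * Q j) * (rcoef h p a b c d * W j 0 b * V i 0 c * w 0 d)); last first.
  apply: eq_bigr => i _; apply: eq_bigr => j _; rewrite mxE riemE mxE.
  rewrite mulr_sumr; apply: eq_bigr => b _; rewrite mulr_sumr.
  by apply: eq_bigr => c _; rewrite mulr_sumr.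
under [RHS]eq_bigr => i _ do rewrite exchange_big /=.
rewrite [RHS]exchange_big /=; apply: eq_bigr => b _.
under [RHS]eq_bigr => i _ do rewrite exchange_big /=.
rewrite [RHS]exchange_big /=; apply: eq_bigr => c _.
under [RHS]eq_bigr => i _ do rewrite exchange_big /=.
rewrite [RHS]exchange_big /=; apply: eq_bigr => d _.
have EV : (\sum_i P i *: V i) 0 c = \sum_i P i * V i 0 c.
  by rewrite summxE; apply: eq_bigr => i _; rewrite mxE.
have EW : (\sum_i Q i *: W i) 0 b = \sum_i Q i * W i 0 b.
  by rewrite summxE; apply: eq_bigr => i _; rewrite mxE.
rewrite EV EW mulr_sumr mulr_suml; apply: eq_bigr => i _.
rewrite [X in X * _ * _]mulr_sumr !mulr_suml; apply: eq_bigr => j _; ring.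
Qed.

Lemma riemZ c v z : riem h p v (c *: v) z = 0.
Proof.
have -> : riem h p v (c *: v) z = c *: riem h p v v z.
  apply/rowP => a; rewrite [RHS]mxE !riemE [LHS]mxE [X in _ * X]mxE mulr_sumr.
  apply: eq_bigr => b _; rewrite mulr_sumr; apply: eq_bigr => c' _.
  by rewrite mulr_sumr; apply: eq_bigr => d _; rewrite mxE; ring.
by rewrite riem_same scaler0.
Qed.

(** For an independent pair the denominator of [sectional] is positive and can be cleared. For a
    dependent pair the form vanishes, by linearity if v = 0 and by antisymmetry if w is a multiple
    of v. *)
Lemma nonpositive_curvature_form : posdef (h p) ->
  (forall v w, row_free (col_mx v w) -> sectional h p v w <= 0) ->
  forall v w, 0 <= inner (h p) (riem h p v w v) w.
Proof.
move=> ph sec v w.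
have [->|v0] := eqVneq v 0.
  suff -> : riem h p 0 w 0 = 0 by rewrite inner0l.
  apply/rowP => a; rewrite riemE [LHS]mxE [RHS]mxE big1 // => b _.
  rewrite big1 // => c _; rewrite big1 // => d _.
  by rewrite [X in _ * X * _ * _]mxE mulr0 !mul0r.
have [[c ->]|nw] := pselect (exists c, w = c *: v).
  by rewrite riemZ inner0l.
have nw' c : w <> c *: v by move=> E; apply: nw; exists c.
have := sec v w (independent_pair v0 nw').
rewrite /sectional.
have -> : riemann h p v w v = riem h p v w v by rewrite riem.unlock.
by rewrite ler_pdivrMr ?cauchy_schwarz_strict // mul0r oppr_le0.
Qed.

End Curvature.

Section Bochner.
Context {R : realType} {m n : nat}.
Variables (h : 'rV[R]_n -> 'M[R]_n) (u : 'rV[R]_m -> 'rV[R]_n).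
Implicit Types (S T : 'rV[R]_m -> 'rV[R]_n) (p : 'rV[R]_m).
Local Notation g := (pull h u).
Local Notation nabla := (nab h u).

(** The Laplace-Beltrami operator of the induced metric, with the sign that makes it nonpositive at
    a maximum, opposite to that of [rough_laplacian]. *)
Definition laplacian (f : 'rV[R]_m -> R) p : R :=
  \sum_i \sum_j invmx (g p) i j *
    (pd i (pd j f) p - \sum_k gam g p i j 0 k * pd k f p).

Lemma jacobiE S p : jacobi h u S p =
  - (\sum_i \sum_j invmx (g p) i j *: nform h u (nabla S) i j p) +
  \sum_i \sum_j invmx (g p) i j *:
     riem h (u p) (dvec u i p) (S p) (dvec u j p).
Proof.
rewrite /jacobi /rough_laplacian /nabla_adjoint nablaL duL riem.unlock.
by rewrite nform.unlock !trace_gE.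
Qed.

Section AtPoint.
Variable p : 'rV[R]_m.
Hypothesis up : local_immersion h u p.
Let su := immersion_smooth up.
Let mh := immersion_metric up.
Let mg := pull_metric up.
Let ph : posdef (h (u p)). Proof. exact: nbhs_singleton mh.1. Qed.
Let pg : posdef (g p). Proof. exact: nbhs_singleton mg.1. Qed.

(** Needed on a neighbourhood because [laplacian_norm2] differentiates this identity once more. *)
Lemma pd_norm2_near S j : smooth_rV S p -> \forall q \near p,
  pd j (fun q => inner (h (u q)) (S q) (S q)) q =
  2 * inner (h (u q)) (nabla S j q) (S q).
Proof.
move=> sS; have nS := smooth_rV_near sS; have nu := local_immersion_near up.
near=> q.
have uq : local_immersion h u q by near: q.
have Sq : smooth_rV S q by near: q.
have mq := immersion_metric uq; have [sq _] := nbhs_singleton mq.1.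
rewrite (pd_inner j (immersion_smooth uq) mq Sq Sq).
by rewrite (innerC (S q) _ sq) mulrDl mul1r.
Unshelve. all: by end_near. Qed.

Lemma laplacian_norm2 S : smooth_rV S p ->
  laplacian (fun q => inner (h (u q)) (S q) (S q)) p =
  2 * (\sum_i \sum_j invmx (g p) i j *
         inner (h (u p)) (nabla S i p) (nabla S j p)) +
  2 * inner (h (u p))
        (\sum_i \sum_j invmx (g p) i j *: nform h u (nabla S) i j p) (S p).
Proof.
move=> sS; rewrite inner_suml 2!mulr_sumr -big_split /=.
apply: eq_bigr => i _; rewrite inner_suml 2!mulr_sumr -big_split /=.
apply: eq_bigr => j _.
rewrite (pd_near i (pd_norm2_near j sS)).
rewrite pdZ; last first.
  exact: (smooth_inner su mh.2 (smooth_nab j up sS) sS).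
rewrite (pd_inner i su mh (smooth_nab j up sS) sS).
have -> : \sum_k gam g p i j 0 k * pd k (fun q => inner (h (u q)) (S q) (S q)) p =
    2 * inner (h (u p)) (\sum_k gam g p i j 0 k *: nabla S k p) (S p).
  rewrite inner_suml mulr_sumr; apply: eq_bigr => k _.
  by rewrite (nbhs_singleton (pd_norm2_near k sS)) innerZl mulrCA.
rewrite nformE innerZl innerBl (innerC (nabla S j p) _ ph.1).
move: (inner _ _ (nabla S j p)) (inner _ (nabla (nabla S j) i p) _).
by move: (inner _ _ _) (invmx _ _ _) => x y z t; ring.
Qed.

(** The identity <tau, d_k u> = 0 holds near [p], so its derivative along i vanishes. *)
Lemma nabla_tens_dvec i k :
  inner (h (u p)) (nabla (tens h u) i p) (dvec u k p) =
  - inner (h (u p)) (tens h u p) (nabla (dvec u k) i p).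
Proof.
have := pd_inner i su mh (smooth_tens up) (smooth_dvec k su).
rewrite (@pd_near _ _ _ _ (fun=> 0)); last first.
  apply: filterS (local_immersion_near up) => q uq; exact: tens_normal.
by rewrite pd_cst => /esym/eqP; rewrite addr_eq0 => /eqP.
Qed.

(** After [nabla_tens_dvec] the trace is that of -<tau, nabla_i d_k u>. Adding the Christoffel
    terms, which are tangential and pair to zero with tau, completes the trace to -<tau, tau>. *)
Lemma trace_nabla_tens : \sum_i \sum_k invmx (g p) i k *
    inner (h (u p)) (nabla (tens h u) i p) (dvec u k p) =
  - inner (h (u p)) (tens h u p) (tens h u p).
Proof.
rewrite {2}tensE inner_sumr -sumrN; apply: eq_bigr => i _.
rewrite inner_sumr -sumrN; apply: eq_bigr => k _.
rewrite nabla_tens_dvec innerZr mulrN nformE innerBr.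
rewrite inner_sumr big1 ?subr0 // => l _.
by rewrite innerZr (tens_normal up) mulr0.
Qed.

Lemma trace_metric : \sum_i \sum_k invmx (g p) i k *
  inner (h (u p)) (dvec u i p) (dvec u k p) = m%:R.
Proof.
transitivity (\tr (invmx (g p) *m g p)); last first.
  by rewrite mulVmx ?posdef_unit // mxtrace1.
apply: eq_bigr => i _; rewrite mxE; apply: eq_bigr => k _; congr (_ * _).
by rewrite pullE mxE; exact: innerC ph.1.
Qed.

Lemma invmx_trace_inner (V W : 'I_m -> 'rV[R]_n) (P : 'M[R]_m) :
  P *m g p *m P^T = 1%:M ->
  \sum_i \sum_j invmx (g p) i j * inner (h (u p)) (V i) (W j) =
  \sum_c inner (h (u p)) (\sum_i P c i *: V i) (\sum_j P c j *: W j).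
Proof.
move=> EP; rewrite (invmx_trace _ EP); apply: eq_bigr => c _.
rewrite inner_suml; apply: eq_bigr => i _; rewrite inner_sumr.
by apply: eq_bigr => j _; rewrite innerZl innerZr mulrA.
Qed.

(** Cauchy-Schwarz between nabla tau and du, in the form of a completed square: over an orthonormal
    frame the sum of |nabla_c tau + s d_c u|^2 is nonnegative, and by the two traces it equals
    |nabla tau|^2 - 2 s F + s^2 m. The choice s = F/m is optimal. *)
Lemma nabla_tens_lower_bound : (0 < m)%N ->
  inner (h (u p)) (tens h u p) (tens h u p) ^+ 2 / m%:R <=
  \sum_i \sum_j invmx (g p) i j *
    inner (h (u p)) (nabla (tens h u) i p) (nabla (tens h u) j p).
Proof.
move=> m0; have [P EP] := posdef_orthonormal pg.
set F := inner _ (tens h u p) (tens h u p); pose s := F / m%:R.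
have m0' : m%:R != 0 :> R by rewrite pnatr_eq0 -lt0n.
pose N c := \sum_i P c i *: nabla (tens h u) i p.
pose E c := \sum_i P c i *: dvec u i p.
rewrite (invmx_trace_inner _ _ EP) -/N.
have EN : \sum_c inner (h (u p)) (N c) (E c) = - F.
  by rewrite -trace_nabla_tens (invmx_trace_inner _ _ EP).
have EE : \sum_c inner (h (u p)) (E c) (E c) = m%:R.
  by rewrite -trace_metric (invmx_trace_inner _ _ EP).
have : 0 <= \sum_c inner (h (u p)) (N c + s *: E c) (N c + s *: E c).
  by apply: sumr_ge0 => c _; exact: posdef_inner_ge0.
under eq_bigr => c _.
  rewrite innerDl !innerDr !innerZl !innerZr (innerC (E c) _ ph.1) addrA.
  rewrite -[X in X + _]addrA -mulr2n -[_ *+ 2]mulr_natl mulrA.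
  over.
rewrite !big_split /= -!mulr_sumr EN EE => H.
rewrite -subr_ge0; apply: le_trans H _; rewrite le_eqVlt; apply/orP; left.
by apply/eqP; rewrite /s; field.
Qed.

(** Biharmonicity replaces the second-order term of [laplacian_norm2] by the curvature trace, which
    is nonnegative for each frame vector separately; what remains is |nabla tau|^2. *)
Lemma bochner_inequality : (0 < m)%N ->
  (forall v w, 0 <= inner (h (u p)) (riem h (u p) v w v) w) ->
  jacobi h u (tens h u) p = 0 ->
  2 / m%:R * inner (h (u p)) (tens h u p) (tens h u p) ^+ 2 <=
  laplacian (fun q => inner (h (u q)) (tens h u q) (tens h u q)) p.
Proof.
move=> m0 curv; rewrite jacobiE => /eqP; rewrite addrC subr_eq0 => /eqP J.
have st := smooth_tens up.
rewrite (laplacian_norm2 st) -J.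
have [P EP] := posdef_orthonormal pg.
have curv_ge0 : 0 <= inner (h (u p)) (\sum_i \sum_j invmx (g p) i j *:
    riem h (u p) (dvec u i p) (tens h u p) (dvec u j p)) (tens h u p).
  have -> : inner (h (u p)) (\sum_i \sum_j invmx (g p) i j *:
      riem h (u p) (dvec u i p) (tens h u p) (dvec u j p)) (tens h u p) =
    \sum_i \sum_j invmx (g p) i j * inner (h (u p))
      (riem h (u p) (dvec u i p) (tens h u p) (dvec u j p)) (tens h u p).
    rewrite inner_suml; apply: eq_bigr => i _; rewrite inner_suml.
    by apply: eq_bigr => j _; rewrite innerZl.
  rewrite (invmx_trace _ EP); apply: sumr_ge0 => c _.
  have := curv (\sum_i P c i *: dvec u i p) (tens h u p).
  rewrite riem_comb inner_suml => H; apply: le_trans H _; rewrite le_eqVlt.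
  apply/orP; left; apply/eqP; apply: eq_bigr => i _; rewrite inner_suml.
  by apply: eq_bigr => j _; rewrite innerZl.
have := nabla_tens_lower_bound m0.
set F2 := _ ^+ 2; set A := (X in _ <= X -> _); set B := inner _ _ _ in curv_ge0 *.
rewrite -/A -mulrA [m%:R^-1 * _]mulrC => H.
by rewrite -mulrDr ler_pM2l //; apply: le_trans H _; rewrite lerDl.
Qed.

End AtPoint.
End Bochner.

(** * Chart independence of the norm of the tension field *)

Section Covariance.
Context {R : realType}.

Lemma pull_entry m n (h : 'rV[R]_n -> 'M[R]_n) (u : 'rV[R]_m -> 'rV[R]_n) q i j :
  pull h u q i j = inner (h (u q)) (dvec u i q) (dvec u j q).
Proof. by rewrite pullE mxE. Qed.

(** Gives injectivity of the Jacobian of a coordinate change from definiteness of the metrics alone,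
    so that no inverse map has to be differentiated. *)
Lemma posdef_congr_free m n (A : 'M[R]_n) (P : 'M[R]_(m, n)) :
  posdef (P *m A *m P^T) -> row_free P.
Proof.
move=> pP; apply: inj_row_free => v vP0; apply: (posdef_inner_eq0 pP).
by rewrite inner_congr vP0 inner0l.
Qed.

Lemma gam_near n (g g' : 'rV[R]_n -> 'M[R]_n) q i j :
  (\forall q \near q, g q = g' q) -> gam g q i j = gam g' q i j.
Proof.
move=> gg; rewrite gam.unlock /chris /christoffel partialL.
have E k a b : pd k (fun q => g q a b) q = pd k (fun q => g' q a b) q.
  by apply: pd_near; apply: filterS gg => q' ->.
apply/rowP => k; rewrite [LHS]mxE [RHS]mxE (nbhs_singleton gg).
by apply: congr1; apply: eq_bigr => l _; rewrite !E.
Qed.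

Lemma dvec_near m n (S T : 'rV[R]_m -> 'rV[R]_n) i q :
  (\forall q \near q, S q = T q) -> dvec S i q = dvec T i q.
Proof.
move=> ST; apply/rowP => a.
rewrite -[LHS]/(rowfun _ a q) -[RHS]/(rowfun _ a q) !rowfun_dvec.
by apply: pd_near; apply: filterS ST => q' E; rewrite /= /rowfun E.
Qed.

Lemma dvec_near_near m n (S T : 'rV[R]_m -> 'rV[R]_n) i (q : 'rV[R]_m) :
  (\forall q \near q, S q = T q) -> \forall q \near q, dvec S i q = dvec T i q.
Proof. by move=> /nbhs_interior; apply: filterS => q'; exact: dvec_near. Qed.

Lemma nab_near m n (h : 'rV[R]_n -> 'M[R]_n) (u S T : 'rV[R]_m -> 'rV[R]_n) i q :
  (\forall q \near q, S q = T q) -> nab h u S i q = nab h u T i q.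
Proof. by move=> ST; rewrite !nabE (dvec_near _ ST) (nbhs_singleton ST). Qed.

Lemma nab_near_map m n (h : 'rV[R]_n -> 'M[R]_n) (u v S : 'rV[R]_m -> 'rV[R]_n) i q :
  (\forall q \near q, u q = v q) -> nab h u S i q = nab h v S i q.
Proof. by move=> uv; rewrite !nabE (dvec_near _ uv) (nbhs_singleton uv). Qed.

Lemma pull_near m n (h : 'rV[R]_n -> 'M[R]_n) (u v : 'rV[R]_m -> 'rV[R]_n)
    (q : 'rV[R]_m) : (\forall q \near q, u q = v q) ->
  \forall q \near q, pull h u q = pull h v q.
Proof.
move=> /nbhs_interior; apply: filterS => q' uv; rewrite !pullE.
by apply/matrixP => i j; rewrite !mxE (nbhs_singleton uv) !(dvec_near _ uv).
Qed.

Lemma tens_near m n (h : 'rV[R]_n -> 'M[R]_n) (u v : 'rV[R]_m -> 'rV[R]_n) q :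
  (\forall q \near q, u q = v q) -> tens h u q = tens h v q.
Proof.
move=> uv; rewrite !tensE; have pn := pull_near h uv.
apply: eq_bigr => i _; apply: eq_bigr => j _; rewrite !nformE.
rewrite (nbhs_singleton pn) (nab_near_map _ _ _ uv).
rewrite (nab_near _ _ _ (dvec_near_near j uv)) (gam_near _ _ pn).
by do 2!apply: congr1; apply: congr1; apply: eq_bigr => k _; rewrite (dvec_near _ uv).
Qed.

Lemma smooth_rV_comp m k n (psi : 'rV[R]_m -> 'rV[R]_k) (f : 'rV[R]_k -> 'rV[R]_n) q :
  smooth_rV psi q -> smooth_rV f (psi q) -> smooth_rV (fun q => f (psi q)) q.
Proof. by move=> sp sf a; exact: smooth_at_comp sp (sf a). Qed.

Lemma dvec_comp m k n (psi : 'rV[R]_m -> 'rV[R]_k) (f : 'rV[R]_k -> 'rV[R]_n) i q :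
  smooth_rV psi q -> smooth_rV f (psi q) ->
  dvec (fun q => f (psi q)) i q =
  \sum_l dvec psi i q 0 l *: dvec f l (psi q).
Proof.
move=> sp sf; apply/rowP => a; rewrite -[LHS]/(rowfun _ a q) rowfun_dvec summxE.
rewrite (pd_comp i sp (sf a)); apply: eq_bigr => l _.
rewrite [RHS]mxE mulrC -[dvec psi _ _ _ _]/(rowfun _ l q) rowfun_dvec.
by rewrite -[dvec f _ _ _ _]/(rowfun _ a _) rowfun_dvec.
Qed.

Lemma nab_comp m k n (h : 'rV[R]_n -> 'M[R]_n) (psi : 'rV[R]_m -> 'rV[R]_k)
    (f S : 'rV[R]_k -> 'rV[R]_n) i q :
  smooth_rV psi q -> smooth_rV f (psi q) -> smooth_rV S (psi q) ->
  nab h (fun q => f (psi q)) (fun q => S (psi q)) i q =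
  \sum_l dvec psi i q 0 l *: nab h f S l (psi q).
Proof.
move=> sp sf sS; rewrite nabE (dvec_comp i sp sf) (dvec_comp i sp sS).
under [in RHS]eq_bigr => l _ do rewrite nabE scalerDr.
rewrite [RHS]big_split /=; apply: congr1.
under [RHS]eq_bigr => l _ do rewrite scaler_sumr.
rewrite [RHS]exchange_big /=; apply: eq_bigr => b _.
under [RHS]eq_bigr => l _ do rewrite scaler_sumr.
rewrite [RHS]exchange_big /=; apply: eq_bigr => c _.
rewrite summxE mulr_suml scaler_suml; apply: eq_bigr => l _.
by rewrite mxE scalerA mulrA.
Qed.

Lemma nab_comb m n (h : 'rV[R]_n -> 'M[R]_n) (u : 'rV[R]_m -> 'rV[R]_n)
    (I : finType) (a : I -> 'rV[R]_m -> R) (S : I -> 'rV[R]_m -> 'rV[R]_n) i q :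
  (forall k, smooth_at (a k) q) -> (forall k, smooth_rV (S k) q) ->
  nab h u (fun q => \sum_k a k q *: S k q) i q =
  \sum_k (pd i (a k) q *: S k q + a k q *: nab h u (S k) i q).
Proof.
move=> sa sS.
have -> : \sum_k (pd i (a k) q *: S k q + a k q *: nab h u (S k) i q) =
  \sum_k (pd i (a k) q *: S k q + a k q *: dvec (S k) i q) +
  \sum_k a k q *: (\sum_b \sum_c (dvec u i q 0 b * S k q 0 c) *: gam h (u q) b c).
  rewrite -big_split /=; apply: eq_bigr => k _.
  by rewrite nabE scalerDr addrA.
rewrite nabE; congr (_ + _).
  apply/rowP => c; rewrite -[LHS]/(rowfun _ c q) rowfun_dvec.
  rewrite (_ : rowfun _ c = fun q => \sum_k a k q * rowfun (S k) c q); last first.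
    by apply/funext => q'; rewrite /rowfun summxE; apply: eq_bigr => k _; rewrite mxE.
  rewrite pd_sum => [|k]; last exact: smooth_atM (sa k) (sS k c).
  rewrite summxE; apply: eq_bigr => k _.
  rewrite (pdM i (sa k) (sS k c)) addrC [RHS]mxE.
  rewrite [X in _ = X + _]mxE [X in _ = _ + X]mxE mulrC; congr (_ + _ * _).
  by rewrite -[RHS]/(rowfun _ c q) rowfun_dvec.
under [RHS]eq_bigr => k _ do rewrite scaler_sumr.
rewrite [RHS]exchange_big /=; apply: eq_bigr => b _.
under [RHS]eq_bigr => k _ do rewrite scaler_sumr.
rewrite [RHS]exchange_big /=; apply: eq_bigr => c _.
rewrite summxE mulr_sumr scaler_suml; apply: eq_bigr => k _.
by rewrite mxE scalerA mulrCA.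
Qed.

Lemma pull_comp m k n (h : 'rV[R]_n -> 'M[R]_n) (psi : 'rV[R]_m -> 'rV[R]_k)
    (f : 'rV[R]_k -> 'rV[R]_n) q :
  smooth_rV psi q -> smooth_rV f (psi q) ->
  pull h (fun q => f (psi q)) q =
  dmx psi q *m pull h f (psi q) *m (dmx psi q)^T.
Proof.
move=> sp sf; apply/matrixP => i j; rewrite -[RHS]inner_delta inner_congr.
rewrite -!rowE !row_dmxL inner_pullback !mul_dmx pull_entry.
by rewrite (dvec_comp i sp sf) (dvec_comp j sp sf).
Qed.

Section SourceChange.
Context {m n : nat}.
Variables (h : 'rV[R]_n -> 'M[R]_n) (psi : 'rV[R]_m -> 'rV[R]_m)
  (f : 'rV[R]_m -> 'rV[R]_n) (q : 'rV[R]_m).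
Local Notation F := (fun q => f (psi q)).
Hypotheses (sp : smooth_rV psi q) (iF : local_immersion h F q)
  (iF2 : local_immersion h f (psi q)).

Let sf := immersion_smooth iF2.
Let gF : posdef (pull h F q). Proof. exact: nbhs_singleton (pull_metric iF).1. Qed.
Let gf : posdef (pull h f (psi q)).
Proof. exact: nbhs_singleton (pull_metric iF2).1. Qed.

Lemma dmx_psi_unit : dmx psi q \in unitmx.
Proof.
rewrite -row_free_unit; apply: (@posdef_congr_free _ _ (pull h f (psi q))).
by rewrite -(pull_comp h sp sf).
Qed.

Lemma inv_pull_comp :
  (dmx psi q)^T *m invmx (pull h F q) *m dmx psi q = invmx (pull h f (psi q)).
Proof.
have uA := dmx_psi_unit; have ug := posdef_unit gf.
have uF := posdef_unit gF.
apply: (can_inj (mulmxK ug)); rewrite mulVmx //.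
have uAT : (dmx psi q)^T \in unitmx by rewrite unitmx_tr.
apply: (can_inj (mulmxK uAT)); rewrite mul1mx -!mulmxA.
by rewrite [dmx psi q *m (_ *m _)]mulmxA -(pull_comp h sp sf) mulVmx // mulmx1.
Qed.

Lemma normal_change w : (forall k, inner (h (F q)) (dvec f k (psi q)) w = 0) ->
  forall k, inner (h (F q)) (dvec F k q) w = 0.
Proof.
move=> nw k; rewrite (dvec_comp k sp sf) inner_suml big1 // => l _.
by rewrite innerZl nw mulr0.
Qed.

Lemma normal_change_inv w : (forall k, inner (h (F q)) (dvec F k q) w = 0) ->
  forall k, inner (h (F q)) (dvec f k (psi q)) w = 0.
Proof.
move=> nw k.
have EF l : dvec F l q = dvec psi l q *m dmx f (psi q).
  by rewrite mul_dmx (dvec_comp l sp sf).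
have -> : dvec f k (psi q) =
    \sum_l (invmx (dmx psi q)) k l *: dvec F l q.
  under eq_bigr => l _ do rewrite EF scalemxAl.
  rewrite -mulmx_suml.
  have -> : \sum_l invmx (dmx psi q) k l *: dvec psi l q =
      delta_mx 0 k *m invmx (dmx psi q) *m dmx psi q.
    rewrite mul_dmx; apply: eq_bigr => l _; congr (_ *: _).
    by rewrite -rowE mxE.
  by rewrite (mulmxKV dmx_psi_unit) -rowE row_dmxL.
by rewrite inner_suml big1 // => l _; rewrite innerZl nw mulr0.
Qed.

(** Paired with a normal vector, the Christoffel symbols of the induced metric disappear, and with
    them the part of the tension that transforms in a complicated way. *)
Lemma inner_tens (u : 'rV[R]_m -> 'rV[R]_n) p w :
  (forall k, inner (h (u p)) (dvec u k p) w = 0) ->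
  inner (h (u p)) (tens h u p) w =
  \sum_i \sum_j invmx (pull h u p) i j *
     inner (h (u p)) (nab h u (dvec u j) i p) w.
Proof.
move=> nw; rewrite tensE inner_suml; apply: eq_bigr => i _.
rewrite inner_suml; apply: eq_bigr => j _; rewrite innerZl nformE innerBl.
rewrite inner_suml [X in _ - X]big1 ?subr0 // => k _.
by rewrite innerZl nw mulr0.
Qed.

(** The second derivatives of [psi] multiply the vectors d_k f, which are orthogonal to [w]; only
    the tensorial terms survive. *)
Lemma inner_nab_comp w i j :
  (forall k, inner (h (F q)) (dvec f k (psi q)) w = 0) ->
  inner (h (F q)) (nab h F (dvec F j) i q) w =
  \sum_k \sum_l dvec psi j q 0 k * dvec psi i q 0 l *
     inner (h (F q)) (nab h f (dvec f k) l (psi q)) w.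
Proof.
move=> nw.
rewrite (@nab_near _ _ _ _ _
  (fun q => \sum_k rowfun (dvec psi j) k q *: dvec f k (psi q))); last first.
  have n1 := smooth_rV_near sp; have n2 := near_pull sp (smooth_rV_near sf).
  near=> q'; rewrite (@dvec_comp _ _ _ psi f j q') //; by near: q'.
rewrite nab_comb => [|k|k]; last first.
- by apply: smooth_rV_comp => //; exact: smooth_dvec.
- exact: (smooth_dvec j sp).
rewrite inner_suml; apply: eq_bigr => k _; rewrite innerDl innerZl nw mulr0 add0r.
rewrite (nab_comp _ _ sp sf (smooth_dvec k sf)) innerZl inner_suml mulr_sumr.
by apply: eq_bigr => l _; rewrite innerZl mulrA.
Unshelve. all: by end_near. Qed.

(** Both tension fields are normal to the same tangent space, hence so is their difference [w]. It
    thus suffices to compare their products with [w], where the pull-back of the inverse metric by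
    the Jacobian of [psi] accounts for everything. *)
Lemma tens_source_change : tens h F q = tens h f (psi q).
Proof.
have ph : posdef (h (F q)) := nbhs_singleton (immersion_metric iF).1.
pose w := tens h F q - tens h f (psi q).
have nf k : inner (h (F q)) (dvec f k (psi q)) w = 0.
  rewrite innerBr (innerC _ (tens h f (psi q)) ph.1) (tens_normal iF2) subr0.
  move: k; apply: normal_change_inv => k.
  by rewrite (innerC _ (tens h F q) ph.1) (tens_normal iF).
have nF := normal_change nf.
suff : inner (h (F q)) w w = 0.
  by move=> /(posdef_inner_eq0 ph)/eqP; rewrite subr_eq0 => /eqP.
rewrite {1}/w innerBl (inner_tens nF) (inner_tens (u := f) (p := psi q) nf).
apply/eqP; rewrite subr_eq0; apply/eqP.
transitivity (\sum_i \sum_j \sum_k \sum_l invmx (pull h F q) i j *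
   (dvec psi j q 0 k * dvec psi i q 0 l *
     inner (h (F q)) (nab h f (dvec f k) l (psi q)) w)).
  apply: eq_bigr => i _; apply: eq_bigr => j _.
  rewrite (inner_nab_comp _ _ nf) mulr_sumr; apply: eq_bigr => k _.
  by rewrite mulr_sumr.
rewrite -inv_pull_comp.
transitivity (\sum_l \sum_k \sum_j \sum_i invmx (pull h F q) i j *
   (dvec psi j q 0 k * dvec psi i q 0 l *
     inner (h (F q)) (nab h f (dvec f k) l (psi q)) w)); last first.
  apply: eq_bigr => l _; apply: eq_bigr => k _.
  rewrite [X in X * _]mxE mulr_suml; apply: eq_bigr => j _.
  rewrite [X in X * _ * _]mxE !mulr_suml; apply: eq_bigr => i _.
  rewrite [(dmx psi q)^T _ _]mxE.
  have E a b : dmx psi q a b = dvec psi a q 0 b by rewrite -row_dmxL [RHS]mxE.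
  by rewrite !E; ring.
under eq_bigr => i _ do under eq_bigr => j _ do rewrite exchange_big /=.
under eq_bigr => i _ do rewrite exchange_big /=.
rewrite exchange_big /=; apply: eq_bigr => l _.
under eq_bigr => i _ do rewrite exchange_big /=.
rewrite exchange_big /=; apply: eq_bigr => k _.
exact: exchange_big.
Qed.

End SourceChange.

Section TargetChange.
Context {m n : nat}.
Variables (h1 h2 : 'rV[R]_n -> 'M[R]_n) (chi : 'rV[R]_n -> 'rV[R]_n)
  (f : 'rV[R]_m -> 'rV[R]_n) (q : 'rV[R]_m).
Local Notation F := (fun q => chi (f q)).
Hypotheses (sc : smooth_rV chi (f q)) (i1 : local_immersion h1 f q)
  (m2 : metric_at h2 (chi (f q)))
  (h12 : \forall y \near f q,
     h1 y = dmx chi y *m h2 (chi y) *m (dmx chi y)^T).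

Let sf := immersion_smooth i1.
Let m1 := immersion_metric i1.

Lemma chi_immersion : local_immersion h2 chi (f q).
Proof.
split=> //; have p1 := m1.1; near=> y.
apply: (@posdef_congr_free _ _ (h2 (chi y))).
have <- : h1 y = dmx chi y *m h2 (chi y) *m (dmx chi y)^T by near: y.
by near: y.
Unshelve. all: by end_near. Qed.

Lemma pull_chi : \forall y \near f q, pull h2 chi y = h1 y.
Proof. by apply: filterS h12 => y ->; exact: pull_dmx. Qed.

(** The transformation law of Christoffel symbols. The coordinate change [chi] is itself an
    isometric immersion between spaces of equal dimension; its normal space is 0, so its second
    fundamental form vanishes. *)
Lemma nab_chi b c : nab h2 chi (dvec chi c) b (f q) =
  \sum_k gam h1 (f q) b c 0 k *: dvec chi k (f q).
Proof.
have ic := chi_immersion; have ph := nbhs_singleton m2.1.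
have fD : dmx chi (f q) \in unitmx.
  by rewrite -row_free_unit; exact: nbhs_singleton (immersion_free ic).
rewrite -(gam_near b c pull_chi); apply/eqP; rewrite -subr_eq0 -nformE.
set w := nform _ _ _ _ _ _; apply/eqP; apply: (posdef_inner_eq0 ph).
rewrite -[X in inner _ _ X](mulmxKV fD) mul_dmx inner_sumr big1 // => k _.
by rewrite innerZr (nform_normal ic) mulr0.
Qed.

Lemma pull_target_change : \forall q \near q, pull h2 F q = pull h1 f q.
Proof.
have n1 := smooth_rV_near sf.
have n2 : \forall q \near q, smooth_rV chi (f q).
  by apply: near_pull => //; exact: smooth_rV_near.
have n3 := near_pull sf pull_chi.
near=> q'; rewrite (@pull_comp _ _ _ h2 f chi q'); last 2 first.
- by near: q'.
- by near: q'.
have E : pull h2 chi (f q') = h1 (f q') by near: q'.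
by rewrite E pull_dmx.
Unshelve. all: by end_near. Qed.

Lemma target_change_immersion : local_immersion h2 F q.
Proof.
split=> //; first exact: smooth_rV_comp.
have p1 := (pull_metric i1).1; have p2 := pull_target_change.
near=> q'; apply: (@posdef_congr_free _ _ (h2 (chi (f q')))).
rewrite -pull_dmx (_ : pull h2 F q' = pull h1 f q'); by near: q'.
Unshelve. all: by end_near. Qed.

(** The derivatives of the components d_k chi produced by the Leibniz rule are, by [nab_chi], the
    images of the Christoffel terms of [h1]. *)
Lemma nab_target_change (S : 'rV[R]_m -> 'rV[R]_n) i : smooth_rV S q ->
  nab h2 F (fun q => S q *m dmx chi (f q)) i q =
  nab h1 f S i q *m dmx chi (f q).
Proof.
move=> sS; have -> : (fun q => S q *m dmx chi (f q)) =
    fun q => \sum_k rowfun S k q *: dvec chi k (f q).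
  by apply/funext => q'; rewrite mul_dmx.
rewrite nab_comb => [|k|k]; last first.
- by apply: smooth_rV_comp => //; exact: smooth_dvec.
- exact: sS.
rewrite nabE mulmxDl !mul_dmx big_split /=; congr (_ + _).
  by apply: eq_bigr => k _; rewrite -rowfun_dvec.
under eq_bigr => k _.
  rewrite (nab_comp _ _ sf sc (smooth_dvec k sc)).
  under eq_bigr => l _ do rewrite nab_chi.
  over.
under [RHS]eq_bigr => k _ do rewrite summxE scaler_suml.
rewrite [RHS]exchange_big /= [LHS](eq_bigr (fun k => \sum_l \sum_j
  (dvec f i q 0 l * S q 0 k * gam h1 (f q) l k 0 j) *: dvec chi j (f q))).
  rewrite exchange_big /=; apply: eq_bigr => l _.
  rewrite exchange_big /=; apply: eq_bigr => j _.
  rewrite summxE scaler_suml; apply: eq_bigr => k _.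
  by rewrite [in RHS]mxE.
move=> k _; rewrite scaler_sumr; apply: eq_bigr => l _.
rewrite scaler_sumr scaler_sumr; apply: eq_bigr => j _.
by rewrite !scalerA; congr (_ *: _); rewrite /rowfun [S q 0 k * _]mulrC.
Qed.

Lemma tens_target_change : tens h2 F q = tens h1 f q *m dmx chi (f q).
Proof.
have pp := pull_target_change.
rewrite !tensE mulmx_suml; apply: eq_bigr => i _; rewrite mulmx_suml.
apply: eq_bigr => j _; rewrite -scalemxAl (nbhs_singleton pp).
apply: congr1; rewrite !nformE (gam_near _ _ pp) mulmxBl.
have E : \forall q \near q, dvec F j q = dvec f j q *m dmx chi (f q).
  have n1 := smooth_rV_near sf.
  have n2 : \forall q \near q, smooth_rV chi (f q).
    by apply: near_pull => //; exact: smooth_rV_near.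
  near=> q'; rewrite mul_dmx; apply: dvec_comp; by near: q'.
rewrite (nab_near _ _ _ E) (nab_target_change _ (smooth_dvec j sf)).
apply: congr1; apply: congr1; rewrite mulmx_suml; apply: eq_bigr => k _.
by rewrite -scalemxAl mul_dmx (dvec_comp k sf sc).
Unshelve. all: by end_near. Qed.

End TargetChange.

(** Both changes pass through the map chi o f1 = f2 o psi: its tension is that of [f2] by the source
    change, and the image of that of [f1] under the isometry d chi by the target change. *)
Lemma tens_norm_chart m n (h1 h2 : 'rV[R]_n -> 'M[R]_n)
    (psi : 'rV[R]_m -> 'rV[R]_m) (chi : 'rV[R]_n -> 'rV[R]_n)
    (f1 f2 : 'rV[R]_m -> 'rV[R]_n) (q : 'rV[R]_m) :
  smooth_rV psi q -> smooth_rV chi (f1 q) ->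
  local_immersion h1 f1 q -> local_immersion h2 f2 (psi q) ->
  (\forall q \near q, chi (f1 q) = f2 (psi q)) ->
  (\forall y \near f1 q, h1 y = dmx chi y *m h2 (chi y) *m (dmx chi y)^T) ->
  inner (h1 (f1 q)) (tens h1 f1 q) (tens h1 f1 q) =
  inner (h2 (f2 (psi q))) (tens h2 f2 (psi q)) (tens h2 f2 (psi q)).
Proof.
move=> sp sc i1 i2 E h12; have Eq := nbhs_singleton E.
have m2 : metric_at h2 (chi (f1 q)) by rewrite Eq; exact: immersion_metric i2.
have iF := target_change_immersion sc i1 m2 h12.
have iF2 : local_immersion h2 (fun q => f2 (psi q)) q.
  split.
  - by apply: smooth_rV_comp => //; exact: immersion_smooth i2.
  - exact: immersion_metric i2.
  - have n1 := immersion_free iF; have n2 := nbhs_interior E.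
    near=> q'.
    have -> : dmx (fun q => f2 (psi q)) q' = dmx (fun q => chi (f1 q)) q'.
      apply/row_matrixP => i; rewrite !row_dmxL; apply: dvec_near.
      have : nbhs q' [set q | chi (f1 q) = f2 (psi q)] by near: q'.
      by apply: filterS => q'' /esym.
    by near: q'.
rewrite -(tens_source_change sp iF2 i2).
rewrite -(tens_near h2 E) (tens_target_change sc i1 m2 h12) -Eq.
by rewrite {1}(nbhs_singleton h12) inner_congr.
Unshelve. all: by end_near. Qed.

End Covariance.

(** * The barrier argument at a maximum *)

Section Barrier.
Context {R : realType} {m n : nat}.
Variables (h : 'rV[R]_n -> 'M[R]_n) (u : 'rV[R]_m -> 'rV[R]_n).
Variable p : 'rV[R]_m.
Hypothesis up : local_immersion h u p.
Local Notation g := (pull h u).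
Local Notation lap f := (laplacian h u f p).
Let su := immersion_smooth up.
Let mh := immersion_metric up.
Let mg := pull_metric up.
Let ph : posdef (h (u p)). Proof. exact: nbhs_singleton mh.1. Qed.
Let pg : posdef (g p). Proof. exact: nbhs_singleton mg.1. Qed.

Definition grad2 (a b : 'rV[R]_m -> R) : R :=
  \sum_i \sum_j invmx (g p) i j * (pd i a p * pd j b p).

Lemma grad2_frame (a b : 'rV[R]_m -> R) (P : 'M[R]_m) :
  P *m g p *m P^T = 1%:M -> grad2 a b =
  \sum_c (\sum_i P c i * pd i a p) * (\sum_j P c j * pd j b p).
Proof.
move=> EP; rewrite /grad2 (invmx_trace _ EP); apply: eq_bigr => c _.
rewrite mulr_suml; apply: eq_bigr => i _; rewrite mulr_sumr.
by apply: eq_bigr => j _; ring.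
Qed.

Lemma grad2C (a b : 'rV[R]_m -> R) : grad2 a b = grad2 b a.
Proof.
have [P EP] := posdef_orthonormal pg; rewrite !(grad2_frame _ _ EP).
by apply: eq_bigr => c _; rewrite mulrC.
Qed.

Lemma grad2_eq (a a' b b' : 'rV[R]_m -> R) (s t : R) :
  (forall i, pd i a' p = s * pd i a p) -> (forall i, pd i b' p = t * pd i b p) ->
  grad2 a' b' = s * t * grad2 a b.
Proof.
move=> Ea Eb; rewrite /grad2 mulr_sumr; apply: eq_bigr => i _.
by rewrite mulr_sumr; apply: eq_bigr => j _; rewrite Ea Eb; ring.
Qed.

Lemma laplacianM (a b : 'rV[R]_m -> R) : smooth_at a p -> smooth_at b p ->
  lap (fun q => a q * b q) = a p * lap b + b p * lap a + 2 * grad2 a b.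
Proof.
move=> sa sb; rewrite mulrDl mul1r {2}grad2C /laplacian /grad2.
rewrite 2!mulr_sumr -!big_split /=; apply: eq_bigr => i _.
rewrite 2!mulr_sumr -!big_split /=; apply: eq_bigr => j _.
have E1 k : \forall q \near p, pd k (fun q => a q * b q) q =
    a q * pd k b q + b q * pd k a q.
  have na := smooth_at_nbhs sa; have nb := smooth_at_nbhs sb.
  by near=> q; apply: pdM; near: q.
rewrite (pd_near i (E1 j)).
have sja := smooth_pd j sa; have sjb := smooth_pd j sb.
rewrite (pdD i (smooth_atM sa sjb) (smooth_atM sb sja)) !pdM //.
have -> : \sum_k gam g p i j 0 k * pd k (fun q => a q * b q) p =
    a p * (\sum_k gam g p i j 0 k * pd k b p) +
    b p * (\sum_k gam g p i j 0 k * pd k a p).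
  rewrite 2!mulr_sumr -big_split /=; apply: eq_bigr => k _.
  by rewrite (nbhs_singleton (E1 k)) mulrDr mulrCA [gam _ _ _ _ _ _ * (b p * _)]mulrCA.
ring.
Unshelve. all: by end_near. Qed.

Lemma laplacian_at_max (f : 'rV[R]_m -> R) : smooth_at f p ->
  (\forall q \near p, f q <= f p) -> lap f <= 0.
Proof.
move=> sf maxf; have [P EP] := posdef_orthonormal pg.
have -> : lap f = \sum_i \sum_j invmx (g p) i j * pd i (pd j f) p.
  apply: eq_bigr => i _; apply: eq_bigr => j _; rewrite big1 ?subr0 // => k _.
  by rewrite (pd_at_max k sf maxf) mulr0.
rewrite (invmx_trace _ EP); apply: sumr_le0 => c _.
have := hessian_pd_at_max (row c P) sf maxf.
apply: le_trans; rewrite le_eqVlt; apply/orP; left; apply/eqP.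
apply: eq_bigr => i _; apply: eq_bigr => j _.
by rewrite [row c P 0 i]mxE [row c P 0 j]mxE.
Qed.

Section Composite.
Variable x : 'rV[R]_n -> R.
Hypothesis sx : smooth_at x (u p).

(** The covariant Hessian of [x] for the metric [h], at the image point. *)
Definition hess_mx : 'M[R]_n := \matrix_(b, a)
  (pd b (pd a x) (u p) - \sum_k gam h (u p) b a 0 k * pd k x (u p)).

Definition dlin : 'rV[R]_n -> R := lincomb (fun a => pd a x (u p)).

Lemma dlinD v w : dlin (v + w) = dlin v + dlin w.
Proof. exact: linearD. Qed.

Lemma dlinB v w : dlin (v - w) = dlin v - dlin w.
Proof. exact: linearB. Qed.

Lemma dlinZ c v : dlin (c *: v) = c * dlin v.
Proof. exact: linearZ. Qed.

Lemma dlin_sum (I : finType) (v : I -> 'rV[R]_n) :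
  dlin (\sum_i v i) = \sum_i dlin (v i).
Proof. exact: linear_sum. Qed.

Lemma pd_compL i : pd i (fun q => x (u q)) p = dlin (dvec u i p).
Proof.
rewrite (pd_comp i su sx); apply: eq_bigr => a _.
by rewrite -[dvec u i p 0 a]/(rowfun _ a p) rowfun_dvec mulrC.
Qed.

Lemma pd_pd_comp i j : pd i (pd j (fun q => x (u q))) p =
  \sum_b \sum_a dvec u i p 0 b * pd b (pd a x) (u p) * dvec u j p 0 a +
  dlin (dvec (dvec u j) i p).
Proof.
have E : \forall q \near p, pd j (fun q => x (u q)) q =
    \sum_a pd a x (u q) * rowfun (dvec u j) a q.
  have n1 := smooth_rV_near su; have n2 := near_pull su (smooth_at_nbhs sx).
  near=> q.
  have uq : smooth_rV u q by near: q.
  have xq : smooth_at x (u q) by near: q.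
  rewrite (pd_comp j uq xq); apply: eq_bigr => a _.
  by rewrite rowfun_dvec.
rewrite (pd_near i E) pd_sum => [|a]; last first.
  apply: smooth_atM; last exact: smooth_dvec.
  exact: smooth_at_comp su (smooth_pd a sx).
rewrite exchange_big /= -big_split /=; apply: eq_bigr => a _.
rewrite pdM; last 2 first.
- exact: smooth_at_comp su (smooth_pd a sx).
- exact: smooth_dvec.
rewrite [LHS]addrC (pd_comp i su (smooth_pd a sx)); congr (_ + _).
  rewrite mulr_sumr; apply: eq_bigr => b _.
  rewrite -[dvec u i p 0 b]/(rowfun _ b p) [rowfun (dvec u i) b]rowfun_dvec.
  by rewrite /rowfun; ring.
by rewrite -[dvec (dvec u j) i p 0 a]/(rowfun _ a p) [in RHS]rowfun_dvec mulrC.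
Unshelve. all: by end_near. Qed.

(** The second covariant derivative of x o u is Hess x (du, du) + dx(nabla du), and the trace of
    nabla du is the tension. In coordinates the Christoffel terms of h subtracted in [hess_mx] are
    those added in [nab]. *)
Lemma laplacian_comp : lap (fun q => x (u q)) =
  \sum_i \sum_j invmx (g p) i j * inner hess_mx (dvec u i p) (dvec u j p) +
  dlin (tens h u p).
Proof.
rewrite tensE dlin_sum -big_split /=; apply: eq_bigr => i _.
rewrite dlin_sum -big_split /=; apply: eq_bigr => j _.
rewrite dlinZ -mulrDr; congr (_ * _).
rewrite pd_pd_comp nformE nabE dlinB dlinD.
have -> : \sum_k gam g p i j 0 k * pd k (fun q => x (u q)) p =
    dlin (\sum_k gam g p i j 0 k *: dvec u k p).
  by rewrite dlin_sum; apply: eq_bigr => k _; rewrite pd_compL dlinZ.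
have -> : inner hess_mx (dvec u i p) (dvec u j p) =
  \sum_b \sum_a dvec u i p 0 b * pd b (pd a x) (u p) * dvec u j p 0 a -
  dlin (\sum_b \sum_c (dvec u i p 0 b * dvec u j p 0 c) *: gam h (u p) b c).
  rewrite innerE dlin_sum -sumrB; apply: eq_bigr => b _.
  rewrite dlin_sum -sumrB; apply: eq_bigr => a _.
  rewrite dlinZ [hess_mx b a]mxE /dlin /lincomb.
  move: (\sum_k _) => t; ring.
move: (dlin (dvec (dvec u j) i p)) (dlin (\sum_k _)) => t1 t2.
move: (dlin (\sum_b _)) (\sum_b _) => t3 t4; ring.
Qed.

End Composite.

Lemma frame_inner (P : 'M[R]_m) c : P *m g p *m P^T = 1%:M ->
  inner (h (u p)) (\sum_i P c i *: dvec u i p) (\sum_i P c i *: dvec u i p) = 1.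
Proof.
move=> EP; have <- : (P *m g p *m P^T) c c = 1 by rewrite EP mxE eqxx.
rewrite -inner_delta inner_congr inner_pullback mul_dmx -rowE.
have -> : \sum_k row c P 0 k *: dvec u k p = \sum_k P c k *: dvec u k p.
  by apply: eq_bigr => k _; rewrite mxE.
by [].
Qed.

(* With [y = F phi^2] and [dF = -F d(phi^2)/phi^2] at the maximum, the
   inequality [lap y <= 0] reads
   [phi^2 lap F <= F (6 |d phi|^2 - 2 phi lap phi)]. *)
Lemma barrier (x : 'rV[R]_n -> R) (F : 'rV[R]_m -> R) (C c e : R) :
  let phi q := 1 + e * ln (x (u q)) in
  smooth_at x (u p) -> 0 < x (u p) -> smooth_at F p ->
  0 <= C -> 0 < e -> e <= 1 -> 0 < phi p -> phi p <= 2 -> 0 < F p ->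
  F p = inner (h (u p)) (tens h u p) (tens h u p) ->
  (forall v, dlin x v ^+ 2 <= C * x (u p) ^+ 2 * inner (h (u p)) v v) ->
  (forall v, - (C * x (u p) * inner (h (u p)) v v) <= inner (hess_mx x) v v) ->
  c * F p ^+ 2 <= lap F ->
  (\forall q \near p, F q * phi q ^+ 2 <= F p * phi p ^+ 2) ->
  (c - e * C) * (F p * phi p ^+ 2) <= e * (14 * C * m%:R + 1).
Proof.
move=> phi sx x0 sF C0 e0 e1 phi0 phi2 F0 EF H1 H2 H3 maxp.
have [P EP] := posdef_orthonormal pg.
pose w q := x (u q).
have sw : smooth_at w p := smooth_at_comp su sx.
have w0 : 0 < w p := x0.
have sl : smooth_at (fun q => ln (w q)) p := smooth_at_ln w0 sw.
have sphi : smooth_at phi p.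
  by apply: smooth_atD; [exact: smooth_at_cst|exact: smooth_atZ].
pose phi' q := phi q * phi q.
have sphi2 : smooth_at phi' p := smooth_atM sphi sphi.
have sy : smooth_at (fun q => F q * phi' q) p := smooth_atM sF sphi2.
have maxy : \forall q \near p, F q * phi' q <= F p * phi' p.
  by apply: filterS maxp => q; rewrite !expr2.
have dF i : pd i F p = (- F p / phi' p) * pd i phi' p.
  have := pd_at_max i sy maxy; rewrite (pdM i sF sphi2) => E.
  have p0 : phi' p != 0 by rewrite mulf_neq0 // gt_eqF.
  apply: (mulfI p0).
  transitivity (- (F p * pd i phi' p)).
    by apply/eqP; rewrite -addr_eq0 addrC E.
  by field.
have dphi' i : pd i phi' p = 2 * phi p * pd i phi p.
  by rewrite (pdM i sphi sphi); ring.
have dphi_near i : \forall q \near p, pd i phi q = e * ((w q)^-1 * pd i w q).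
  have n1 := smooth_at_nbhs sw.
  have n2 : \forall q \near p, 0 < w q.
    exact: (cvgr_gt _ (smooth_at_continuous sw)).
  near=> q.
  have wq : smooth_at w q by near: q.
  have wq0 : 0 < w q by near: q.
  have slq := smooth_at_ln wq0 wq.
  rewrite /phi (pdD i (smooth_at_cst 1 q) (smooth_atZ e slq)) pd_cst add0r.
  by rewrite (pdZ i e slq) (pd_ln i wq wq0).
have dphi i : pd i phi p = e / w p * pd i w p.
  by rewrite (nbhs_singleton (dphi_near i)) mulrA.
pose N := grad2 w w.
have gphi : grad2 phi phi = e / w p * (e / w p) * N := grad2_eq dphi dphi.
have gphi' : grad2 phi' phi' = 2 * phi p * (2 * phi p) * grad2 phi phi :=
  grad2_eq dphi' dphi'.
have gF : grad2 F phi' = - F p / phi' p * 1 * grad2 phi' phi'.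
  by apply: grad2_eq => // i; rewrite mul1r.
have lphi : lap phi = e * (lap w / w p - N / w p ^+ 2).
  rewrite /laplacian /N /grad2 !mulr_suml -sumrB mulr_sumr.
  apply: eq_bigr => i _; rewrite !mulr_suml -sumrB mulr_sumr.
  apply: eq_bigr => j _; rewrite (pd_near i (dphi_near j)).
  have sjw := smooth_pd j sw; have siw := smooth_atV (lt0r_neq0 w0) sw.
  rewrite (pdZ i e (smooth_atM siw sjw)) (pdM i siw sjw).
  rewrite (pdV i sw (lt0r_neq0 w0)).
  have -> : \sum_k gam g p i j 0 k * pd k phi p =
      e / w p * \sum_k gam g p i j 0 k * pd k w p.
    by rewrite mulr_sumr; apply: eq_bigr => k _; rewrite dphi; ring.
  move: (\sum_k _) (pd i (pd j w) p) (pd i w p) (pd j w p) => t1 t2 t3 t4.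
  by field; exact: lt0r_neq0.
pose E c' := \sum_i P c' i *: dvec u i p.
have EE c' : inner (h (u p)) (E c') (E c') = 1 := frame_inner c' EP.
have dE c' : \sum_i P c' i * pd i w p = dlin x (E c').
  rewrite dlin_sum; apply: eq_bigr => i _.
  by rewrite dlinZ (pd_compL sx).
have N_le : N / w p ^+ 2 <= C * m%:R.
  rewrite ler_pdivrMr ?exprn_gt0 // /N (grad2_frame _ _ EP).
  have -> : C * m%:R * w p ^+ 2 = \sum_(c < m) C * w p ^+ 2.
    by rewrite sumr_const card_ord -[RHS]mulr_natr mulrAC.
  apply: ler_sum => c' _; rewrite dE -expr2.
  by apply: le_trans (H1 _) _; rewrite EE mulr1.
have lw : - (C * m%:R) + dlin x (tens h u p) / w p <= lap w / w p.
  rewrite (laplacian_comp sx) mulrDl lerD2r ler_pdivlMr //.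
  rewrite mulNr -[_ * m%:R * _]mulrAC.
  have -> : - (C * w p * m%:R) = \sum_(c < m) - (C * w p).
    by rewrite sumr_const card_ord -[RHS]mulr_natr mulNr.
  rewrite (invmx_trace _ EP); apply: ler_sum => c' _.
  have := H2 (E c'); rewrite EE mulr1 => H; apply: le_trans H _.
  rewrite le_eqVlt; apply/orP; left; apply/eqP; rewrite inner_suml.
  apply: eq_bigr => i _; rewrite inner_sumr; apply: eq_bigr => j _.
  by rewrite innerZl innerZr mulrA.
have t2 : (dlin x (tens h u p) / w p) ^+ 2 <= C * F p.
  rewrite expr_div_n ler_pdivrMr ?exprn_gt0 // EF mulrAC.
  exact: H1.
have := laplacian_at_max sy maxy.
rewrite (laplacianM sF sphi2) (laplacianM sphi sphi) gF gphi'.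
(* One of the two factors e is given up by e <= 1, so that all error terms have the same order in
   e. *)
have G_le : grad2 phi phi <= e * (C * m%:R).
  rewrite gphi (_ : _ * N = e * (e * (N / w p ^+ 2))); last first.
    by field; exact: lt0r_neq0.
  rewrite ler_pM2l //; apply: le_trans (_ : 1 * (C * m%:R) <= _); last first.
    by rewrite mul1r.
  apply: (le_trans (y := e * (C * m%:R))); first by rewrite ler_pM2l.
  by rewrite ler_wpM2r // mulr_ge0.
rewrite lphi; move: lw t2 G_le N_le H3.
rewrite -[phi' p]/(phi p * phi p) expr2.
move: (dlin x (tens h u p) / w p) (lap w / w p) (N / w p ^+ 2) (lap F).
move: (grad2 phi phi) => G t L s LF lw t2 GC nC cF.
have p0 : phi p != 0 by exact: lt0r_neq0.
rewrite (_ : - F p / _ * 1 * _ = - 4 * F p * G); last by field.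
move: F0 phi0 phi2 t2 cF {p0}; move: (F p) (phi p) => f z f0 z0 z2 t2 cF H.
clear -C0 e0 e1 lw GC nC f0 z0 z2 t2 cF H.
have Cm0 : 0 <= C * m%:R by rewrite mulr_ge0.
move: Cm0 lw GC nC; rewrite -[14 * C * _]mulrA; move: (C * m%:R) => K K0 lw GC nC.
(* The coefficient is 8 - 2: the cross term in lap (F phi^2) contributes -8 F |d phi|^2 and lap
   (phi^2) contributes 2 F |d phi|^2. The inequality is divided by f > 0. *)
have h1 : c * (f * (z * z)) <= 6 * G - 2 * z * (e * (L - s)).
  rewrite -(ler_pM2l f0); have : z * z * (c * f ^+ 2) <= z * z * LF.
    by rewrite ler_pM2l ?mulr_gt0.
  lra.
have h2 : - (2 * z * (e * (L - s))) <= e * (2 * z * (2 * K - t)).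
  have : 0 <= e * (2 * z) * ((L - s) - (t - 2 * K)).
    by rewrite mulr_ge0 ?mulr_ge0 ?(ltW e0) ?(ltW z0) // subr_ge0; lra.
  lra.
(* The bound z <= 2 gives 4 z K <= 8 K, and -2 z t <= 1 + z^2 t^2 with t^2 <= C f gives the rest.
   With the 6 K from |d phi|^2 this is the origin of 14. *)
have h3 : 2 * z * (2 * K - t) <= 8 * K + 1 + C * (f * (z * z)).
  have a1 : 0 <= (1 + z * t) ^+ 2 by exact: sqr_ge0.
  have a2 : 0 <= z * z * (C * f - t ^+ 2).
    by rewrite mulr_ge0 ?mulr_ge0 ?subr_ge0 // ltW.
  have a3 : 0 <= K * (2 - z) by rewrite mulr_ge0 // subr_ge0.
  lra.
have h4 : e * (2 * z * (2 * K - t)) <= e * (8 * K + 1 + C * (f * (z * z))).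
  by rewrite ler_pM2l.
lra.
Unshelve. all: by end_near. Qed.

End Barrier.

(** * A Landau inequality for products of first-order operators *)

Section Tower.
Context {R : realType}.
Variable rho : R.
Hypothesis rho0 : 0 < rho.
Implicit Types (G H : R -> R) (bs : seq R).

(** [H] arises from [G] by the operators d/ds - b for b in [bs], the head acting last. A relation is
    used because the derivatives are only prescribed on [-rho, rho]; the intermediate functions are
    existential. *)
Fixpoint tower bs G H : Prop :=
  if bs is b :: bs' then
    exists2 H', tower bs' G H' &
      forall s, `|s| <= rho -> is_derive s (1 : R) H' (H s + b * H' s)
  else H = G.

Lemma towerN bs G H : tower bs G H -> tower bs (fun s => - G s) (fun s => - H s).
Proof.
elim: bs H => [|b bs IH] H /=; first by move=> ->.
move=> [H' tH' dH']; exists (fun s => - H' s); first exact: IH.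
move=> s sI; have dH := dH' s sI.
have D := is_deriveN dH.
by rewrite mulrN -opprD.
Qed.

Section OneStep.
Variables (b : R) (H H' : R -> R).
Hypothesis dH' : forall s, `|s| <= rho -> is_derive s (1 : R) H' (H s + b * H' s).
(** Integrating factor: the derivative of [phi] is exp(-b s) H, without a term in H'. The constant
    [m] below bounds the factor and its inverse. *)
Let phi s := expR (- b * s) * H' s.
Let m := expR (`|b| * rho).

Let m0 : 0 < m. Proof. exact: expR_gt0. Qed.

Lemma expR_le_m s : `|s| <= rho -> expR (- b * s) <= m.
Proof.
move=> sI; rewrite ler_expR; apply: le_trans (ler_norm _) _.
by rewrite normrM normrN ler_wpM2l.
Qed.

Lemma expR_ge_m s : `|s| <= rho -> m^-1 <= expR (- b * s).
Proof.
move=> sI; rewrite -expRN ler_expR lerNl mulNr opprK.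
apply: le_trans (ler_norm _) _.
by rewrite normrM ler_wpM2l.
Qed.

Lemma derive_phi s : `|s| <= rho ->
  is_derive s (1 : R) phi (expR (- b * s) * H s).
Proof.
move=> sI; have dH := dH' sI.
have d1 : is_derive s (1 : R) (fun s : R => - b * s) (- b).
  have D := is_deriveZ (- b) (is_derive_id s (1 : R)).
  by apply: (is_derive_eq D); rewrite -[_ *: _]/(_ * _) mulr1.
have d2 : is_derive s (1 : R) (fun s : R => expR (- b * s)) (- b * expR (- b * s)).
  by rewrite mulrC; exact: is_derive1_comp (is_derive_expR _) d1.
have D := is_deriveM d2 dH.
apply: (is_derive_eq D).
by rewrite -![_ *: _]/(_ * _); ring.
Qed.

Lemma phi_increment s t : `|s| <= rho -> `|t| <= rho -> s <= t ->
  exists2 c, `|c| <= rho /\ s <= c <= t &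
    phi t - phi s = expR (- b * c) * H c * (t - s).
Proof.
move=> sI tI st.
have mid c : s <= c <= t -> `|c| <= rho.
  move=> /andP[sc ct]; move: sI tI; rewrite !ler_norml => /andP[h1 _] /andP[_ h2].
  by rewrite (le_trans h1 sc) (le_trans ct h2).
have [||c] := @MVT_segment R phi (fun c => expR (- b * c) * H c) s t st.
- move=> c; rewrite in_itv /= => /andP[sc ct]; apply: derive_phi; apply: mid.
  by rewrite !ltW.
- apply: continuous_in_subspaceT => c /set_mem; rewrite /= in_itv /= => sct.
  have [D _] := derive_phi (mid c sct).
  by apply: differentiable_continuous; apply/derivable1_diffP.
by rewrite in_itv /= => sct E; exists c => //; split=> //; exact: mid.
Qed.

Lemma H'_phi s : H' s = expR (b * s) * phi s.
Proof. by rewrite /phi mulrA -expRD mulNr subrr expR0 mul1r. Qed.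

Lemma expR_ge_m' s : `|s| <= rho -> m^-1 <= expR (b * s).
Proof.
move=> sI; rewrite -expRN ler_expR lerNl; apply: le_trans (ler_norm _) _.
by rewrite normrN normrM ler_wpM2l.
Qed.

(* On one of the outer quarters of the interval, [phi] is far from 0. *)
Lemma one_step_large (B l s0 : R) : 0 < l -> 0 <= B ->
  (forall s, s0 <= s <= s0 + l -> `|s| <= rho) ->
  (forall s, s0 <= s <= s0 + l -> B <= H s) ->
  let B' := m^-1 * (m^-1 * B * (l / 4)) in
  (forall s, s0 + 3 / 4 * l <= s <= s0 + l -> B' <= H' s) \/
  (forall s, s0 <= s <= s0 + l / 4 -> B' <= - H' s).
Proof.
move=> l0 B0 sub HB B'; have mi0 : 0 < m^-1 by rewrite invr_gt0.
pose mid := s0 + l / 2.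
have I s : s0 <= s <= s0 + l -> `|s| <= rho by exact: sub.
have midI : s0 <= mid <= s0 + l by rewrite /mid; apply/andP; split; lra.
have X0 : 0 <= m^-1 * B * (l / 4) by rewrite !mulr_ge0 ?(ltW mi0) //; lra.
have growth s t : s0 <= s -> t <= s0 + l -> s + l / 4 <= t ->
    m^-1 * B * (l / 4) <= phi t - phi s.
  move=> hs ht hst; have st : s <= t by lra.
  have sI : `|s| <= rho by apply: I; rewrite hs /=; lra.
  have tI : `|t| <= rho by apply: I; rewrite ht andbT; lra.
  have [c [cI /andP[sc ct]] ->] := phi_increment sI tI st.
  have cB : B <= H c by apply: HB; apply/andP; split; lra.
  rewrite !ler_pM ?mulr_ge0 ?(ltW mi0) //; try lra.
  exact: expR_ge_m.
have [p0|p0] := leP 0 (phi mid); [left|right] => s /andP[h1 h2].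
  have sI : `|s| <= rho by apply: I; rewrite h2 andbT; lra.
  have H1 : m^-1 * B * (l / 4) <= phi s.
    have G : m^-1 * B * (l / 4) <= phi s - phi mid.
      by apply: growth => //; rewrite /mid; lra.
    by apply: le_trans G _; rewrite lerBlDr lerDl.
  rewrite H'_phi /B'; apply: ler_pM => //; first exact: ltW.
  exact: expR_ge_m'.
have sI : `|s| <= rho by apply: I; rewrite h1 /=; lra.
have H1 : m^-1 * B * (l / 4) <= - phi s.
  have := growth s mid; rewrite /mid => /(_ h1) G.
  have {}G : m^-1 * B * (l / 4) <= phi mid - phi s by apply: G; lra.
  by apply: le_trans G _; rewrite lerBlDr addNr ltW.
rewrite H'_phi -mulrN /B'; apply: ler_pM => //; first exact: ltW.
exact: expR_ge_m'.
Qed.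

(** A bound on H limits the variation of [phi], so H' stays large near a point where it is large.
    The second alternative records that the bound obtained is vacuous. *)
Lemma one_step_lower (A s0 s : R) : 0 <= A ->
  (forall s, `|s| <= rho -> `|H s| <= A) -> `|s0| <= rho -> `|s| <= rho ->
  m^-1 * (m^-1 * H' s0 - m * A * `|s - s0|) <= H' s \/
  m^-1 * H' s0 - m * A * `|s - s0| <= 0.
Proof.
move=> A0 HA s0I sI.
set X := m^-1 * H' s0 - _.
have [X0|X0] := leP X 0; [by right|left].
have d a b' : `|a| <= rho -> `|b'| <= rho -> a <= b' ->
    `|phi b' - phi a| <= m * A * `|b' - a|.
  move=> aI bI ab; have [c [cI _] ->] := phi_increment aI bI ab.
  rewrite !normrM ler_wpM2r // ler_pM //; last exact: HA.
  by rewrite ger0_norm ?expR_ge0 //; exact: expR_le_m.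
have D : `|phi s - phi s0| <= m * A * `|s - s0|.
  have [h|/ltW h] := leP s0 s; first exact: d.
  by rewrite distrC [`|s - s0|]distrC; exact: d.
have Hs0 : 0 <= H' s0.
  rewrite leNgt; apply/negP => neg; move: X0; rewrite ltNge => /negP; apply.
  have h1 : m^-1 * H' s0 <= 0 by rewrite nmulr_lle0 // invr_ge0 ltW.
  have h2 : 0 <= m * A * `|s - s0| by rewrite !mulr_ge0 // ltW.
  rewrite /X; lra.
have p0 : m^-1 * H' s0 <= phi s0 by rewrite ler_wpM2r //; exact: expR_ge_m.
have : X <= phi s.
  move: D; rewrite ler_norml => /andP[h _]; rewrite /X; lra.
rewrite [H' s]H'_phi => h; apply: ler_pM => //.
- by rewrite invr_ge0 ltW.
- exact: ltW.
- exact: expR_ge_m'.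
Qed.

End OneStep.

(** Each operator is undone by [one_step_large], which passes to a quarter of the interval and may
    reverse the sign; the reversal is absorbed by [towerN] and by the absolute value in the
    conclusion. *)
Lemma tower_large bs (l : R) : 0 < l -> exists2 c, 0 < c &
  forall G H B s0, tower bs G H -> 0 <= B ->
    (forall s, s0 <= s <= s0 + l -> `|s| <= rho) ->
    (forall s, s0 <= s <= s0 + l -> B <= H s) ->
    exists2 s, `|s| <= rho & c * B <= `|G s|.
Proof.
elim: bs l => [|b bs IH] l l0 /=.
  exists 1 => // G H B s0 E B0 sub HB; have h : s0 <= s0 <= s0 + l.
    by rewrite lexx /= lerDl ltW.
  exists s0; first exact: sub.
  by rewrite mul1r -E; apply: le_trans (HB _ h) (ler_norm _).
have l4 : 0 < l / 4 by rewrite divr_gt0.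
have [c c0 cP] := IH _ l4.
pose m := expR (`|b| * rho); have m0 : 0 < m by exact: expR_gt0.
exists (c * (m^-1 * (m^-1 * (l / 4)))).
  by rewrite mulr_gt0 // mulr_gt0 ?invr_gt0 // mulr_gt0 ?invr_gt0.
move=> G H B s0 [H' tH' dH'] B0 sub HB.
have B'0 : 0 <= m^-1 * (m^-1 * B * (l / 4)).
  have mi : 0 <= m^-1 by rewrite invr_ge0 ltW.
  by rewrite mulr_ge0 // mulr_ge0 ?(ltW l4) // mulr_ge0.
have -> : c * (m^-1 * (m^-1 * (l / 4))) * B = c * (m^-1 * (m^-1 * B * (l / 4))).
  by ring.
have [h|h] := one_step_large dH' l0 B0 sub HB.
  apply: (cP G H' _ (s0 + 3 / 4 * l)) => //.
  - by move=> s /andP[h1 h2]; apply: sub; apply/andP; split; lra.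
  - by move=> s /andP[h1 h2]; apply: h; apply/andP; split; lra.
have [||s sI Gs] := cP _ _ _ s0 (towerN tH') B'0.
- by move=> s /andP[h1 h2]; apply: sub; apply/andP; split; lra.
- exact: h.
by exists s => //; rewrite normrN in Gs.
Qed.

(** If H' were very large at one point, the bound on H would keep it large on an interval of length
    rho/2, and [tower_large] would then make [G] exceed A somewhere. *)
Lemma tower_step b bs : exists2 C, 0 < C & forall G H H' A, 0 <= A ->
  tower bs G H' ->
  (forall s, `|s| <= rho -> is_derive s (1 : R) H' (H s + b * H' s)) ->
  (forall s, `|s| <= rho -> `|G s| <= A) ->
  (forall s, `|s| <= rho -> `|H s| <= A) ->
  forall s, `|s| <= rho -> `|H' s| <= C * A.
Proof.
pose m := expR (`|b| * rho); have m0 : 0 < m by exact: expR_gt0.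
have r2 : 0 < rho / 2 by rewrite divr_gt0.
have [c c0 cP] := tower_large bs r2.
(* The first summand makes the loss m A rho/2 at most half of the main term Y/m; the second makes
   the resulting lower bound c Y/(2 m^2) for [G] larger than A. *)
exists (m * m * rho + 2 * (m * m) / c).
  by rewrite addr_gt0 // !mulr_gt0 ?invr_gt0.
suff main G H H' A : 0 <= A -> tower bs G H' ->
    (forall s, `|s| <= rho -> is_derive s (1 : R) H' (H s + b * H' s)) ->
    (forall s, `|s| <= rho -> `|G s| <= A) ->
    (forall s, `|s| <= rho -> `|H s| <= A) ->
    forall s, `|s| <= rho -> H' s <= (m * m * rho + 2 * (m * m) / c) * A.
  move=> G H H' A A0 tH dH GA HA s sI; rewrite ler_norml; apply/andP; split.
    rewrite lerNl.
    apply: (main (fun s => - G s) (fun s => - H s) (fun s => - H' s)) => //.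
    - exact: towerN.
    - move=> t tI; have dHt := dH t tI.
      have D := is_deriveN dHt.
      by rewrite mulrN -opprD.
    - by move=> t /GA; rewrite normrN.
    - by move=> t /HA; rewrite normrN.
  exact: (main G H H' A).
move=> A0 tH dH GA HA s0 s0I.
rewrite leNgt; apply/negP => big.
have cA : 0 <= 2 * (m * m) / c * A by rewrite !mulr_ge0 ?invr_ge0 // ltW.
have mA : 0 <= m * m * rho * A by rewrite !mulr_ge0 // ltW.
pose Y := H' s0; rewrite -/Y mulrDl in big.
have Y0 : 0 < Y by lra.
(* The interval has s0 as an endpoint and points towards 0, so that it stays inside [-rho, rho]. *)
have [s1 s1P] : exists s1, forall s, s1 <= s <= s1 + rho / 2 ->
    `|s| <= rho /\ `|s - s0| <= rho / 2.
  move: s0I; rewrite ler_norml => /andP[a1 a2].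
  have [h|h] := leP s0 0; [exists s0|exists (s0 - rho / 2)];
    move=> s /andP[b1 b2]; rewrite !ler_norml; split; apply/andP; split; lra.
have low s : s1 <= s <= s1 + rho / 2 -> m^-1 * (m^-1 * (Y / 2)) <= H' s.
  move=> /s1P[sI ss0].
  have h1 : m^-1 * (Y / 2) <= m^-1 * Y - m * A * `|s - s0|.
    have : m * A * `|s - s0| <= m * A * (rho / 2).
      by rewrite ler_wpM2l // mulr_ge0 // ltW.
    have : m * A * (rho / 2) <= m^-1 * (Y / 2).
      by rewrite ler_pdivlMl //; lra.
    have : m^-1 * Y = 2 * (m^-1 * (Y / 2)) by field; exact: lt0r_neq0.
    lra.
  have h0 : 0 < m^-1 * (Y / 2) by rewrite mulr_gt0 ?invr_gt0 //; lra.
  have [h|h] := one_step_lower dH A0 HA s0I sI.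
    apply: le_trans h; rewrite ler_wpM2l ?invr_ge0 ?(ltW m0) //.
  by move: (lt_le_trans h0 (le_trans h1 h)); rewrite ltxx.
have B0 : 0 <= m^-1 * (m^-1 * (Y / 2)).
  by rewrite !mulr_ge0 ?invr_ge0 ?(ltW m0) //; lra.
have [s sI] := cP G H' _ s1 tH B0 (fun s h => proj1 (s1P s h)) low.
move=> h; have := le_trans h (GA s sI).
rewrite leNgt => /negP; apply.
have -> : c * (m^-1 * (m^-1 * (Y / 2))) = Y * (c / (2 * (m * m))).
  by field; exact: lt0r_neq0.
have -> : A = 2 * (m * m) / c * A * (c / (2 * (m * m))).
  by field; rewrite !lt0r_neq0.
rewrite ltr_pM2r ?divr_gt0 ?mulr_gt0 //; lra.
Qed.

(** [tower_step] strips the outermost operator while keeping a bound. When only the innermost one is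
    left, G' = H + b G is bounded directly; this is why the list is written with a last element. *)
Lemma landau bs b : exists2 C, 0 < C & forall G H dG A, 0 <= A ->
  tower (rcons bs b) G H ->
  (forall s, `|s| <= rho -> is_derive s (1 : R) G (dG s)) ->
  (forall s, `|s| <= rho -> `|G s| <= A) ->
  (forall s, `|s| <= rho -> `|H s| <= A) ->
  forall s, `|s| <= rho -> `|dG s| <= C * A.
Proof.
elim: bs => [|b' bs [C C0 IH]] /=.
  exists (1 + `|b|); first by rewrite ltr_wpDr.
  move=> G H dG A A0 [H' E dH'] dGP GA HA s sI.
  have [_ e1] := dGP s sI; have [_ e2] := dH' s sI.
  rewrite -e1 -E e2 mulrDl mul1r; apply: le_trans (ler_normD _ _) _.
  by rewrite lerD ?HA // normrM ler_wpM2l // E GA.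
have [C' C'0 step] := tower_step b' (rcons bs b).
exists (C * (1 + C')); first by rewrite mulr_gt0 // addr_gt0.
move=> G H dG A A0 [H' tH' dH'] dGP GA HA s sI.
rewrite -mulrA; apply: (IH G H' dG) => //.
- by rewrite mulr_ge0 // addr_ge0 // ltW.
- move=> t tI; apply: le_trans (GA t tI) _.
  by rewrite mulrDl mul1r lerDl mulr_ge0 // ltW.
- move=> t tI; apply: le_trans (step G H H' A A0 tH' dH' GA HA t tI) _.
  by rewrite mulrDl mul1r lerDr.
Qed.

End Tower.

(** * Derivatives of bounded polyhomogeneous functions *)

Section BoundaryCoordinate.
Context {R : realType} {n : nat}.

Lemma bcoordP : (exists2 i0 : 'I_n, forall q : 'rV[R]_n, bcoord q = q 0 i0 &
    forall i, (i0 == i) = (i == 0%N :> nat)) \/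
  (forall q : 'rV[R]_n, bcoord q = 1).
Proof.
rewrite /bcoord; case: insubP => [i0 _ e0|_]; [left|right] => //.
by exists i0 => // i; rewrite -val_eqE /= e0 eq_sym.
Qed.

Lemma smooth_bcoord (q : 'rV[R]_n) : smooth_at (@bcoord R n) q.
Proof.
case: bcoordP => [[i0 E _]|E].
  rewrite (_ : @bcoord R n = fun q => q 0 i0); last exact/funext.
  exact: smooth_at_coord.
rewrite (_ : @bcoord R n = fun=> 1); last exact/funext.
exact: smooth_at_cst.
Qed.

Lemma continuous_bcoord (q : 'rV[R]_n) : {for q, continuous (@bcoord R n)}.
Proof. exact: smooth_at_continuous (smooth_bcoord q). Qed.

Lemma near_bcoord_gt0 (q : 'rV[R]_n) :
  0 < bcoord q -> \forall y \near q, 0 < bcoord y.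
Proof. by move=> q0; exact: (cvgr_gt _ (@continuous_bcoord q)). Qed.

(** The derivative of the boundary coordinate along i. It lets the normal field x d_x and the fields
    x d_i along the boundary be treated by the same formulas. *)
Definition normal_index (i : 'I_n) : R := (i == 0%N :> nat)%:R.

Lemma pd_bcoord i (q : 'rV[R]_n) : pd i (@bcoord R n) q = normal_index i.
Proof.
case: bcoordP => [[i0 E Ei]|E].
  rewrite (_ : @bcoord R n = fun q => q 0 i0); last exact/funext.
  by rewrite pd_coord Ei.
have : i = 0%N :> nat -> False.
  move=> i0; move: (E 0); rewrite /bcoord; case: insubP => [j _ _|] /=.
    by rewrite mxE => /esym/eqP; rewrite oner_eq0.
  by rewrite -i0 ltn_ord.
rewrite (_ : @bcoord R n = fun=> 1); last exact/funext.
by rewrite pd_cst /normal_index; case: eqP.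
Qed.

End BoundaryCoordinate.

(** * The operators x d_i - b on germs at a boundary point *)

Section PositiveGerms.
Context {R : realType} {n : nat}.
Variables (p : 'rV[R]_n) (i : 'I_n).
Implicit Types (g f : 'rV[R]_n -> R) (b : R) (bs : seq R).
Local Notation x := (@bcoord R n).
Local Notation kappa := (normal_index i : R).

(** Germs at [p] on the open side x > 0, the only place where polyhomogeneous functions are
    controlled. *)
Definition ev (P : 'rV[R]_n -> Prop) := \forall q \near p, 0 < x q -> P q.
Local Notation sm g := (ev (fun q => smooth_at g q)).
Definition bd g := exists C : R, ev (fun q => `|g q| <= C).
Local Notation eqv f g := (ev (fun q => f q = g q)).
Definition bder g : 'rV[R]_n -> R := fun q => x q * pd i g q.
Definition step b g : 'rV[R]_n -> R := fun q => bder g q - b * g q.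
Definition steps bs g := foldr step g bs.
Definition tbd g := sm g /\ forall j, bd (iter j bder g).
(** Annihilation is understood modulo remainders in [tbd]. Only the existence of the list is
    recorded, since [landau] accepts any list. *)
Definition kill g := sm g /\ exists bs, tbd (steps bs g).

Lemma ev2 (P Q S : 'rV[R]_n -> Prop) : ev P -> ev Q ->
  (forall q, 0 < x q -> P q -> Q q -> S q) -> ev S.
Proof.
rewrite /ev => eP eQ H; apply: filterS2 eP eQ => q hP hQ q0.
by apply: H; [|exact: hP|exact: hQ].
Qed.

Lemma ev1 (P S : 'rV[R]_n -> Prop) : ev P ->
  (forall q, 0 < x q -> P q -> S q) -> ev S.
Proof. by rewrite /ev => eP H; apply: filterS eP => q hP q0; apply: H => //; exact: hP. Qed.

Lemma evT (P : 'rV[R]_n -> Prop) : (forall q, P q) -> ev P.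
Proof. by rewrite /ev => H; apply: filterE => q _; exact: H. Qed.

Lemma ev_all (I : eqType) (s : seq I) (P : I -> 'rV[R]_n -> Prop) :
  (forall e, e \in s -> ev (P e)) -> ev (fun q => forall e, e \in s -> P e q).
Proof.
elim: s => [|e s IH] H; first exact: evT.
have h1 := H e (mem_head _ _).
have h2 : ev (fun q => forall e, e \in s -> P e q).
  by apply: IH => e' h; apply: H; rewrite in_cons h orbT.
refine (ev2 h1 h2 _) => q _ a1 a2 e'.
by rewrite in_cons => /predU1P[->//|]; exact: a2.
Qed.

Lemma eqv_near f g : eqv f g -> ev (fun q => {near q, f =1 g}).
Proof.
rewrite /ev => /nbhs_interior; apply: filterS => q fg q0.
apply: filterS2 fg (near_bcoord_gt0 q0) => y; exact.
Qed.

Lemma eqv_sym f g : eqv f g -> eqv g f.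
Proof. by move=> fg; refine (ev1 fg _) => q _ ->. Qed.

Lemma eqv_trans f g k : eqv f g -> eqv g k -> eqv f k.
Proof. by move=> fg gk; refine (ev2 fg gk _) => q _ -> ->. Qed.

Lemma eqv_refl g : eqv g g. Proof. exact: evT. Qed.

Lemma sm_eqv f g : eqv f g -> sm f -> sm g.
Proof.
move=> fg sf; refine (ev2 (eqv_near fg) sf _) => q _ E; exact: smooth_at_eq.
Qed.

Lemma bd_eqv f g : eqv f g -> bd f -> bd g.
Proof. by move=> fg [C Cf]; exists C; refine (ev2 fg Cf _) => q _ ->. Qed.

Lemma bder_eqv f g : eqv f g -> eqv (bder f) (bder g).
Proof.
by move=> fg; refine (ev1 (eqv_near fg) _) => q _ E; rewrite /bder (pd_near i E).
Qed.

Lemma iter_bder_eqv j f g : eqv f g -> eqv (iter j bder f) (iter j bder g).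
Proof. by move=> fg; elim: j => //= j; exact: bder_eqv. Qed.

Lemma step_eqv b f g : eqv f g -> eqv (step b f) (step b g).
Proof.
by move=> fg; refine (ev2 (bder_eqv fg) fg _) => q _ E1 E2; rewrite /step E1 E2.
Qed.

Lemma steps_eqv bs f g : eqv f g -> eqv (steps bs f) (steps bs g).
Proof. by move=> fg; elim: bs => //= b bs; exact: step_eqv. Qed.

Lemma sm_bder g : sm g -> sm (bder g).
Proof.
by move=> sg; refine (ev1 sg _) => q _ s; apply: smooth_atM (smooth_bcoord q) (smooth_pd i s).
Qed.

Lemma sm_comb a b f g : sm f -> sm g -> sm (fun q => a * f q + b * g q).
Proof.
move=> sf sg; refine (ev2 sf sg _) => q _ s1 s2.
by apply: smooth_atD; exact: smooth_atZ.
Qed.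

Lemma bd_comb a b f g : bd f -> bd g -> bd (fun q => a * f q + b * g q).
Proof.
move=> [C Cf] [D Dg]; exists (`|a| * C + `|b| * D); refine (ev2 Cf Dg _) => q _ h1 h2.
apply: le_trans (ler_normD _ _) _; rewrite !normrM.
by rewrite lerD // ler_wpM2l.
Qed.

Lemma bder_comb a b f g : sm f -> sm g ->
  eqv (bder (fun q => a * f q + b * g q)) (fun q => a * bder f q + b * bder g q).
Proof.
move=> sf sg; refine (ev2 sf sg _) => q _ s1 s2; rewrite /bder.
rewrite (pdD i (smooth_atZ a s1) (smooth_atZ b s2)) (pdZ i a s1) (pdZ i b s2).
ring.
Qed.

Lemma sm_iter_bder j g : sm g -> sm (iter j bder g).
Proof. by move=> sg; elim: j => //= j; exact: sm_bder. Qed.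

Lemma iter_bder_comb j a b f g : sm f -> sm g ->
  eqv (iter j bder (fun q => a * f q + b * g q))
      (fun q => a * iter j bder f q + b * iter j bder g q).
Proof.
move=> sf sg; elim: j => [|j IH] /=; first exact: eqv_refl.
apply: eqv_trans (bder_eqv IH) _; apply: bder_comb; exact: sm_iter_bder.
Qed.

Lemma tbd_comb a b f g : tbd f -> tbd g -> tbd (fun q => a * f q + b * g q).
Proof.
move=> [sf bf] [sg bg]; split; first exact: sm_comb.
move=> j; apply: bd_eqv (eqv_sym (iter_bder_comb j a b sf sg)) _.
exact: bd_comb.
Qed.

Lemma tbd_eqv f g : eqv f g -> tbd f -> tbd g.
Proof.
move=> fg [sf bf]; split; first exact: sm_eqv sf.
by move=> j; apply: bd_eqv (iter_bder_eqv j fg) (bf j).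
Qed.

Lemma tbd_bder g : tbd g -> tbd (bder g).
Proof. by move=> [sg bg]; split; [exact: sm_bder|move=> j; rewrite -iterSr]. Qed.

Lemma stepE b g : step b g = fun q => 1 * bder g q + (- b) * g q.
Proof. by apply/funext => q; rewrite /step mul1r mulNr. Qed.

Lemma sm_step b g : sm g -> sm (step b g).
Proof. by move=> sg; rewrite stepE; apply: sm_comb => //; exact: sm_bder. Qed.

Lemma sm_steps bs g : sm g -> sm (steps bs g).
Proof. by move=> sg; elim: bs => //= b bs; exact: sm_step. Qed.

Lemma tbd_step b g : tbd g -> tbd (step b g).
Proof. by move=> tg; rewrite stepE; apply: tbd_comb => //; exact: tbd_bder. Qed.

Lemma tbd_steps bs g : tbd g -> tbd (steps bs g).
Proof. by move=> tg; elim: bs => //= b bs; exact: tbd_step. Qed.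

Lemma step_comb c a b f g : sm f -> sm g ->
  eqv (step c (fun q => a * f q + b * g q))
      (fun q => a * step c f q + b * step c g q).
Proof.
move=> sf sg; refine (ev1 (bder_comb a b sf sg) _) => q _ E.
by rewrite /step E; ring.
Qed.

Lemma steps_comb bs a b f g : sm f -> sm g ->
  eqv (steps bs (fun q => a * f q + b * g q))
      (fun q => a * steps bs f q + b * steps bs g q).
Proof.
move=> sf sg; elim: bs => [|c bs IH] /=; first exact: eqv_refl.
apply: eqv_trans (step_eqv c IH) _; apply: step_comb; exact: sm_steps.
Qed.

Lemma stepC b c g : sm g -> eqv (step b (step c g)) (step c (step b g)).
Proof.
move=> sg; have stg := sm_bder sg.
have E d : eqv (bder (step d g)) (fun q => 1 * bder (bder g) q + - d * bder g q).
  by rewrite stepE; exact: bder_comb.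
refine (ev2 (E c) (E b) _) => q _ e1 e2.
rewrite -[LHS]/(bder (step c g) q - b * (bder g q - c * g q)).
rewrite -[RHS]/(bder (step b g) q - c * (bder g q - b * g q)) e1 e2; ring.
Qed.

Lemma step_stepsC b bs g : sm g -> eqv (step b (steps bs g)) (steps bs (step b g)).
Proof.
move=> sg; elim: bs => [|c bs IH] /=; first exact: eqv_refl.
apply: eqv_trans (stepC b c (sm_steps bs sg)) _; exact: step_eqv.
Qed.

Lemma stepsC bs cs g : sm g ->
  eqv (steps bs (steps cs g)) (steps cs (steps bs g)).
Proof.
move=> sg; elim: bs => [|b bs IH] /=; first exact: eqv_refl.
apply: eqv_trans (step_eqv b IH) _; apply: step_stepsC; exact: sm_steps.
Qed.

(** The lists of both summands are concatenated: the operators commute, so each summand may meet its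
    own list first, and the other list preserves [tbd]. *)
Lemma kill_comb a b f g : kill f -> kill g -> kill (fun q => a * f q + b * g q).
Proof.
move=> [sf [bs kf]] [sg [cs kg]]; split; first exact: sm_comb.
exists (bs ++ cs); rewrite /steps foldr_cat -!/(steps _ _).
apply: tbd_eqv (eqv_sym (steps_eqv bs (steps_comb cs a b sf sg))) _.
apply: tbd_eqv (eqv_sym (steps_comb bs a b (sm_steps cs sf) (sm_steps cs sg))) _.
apply: tbd_comb; last exact: tbd_steps.
by apply: tbd_eqv (stepsC cs bs sf) _; exact: tbd_steps.
Qed.

Lemma kill_eqv f g : eqv f g -> kill f -> kill g.
Proof.
move=> fg [sf [bs kf]]; split; first exact: sm_eqv sf.
by exists bs; apply: tbd_eqv kf; exact: steps_eqv.
Qed.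

Lemma kill_step b g : sm g -> kill (step b g) -> kill g.
Proof.
move=> sg [_ [bs kb]]; split=> //; exists (rcons bs b).
by rewrite /steps foldr_rcons.
Qed.

Lemma kill_tbd g : tbd g -> kill g.
Proof. by move=> tg; split; [case: tg|exists [::]]. Qed.

Lemma kill_sum (I : eqType) (s : seq I) (F : I -> 'rV[R]_n -> R) :
  (forall e, e \in s -> kill (F e)) -> kill (fun q => \sum_(e <- s) F e q).
Proof.
elim: s => [|e s IH] H.
  apply: kill_tbd; have E : eqv (fun=> 0) (fun q => \sum_(e <- [::]) F e q).
    by apply: evT => q; rewrite big_nil.
  apply: tbd_eqv E _; split; first by apply: evT => q; exact: smooth_at_cst.
  have Z j : eqv (fun=> 0) (iter j bder (fun=> 0)).
    elim: j => [|j IHj] /=; first exact: eqv_refl.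
    apply: eqv_trans (bder_eqv IHj); apply: evT => q.
    by rewrite /bder pd_cst mulr0.
  by move=> j; apply: bd_eqv (Z j) _; exists 0; apply: evT => q; rewrite normr0.
apply: (@kill_eqv (fun q => 1 * F e q + 1 * \sum_(e <- s) F e q)).
  by apply: evT => q; rewrite big_cons !mul1r.
apply: kill_comb; first by apply: H; exact: mem_head.
by apply: IH => e' h; apply: H; rewrite in_cons h orbT.
Qed.

End PositiveGerms.

Section PolyhomogeneousTerms.
Context {R : realType} {n : nat}.

Lemma smooth_at_powR k (f : 'rV[R]_k -> R) q a : 0 < f q -> smooth_at f q ->
  smooth_at (fun y => f y `^ a) q.
Proof.
move=> f0 sf; have [A oA Aq sAf] := sf.
have : nbhs q (A `&` [set y | 0 < f y]).
  apply: filterI; first exact: open_nbhs_nbhs.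
  exact: (cvgr_gt (f q) (smooth_at_continuous sf)).
rewrite nbhsE => -[B [oB Bq] sB]; apply: (SmoothAt oB Bq) => j.
apply: (Ck_powR _ oB); first by move=> y /sB[].
by apply: Ck_sub (sAf j) => y /sB[].
Qed.

Lemma smooth_atX k (f : 'rV[R]_k -> R) q l : smooth_at f q ->
  smooth_at (fun y => f y ^+ l) q.
Proof.
move=> sf; elim: l => [|l IH]; first exact: smooth_at_cst.
rewrite (_ : (fun y => _) = fun y => f y * f y ^+ l); first exact: smooth_atM.
by apply/funext => y; rewrite exprS.
Qed.

Lemma pdX k (i : 'I_k) (f : 'rV[R]_k -> R) q l : smooth_at f q ->
  pd i (fun y => f y ^+ l) q = l%:R * f q ^+ l.-1 * pd i f q.
Proof.
move=> sf; elim: l => [|l IH]; first by rewrite pd_cst !mul0r.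
rewrite (_ : (fun y => _) = fun y => f y * f y ^+ l); last first.
  by apply/funext => y; rewrite exprS.
rewrite (pdM i sf (smooth_atX l sf)) IH /=.
case: l {IH} => [|l] /=; first by rewrite !expr0; ring.
rewrite [f q ^+ l.+1]exprS -[in RHS]natr1; ring.
Qed.

Lemma powR_ln_bounded (a : R) l : 0 < a ->
  exists C : R, forall t, 0 < t -> t <= 1 -> `|t `^ a * ln t ^+ l| <= C.
Proof.
move=> a0; case: l => [|l].
  exists 1 => t t0 t1; rewrite expr0 mulr1 ger0_norm ?powR_ge0 //.
  have H : t `^ a <= 1 `^ a by apply: ge0_ler_powR; rewrite ?nnegrE //; exact: ltW.
  by apply: le_trans H _; rewrite powR1.
(* From ln y < y at y = t^(-b) one gets |ln t| <= t^(-b)/b; with this b the power l+1 of t^(-b)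
   cancels t^a exactly. *)
pose b := a / l.+1%:R; have b0 : 0 < b by rewrite divr_gt0.
exists (b^-1 ^+ l.+1) => t t0 t1.
have ln0 : ln t <= 0 by exact: ln_le0.
have tb0 : 0 < t `^ (- b) by exact: powR_gt0.
have key : `|ln t| <= b^-1 * t `^ (- b).
  rewrite ler0_norm // -ler_pdivrMl ?invr_gt0 // invrK mulrN -mulNr -ln_powR.
  by apply/ltW/ln_sublinear.
rewrite normrM normrX (ger0_norm (powR_ge0 _ _)).
have h : `|ln t| ^+ l.+1 <= (b^-1 * t `^ (- b)) ^+ l.+1.
  by rewrite lerXn2r ?nnegrE // mulr_ge0 ?invr_ge0 ?(ltW b0) ?powR_ge0.
apply: le_trans (ler_wpM2l (powR_ge0 t a) h) _.
rewrite exprMn -(powR_mulrn _ (powR_ge0 _ _)) -powRrM.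
have -> : - b * l.+1%:R = - a by rewrite mulNr /b divfK.
by rewrite mulrCA -powRD ?subrr ?powRr0 ?mulr1 // (gt_eqF t0) implybT.
Qed.

End PolyhomogeneousTerms.

Section KillTerms.
Context {R : realType} {n : nat}.
Variables (p : 'rV[R]_n) (i : 'I_n).
Hypothesis p0 : bcoord p = 0.
Local Notation x := (@bcoord R n).
Local Notation kappa := (normal_index i : R).
Local Notation sm g := (ev p (fun q => smooth_at g q)).
Local Notation eqv f g := (ev p (fun q => f q = g q)).

Definition term (F : 'rV[R]_n -> R) (a : R) (l : nat) : 'rV[R]_n -> R :=
  fun q => F q * x q `^ a * ln (x q) ^+ l.

Lemma ev_smooth F : smooth_at F p -> sm F.
Proof. by move=> /smooth_at_nbhs; apply: filterS. Qed.

Lemma smooth_term F a l q : 0 < x q -> smooth_at F q -> smooth_at (term F a l) q.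
Proof.
move=> x0 sF; apply: smooth_atM.
  by apply: smooth_atM => //; apply: smooth_at_powR => //; exact: smooth_bcoord.
by apply: smooth_atX; apply: smooth_at_ln => //; exact: smooth_bcoord.
Qed.

Lemma sm_term F a l : smooth_at F p -> sm (term F a l).
Proof.
by move=> /ev_smooth sF; refine (ev1 sF _) => q q0 s; exact: smooth_term.
Qed.

(** Differentiating the coefficient gains a power of x; differentiating x^a keeps the term;
    differentiating the logarithm lowers its power. For l = 0 the last contribution has coefficient
    0, so the value of [l.-1] is harmless. *)
Lemma bder_term F a l : smooth_at F p -> eqv (bder i (term F a l))
  (fun q => 1 * term (pd i F) (a + 1) l q +
     1 * (kappa * a * term F a l q + kappa * l%:R * term F a l.-1 q)).
Proof.
move=> /ev_smooth sF; refine (ev1 sF _) => q q0 s; rewrite /bder /term.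
have sx := smooth_bcoord q.
have sp := smooth_at_powR a q0 sx.
have sl := smooth_at_ln q0 sx.
rewrite (pdM i (smooth_atM s sp) (smooth_atX l sl)) (pdM i s sp).
rewrite (pdX i l sl) (pd_ln i sx q0) (pd_powR i a sx q0) pd_bcoord.
have q0' : x q != 0 by exact: lt0r_neq0.
have -> : x q `^ (a - 1) = x q `^ a / x q.
  by rewrite powRB ?q0' ?implybT // powRr1 // ltW.
have -> : x q `^ (a + 1) = x q `^ a * x q.
  by rewrite powRD ?q0' ?implybT // powRr1 // ltW.
move: (x q `^ a) (ln (x q) ^+ l) (ln (x q) ^+ l.-1) => t1 t2 t3.
by field.
Qed.

Lemma bd_term F a l : 0 < a -> smooth_at F p -> bd p (term F a l).
Proof.
move=> a0 sF; have [C CP] := powR_ln_bounded l a0.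
exists ((`|F p| + 1) * C).
have h1 : \forall q \near p, `|F q| <= `|F p| + 1.
  have /cvgrPdist_le/(_ _ ltr01) := smooth_at_continuous sF.
  apply: filterS => q h; rewrite addrC -lerBlDr.
  by apply: le_trans (lerB_dist _ _) _; rewrite distrC.
have h2 : \forall q \near p, x q < 1.
  have p1 : x p < 1 by rewrite p0 ltr01.
  exact: (cvgr_lt (x p) (@continuous_bcoord _ _ p) _ p1).
apply: filterS2 h1 h2 => q h1 h2 q0; rewrite /term -mulrA normrM.
by apply: ler_pM => //; apply: CP => //; exact: ltW.
Qed.

(** By [bder_term] the span of terms with positive exponent is stable under x d_i, and each such
    term is bounded near the boundary. *)
Lemma tbd_term F a l : 0 < a -> smooth_at F p -> tbd p i (term F a l).
Proof.
move=> a0 sF; split; first exact: sm_term.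
move=> j; elim: j F a l a0 sF => [|j IH] F a l a0 sF; first exact: bd_term.
rewrite iterSr.
have E := iter_bder_eqv i j (bder_term a l sF).
apply: bd_eqv (eqv_sym E) _.
have s1 := sm_term (a + 1) l (smooth_pd i sF).
have s2 := sm_comb (kappa * a) (kappa * l%:R) (sm_term a l sF) (sm_term a l.-1 sF).
apply: bd_eqv (eqv_sym (iter_bder_comb i j 1 1 s1 s2)) _.
apply: bd_comb; first by apply: IH; [exact: addr_gt0|exact: smooth_pd].
apply: bd_eqv (eqv_sym (iter_bder_comb i j _ _ (sm_term a l sF) (sm_term a l.-1 sF))) _.
by apply: bd_comb; exact: IH.
Qed.

(* [T - kappa a] raises the exponent of [x] by one or lowers that of [log x]. *)
Lemma kill_term F a l : smooth_at F p -> kill p i (term F a l).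
Proof.
move: F a l; suff main (N : nat) F a l : 0 < a + N%:R -> smooth_at F p ->
    kill p i (term F a l).
  (* N counts how often the exponent may have to be raised before it is positive. *)
  move=> F a l; apply: (main (Num.bound `|a|)).
  have := archi_boundP (normr_ge0 a); have := ler_norm (- a); rewrite normrN.
  move: (_%:R) => t; lra.
elim: N F a l => [|N IHN] F a l.
  by rewrite addr0 => a0 sF; apply: kill_tbd; exact: tbd_term.
move=> aN sF; elim: l => [|l IHl].
- apply: (@kill_step _ _ _ _ (kappa * a)); first exact: sm_term.
  have k1 : kill p i (term (pd i F) (a + 1) 0).
    by apply: IHN; [rewrite -addrA [1 + _]addrC natr1|exact: smooth_pd].
  apply: kill_eqv (kill_comb 1 0 k1 k1).
  refine (ev1 (bder_term a 0 sF) _) => q q0 E; rewrite /step E; ring.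
apply: (@kill_step _ _ _ _ (kappa * a)); first exact: sm_term.
have k1 : kill p i (term (pd i F) (a + 1) l.+1).
  by apply: IHN; [rewrite -addrA [1 + _]addrC natr1|exact: smooth_pd].
apply: kill_eqv (kill_comb 1 (kappa * l.+1%:R) k1 IHl).
refine (ev1 (bder_term a l.+1 sF) _) => q q0 E; rewrite /step E /=; ring.
Qed.

End KillTerms.

Section LogDerivative.
Context {R : realType} {n : nat}.
Variables (p : 'rV[R]_n) (i : 'I_n).
Hypothesis p0 : bcoord p = 0.
Local Notation x := (@bcoord R n).
Local Notation kappa := (normal_index i : R).
Local Notation sm g := (ev p (fun q => smooth_at g q)).
Local Notation eqv f g := (ev p (fun q => f q = g q)).

Lemma bcoord_translate (q : 'rV[R]_n) t :
  x (q + t *: delta_mx 0 i) = x q + kappa * t.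
Proof.
case: (@bcoordP R n) => [[i0 E Ei]|E].
  by rewrite !E /normal_index -Ei !mxE eqxx mulrC.
by move: p0; rewrite E => /eqP; rewrite oner_eq0.
Qed.

Lemma bcoord_le_norm (q : 'rV[R]_n) : x q <= `|q - p|.
Proof.
case: (@bcoordP R n) => [[i0 E Ei]|E]; last first.
  by move: p0; rewrite E => /eqP; rewrite oner_eq0.
apply: le_trans (ler_norm _) _; apply: le_trans (coord_norm_le (q - p) i0).
by rewrite !mxE -!E p0 subr0.
Qed.

(** Any positive rho with exp(rho) <= 2 and rho <= 1 would serve in [flow]. *)
Let rho : R := ln 2 / 2.

Let rho0 : 0 < rho. Proof. by rewrite divr_gt0 // ln_gt0 // ltr1n. Qed.

(** The integral curve of x d_i through [q], with displacement x (exp s - 1) in the normal case and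
    x s otherwise. For |s| <= rho the displacement is at most x(q), so the curve stays in x > 0 and
    near [p]. *)
Lemma flow (q : 'rV[R]_n) : 0 < x q -> exists tau : R -> R,
  [/\ tau 0 = 0, (forall s, `|s| <= rho -> `|tau s| <= x q),
      (forall s, `|s| <= rho -> 0 < x q + kappa * tau s) &
      forall s, is_derive s (1 : R) tau (x q + kappa * tau s)].
Proof.
move=> q0.
have ln2 : ln 2 < 2 :> R by exact: ln_sublinear.
rewrite /normal_index; case: (i == 0%N :> nat) => /=.
- exists (fun s => x q * (expR s - 1)); split.
  + by rewrite expR0 subrr mulr0.
  + move=> s; rewrite ler_norml => /andP[_ h]; rewrite normrM gtr0_norm //.
    rewrite -[leRHS]mulr1 ler_pM2l // ler_norml; have := expR_ge0 s.
    have : expR s <= 2.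
      rewrite -[leRHS](lnK (x := 2)) ?posrE // ler_expR.
      by apply: le_trans h _; rewrite /rho; have := rho0; rewrite /rho; lra.
    move: (expR s) => t; lra.
  + by move=> s _; rewrite mul1r mulrBr mulr1 addrC subrK mulr_gt0 // expR_gt0.
  + move=> s; have d := is_derive_expR s.
    have d1 := is_deriveB d (is_derive_cst (1 : R) s (1 : R)).
    have d2 := is_deriveZ (x q) d1.
    apply: (is_derive_eq d2).
    by rewrite -[_ *: _]/(_ * _) subr0 mul1r mulrBr mulr1 addrC subrK.
- exists (fun s => x q * s); split.
  + by rewrite mulr0.
  + move=> s h; rewrite normrM gtr0_norm // -[leRHS]mulr1 ler_pM2l //.
    by apply: le_trans h _; rewrite /rho; lra.
  + by move=> s _; rewrite mul0r addr0.
  + move=> s; have d2 := is_deriveZ (x q) (is_derive_id s (1 : R)).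
    apply: (is_derive_eq d2).
    by rewrite -[_ *: _]/(_ * _) mulr1 mul0r addr0.
Qed.

Lemma smooth_at_derive_line (K : 'rV[R]_n -> R) q t :
  smooth_at K (q + t *: delta_mx 0 i) ->
  is_derive t (1 : R) (fun t => K (q + t *: delta_mx 0 i))
    (pd i K (q + t *: delta_mx 0 i)).
Proof.
move=> [A oA Aq sK].
have D0 : derivable K (q + t *: delta_mx 0 i) (delta_mx 0 i).
  exact: Ck_derivable (sK 1%N) Aq.
by have D := derive_line D0; rewrite pd.unlock partialE.
Qed.

Lemma smooth_at_steps bs (f : 'rV[R]_n -> R) q :
  smooth_at f q -> smooth_at (steps i bs f) q.
Proof.
move=> sf; elim: bs => //= b bs IH; apply: smooth_atB; last exact: smooth_atZ.
by apply: smooth_atM; [exact: smooth_bcoord|exact: smooth_pd].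
Qed.

(** Along the flow x d_i becomes d/ds and the list of operators becomes a [tower]. The constant of
    [landau] depends on rho and the list only, so evaluation at s = 0 gives a bound uniform in the
    starting point. *)
Lemma bd_bder_of_steps bs (f : 'rV[R]_n -> R) :
  sm f -> bd p f -> tbd p i (steps i bs f) -> bd p (bder i f).
Proof.
move=> sf [A1 fA] tb.
(* One more operator is applied so that the list is nonempty, as [landau] requires. *)
have [_ /(_ 0%N)[A2 HA]] := tbd_step 0 tb.
rewrite /= -[step i 0 _]/(steps i (0 :: bs) f) lastI in HA.
set cs := belast 0 bs in HA; set b := last 0 bs in HA.
have [C C0 landauC] := landau rho0 cs b.
pose A := Num.max A1 A2.
have : \forall q \near p, 0 < x q ->
    [/\ smooth_at f q, `|f q| <= A & `|steps i (rcons cs b) f q| <= A].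
  have fA' : ev p (fun q => `|f q| <= A).
    by refine (ev1 fA _) => q _ h; rewrite /A le_max h.
  have HA' : ev p (fun q => `|steps i (rcons cs b) f q| <= A).
    by refine (ev1 HA _) => q _ h; rewrite /A le_max h orbT.
  have fH : ev p (fun q => `|f q| <= A /\ `|steps i (rcons cs b) f q| <= A).
    by refine (ev2 fA' HA' _).
  by refine (ev2 sf fH _) => q _ h1 [h2 h3].
move=> /nbhs_ballP[r /= r0 rP].
exists (C * A).
(* Half the radius, since the flow moves q by at most x(q) <= |q - p|. *)
have : nbhs p (ball p (r / 2)) by apply: nbhsx_ballx; rewrite divr_gt0.
apply: filterS => q; rewrite mx_norm_ball /ball_ /= distrC => qr q0.
have [tau [t0 tle tpos dtau]] := flow q0.
pose gam s := q + tau s *: delta_mx 0 i.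
have gamP s : `|s| <= rho ->
    [/\ smooth_at f (gam s), `|f (gam s)| <= A & `|steps i (rcons cs b) f (gam s)| <= A].
  move=> sI; apply: rP; last by rewrite /gam bcoord_translate tpos.
  rewrite mx_norm_ball /ball_ /= distrC /gam addrAC.
  apply: le_lt_trans (ler_normD _ _) _; rewrite normrZ.
  have h1 : `|tau s| * `|delta_mx 0 i : 'rV[R]_n| <= `|q - p|.
    rewrite -[leRHS]mulr1 ler_pM ?norm_delta_le //.
    by apply: le_trans (tle s sI) (bcoord_le_norm q).
  have := lerD (lexx `|q - p|) h1; move: qr; lra.
have dgam (K : 'rV[R]_n -> R) s : smooth_at K (gam s) ->
    is_derive s (1 : R) (fun s => K (gam s)) (bder i K (gam s)).
  move=> sK; have D := is_derive1_comp (smooth_at_derive_line sK) (dtau s).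
  by rewrite /bder /gam bcoord_translate mulrC.
have A0 : 0 <= A.
  have [|_ h _] := gamP 0; first by rewrite normr0 ltW.
  exact: le_trans (normr_ge0 _) h.
have towers ds : tower rho ds (fun s => f (gam s)) (fun s => steps i ds f (gam s)).
  elim: ds => [//|d ds IH] /=; exists (fun s => steps i ds f (gam s)) => // s sI.
  have [sfg _ _] := gamP s sI.
  have D := dgam _ _ (smooth_at_steps ds sfg).
  by rewrite /step subrK.
have := landauC _ _ (fun s => bder i f (gam s)) A A0 (towers (rcons cs b)).
move=> /(_ _ _ _ 0); rewrite /gam t0 scale0r addr0; apply.
- by move=> s sI; have [sfg _ _] := gamP s sI; exact: dgam.
- by move=> s /gamP[].
- by move=> s /gamP[].
- by rewrite normr0 ltW.
Qed.

End LogDerivative.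

Section PolyhomogeneousDerivative.
Context {R : realType} {n : nat}.
Variables (i : 'I_n).
Local Notation x := (@bcoord R n).

Lemma open_bcoord_gt0 : open [set q : 'rV[R]_n | 0 < x q].
Proof. by rewrite openE => q; exact: near_bcoord_gt0. Qed.

Lemma open_phg_domain (A W : set 'rV[R]_n) : open A -> open W ->
  open [set q | [/\ W q, (A `&` halfspace n) q & 0 < x q]].
Proof.
move=> oA oW; rewrite (_ : mkset _ = W `&` A `&` [set q | 0 < x q]).
  by apply: openI; [exact: openI|exact: open_bcoord_gt0].
apply/seteqP; split=> q /=; first by move=> [Wq [Aq _] q0].
by move=> [[Wq Aq] q0]; split=> //; split=> //; exact: ltW.
Qed.

Definition bfield : 'rV[R]_n -> 'rV[R]_n := fun q => x q *: delta_mx 0 i.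

Lemma smooth_at_upto (U : set 'rV[R]_n) f :
  (forall q, U q -> smooth_at f q) -> smooth_upto U f.
Proof.
by move=> sf q Uq; have [A oA Aq sA] := sf q Uq; exists f, A; split.
Qed.

Lemma tangent_bfield : tangent_field bfield.
Proof.
split=> [j|q q0].
  apply: smooth_at_upto => q _.
  rewrite (_ : (fun q => _) = fun q => ((0 == 0 :> 'I_1) && (j == i))%:R * x q).
    by apply: smooth_atZ; exact: smooth_bcoord.
  by apply/funext => y; rewrite !mxE mulrC.
case: (@bcoordP R n) => [[i0 E _]|E]; last by move: q0; rewrite E => /eqP; rewrite oner_eq0.
by rewrite E !mxE -/(bcoord q) q0 mul0r.
Qed.

Lemma lie_bfield f : lie bfield f = bder i f.
Proof.
apply/funext => q; rewrite /lie partialL (bigD1 i) //= big1 ?addr0.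
  by rewrite !mxE !eqxx mulr1.
by move=> j ji; rewrite !mxE (negPf ji) andbF mulr0 mul0r.
Qed.

Lemma foldr_lie_bfield j f : foldr lie f (nseq j bfield) = iter j (bder i) f.
Proof. by elim: j => //= j ->; rewrite lie_bfield. Qed.

(** The truncated expansion is in [kill] term by term and the remainder is in [tbd]; hence f, which
    is bounded as a whole, satisfies the hypotheses of [bd_bder_of_steps]. *)
Lemma phg_log_derivative (A : set 'rV[R]_n) f p : open A -> A p -> x p = 0 ->
  phg_at (A `&` halfspace n) f p -> bd p (bder i f).
Proof.
move=> oA Ap p0 [E [W [c [iE [oW Wp] [sD [C0 fC0]] cU exps]]]].
set D := mkset _ in sD fC0 exps.
have oD : open D := open_phg_domain oA oW.
have evD : ev p (fun q => D q).
  have : nbhs p (W `&` A) by apply: filterI; exact: open_nbhs_nbhs.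
  by apply: filterS => q [Wq Aq] q0; split=> //; split=> //; exact: ltW.
have sf : ev p (fun q => smooth_at f q).
  by refine (ev1 evD _) => q _ Dq; exact: SmoothAt oD Dq sD.
have bf : bd p f by exists C0; refine (ev1 evD _) => q _; exact: fC0.
(* Truncation at order 0 already leaves a remainder whose iterated x d_i derivatives are bounded. *)
pose E0 := E `&` [set e : R * nat | e.1 <= 0].
have finE0 : finite_set E0 := iE.2 0.
(* The coefficients are smooth up to the boundary only; smooth extensions across it are germs at
   [p], to which [kill_term] applies. *)
have /choice[F FP] : forall e, exists F : 'rV[R]_n -> R, E e ->
    smooth_at F p /\ \forall q \near p, W q -> 0 < x q -> F q = c e q.
  move=> e; have [Ee|nE] := pselect (E e); last by exists (fun=> 0).
  have [|F [V [oV Vp sV VF]]] := cU e Ee p.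
    by split=> //; rewrite /halfspace /= p0.
  exists F => _; split; first exact: SmoothAt oV Vp sV.
  have := open_nbhs_nbhs (conj oV Vp); apply: filterS => q Vq Wq q0.
  by apply: VF => //; split=> //; exact: ltW.
pose s : seq (R * nat) := finmap.enum_fset (fset_set E0).
have sE e : e \in s -> E e.
  have -> : (e \in s) = (e \in E0) by exact: in_fset_set.
  by move=> /set_mem[].
pose S q := \sum_(e <- s) term (F e) e.1 e.2 q.
have kS : kill p i S.
  apply: kill_sum => e /sE Ee; apply: kill_term => //.
  exact: (FP e Ee).1.
pose S0 := phg_partial_sum E c 0.
have ES : ev p (fun q => S q = S0 q).
  have H : ev p (fun q => forall e, e \in s -> F e q = c e q).
    apply: ev_all => e /sE Ee; have [_ h] := FP e Ee.
    have := open_nbhs_nbhs (conj oW Wp).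
    by apply: filterS2 h => q h Wq q0; exact: h.
  refine (ev1 H _) => q _ h; rewrite /S0 /phg_partial_sum fsbig_finite //=.
  by rewrite /S !big_seq; apply: eq_bigr => e es; rewrite /term (h e es).
have tbd_rest : tbd p i (fun q => f q - S0 q).
  have sS0 : ev p (fun q => smooth_at S0 q) by apply: sm_eqv ES kS.1.
  split; first by refine (ev2 sf sS0 _) => q _; exact: smooth_atB.
  move=> j; have [|C CP] := exps 0 (nseq j bfield).
    by elim: j => //= j IH; constructor => //; exact: tangent_bfield.
  exists C; refine (ev1 evD _) => q _ Dq; have := CP q Dq.
  by rewrite foldr_lie_bfield powRr0 mulr1.
have kf : kill p i f.
  apply: kill_eqv (kill_comb 1 1 kS (kill_tbd tbd_rest)).
  by refine (ev1 ES _) => q _ ->; rewrite !mul1r addrC subrK.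
have [_ [bs tb]] := kf.
exact: (bd_bder_of_steps p0 sf bf tb).
Qed.

Lemma phg_interior_smooth (A : set 'rV[R]_n) f p : open A -> A p -> 0 < x p ->
  phg_at (A `&` halfspace n) f p -> smooth_at f p.
Proof.
move=> oA Ap p0 [E [W [c [_ [oW Wp] [sD _] _ _]]]].
apply: (SmoothAt (open_phg_domain oA oW) _ sD).
by split=> //; split=> //; exact: ltW.
Qed.

Lemma phg_bcoord_derivative (A : set 'rV[R]_n) f p : open A ->
  (A `&` halfspace n) p -> phg_at (A `&` halfspace n) f p ->
  exists C : R, ev p (fun q => `|x q * pd i f q| <= C).
Proof.
move=> oA [Ap]; rewrite /halfspace /= le_eqVlt => /predU1P[/esym p0|p0] phg.
  exact: phg_log_derivative phg.
have sf := phg_interior_smooth oA Ap p0 phg.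
have st := smooth_atM (smooth_bcoord p) (smooth_pd i sf).
exists (`|x p * pd i f p| + 1).
have /cvgrPdist_le/(_ _ ltr01) := smooth_at_continuous st.
apply: filterS => q h _; rewrite addrC -lerBlDr.
by apply: le_trans (lerB_dist _ _) _; rewrite distrC.
Qed.

End PolyhomogeneousDerivative.

(** * Asymptotic estimates for a conformally compact metric *)

Definition barrier_bounds (R : realType) n (h : 'rV[R]_n -> 'M[R]_n)
    (x : 'rV[R]_n -> R) (C : R) (y : 'rV[R]_n) : Prop :=
  (forall v, lincomb (fun a => pd a x y) v ^+ 2 <=
     C * x y ^+ 2 * inner (h y) v v) /\
  (forall v, - (C * x y * inner (h y) v v) <=
     inner (\matrix_(b, a) (pd b (pd a x) y -
       \sum_k gam h y b a 0 k * pd k x y)) v v).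

Lemma sum_ord_const (R : realType) n (c : R) : \sum_(i < n) c = n%:R * c.
Proof. by rewrite sumr_const card_ord mulr_natl. Qed.

Section PointwiseEstimate.
Context {R : realType} {n : nat}.
Variables (h hbar : 'rV[R]_n -> 'M[R]_n) (x : 'rV[R]_n -> R) (K : R)
  (y : 'rV[R]_n).
Hypotheses (mh : metric_at h y) (sx : smooth_at x y) (x0 : 0 < x y)
  (pb : posdef (hbar y))
  (hb : \forall z \near y, hbar z = x z ^+ 2 *: h z) (K1 : 1 <= K).
Hypotheses (Kx : x y <= K) (Kx1 : forall a, `|pd a x y| <= K)
  (Kx2 : forall a b, `|pd a (pd b x) y| <= K)
  (Kh : forall a b, `|hbar y a b| <= K)
  (Ki : forall a b, `|invmx (hbar y) a b| <= K)
  (Kd : forall c a b, x y * `|pd c (fun z => hbar z a b) y| <= K).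

Let K0 : 0 <= K. Proof. exact: le_trans K1. Qed.

Let hyE : hbar y = x y ^+ 2 *: h y. Proof. exact: nbhs_singleton hb. Qed.

(** Cauchy-Schwarz for [hbar] with the vector dual to coordinate c, of squared norm (hbar^-1)_cc <=
    K, gives v_c^2 <= K hbar(v, v). The product of two coordinates follows from the
    arithmetic-geometric mean inequality. *)
Lemma coord_product_le (v : 'rV[R]_n) a b :
  `|v 0 a| * `|v 0 b| <= K * (x y ^+ 2 * inner (h y) v v).
Proof.
have EN : x y ^+ 2 * inner (h y) v v = inner (hbar y) v v.
  by rewrite hyE /inner -scalemxAr -scalemxAl [RHS]mxE.
have sq c : v 0 c ^+ 2 <= K * inner (hbar y) v v.
  pose w : 'rV[R]_n := delta_mx 0 c *m invmx (hbar y).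
  have ub := posdef_unit pb.
  have wv : inner (hbar y) w v = v 0 c.
    by rewrite /inner /w mulmxKV // -rowE !mxE.
  have ww : inner (hbar y) w w = invmx (hbar y) c c.
    rewrite /inner /w mulmxKV // trmx_mul (invmx_sym pb.1) trmx_delta.
    by rewrite mulmxA -rowE -colE !mxE.
  have N0 := posdef_inner_ge0 v pb.
  have [v0|v0] := eqVneq v 0.
    by rewrite v0 mxE expr0n /= inner0l mulr0.
  have N1 : 0 < inner (hbar y) v v by exact: pb.2.
  have := posdef_inner_ge0 (w - (v 0 c / inner (hbar y) v v) *: v) pb.
  rewrite innerBl !innerBr !innerZl !innerZr (innerC v w pb.1) wv ww.
  set N := inner _ v v in N0 N1 *; set t := v 0 c.
  have -> : invmx (hbar y) c c - t / N * t - (t / N * t - t / N * (t / N * N)) =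
    invmx (hbar y) c c - t ^+ 2 / N by field; exact: lt0r_neq0.
  rewrite subr_ge0 ler_pdivrMr // => H; apply: le_trans H _.
  by rewrite ler_wpM2r //; apply: le_trans (ler_norm _) (Ki c c).
rewrite EN; have ha := sq a; have hb' := sq b.
have : 0 <= (`|v 0 a| - `|v 0 b|) ^+ 2 by exact: sqr_ge0.
rewrite sqrrB !real_normK ?num_real // => H.
have : `|v 0 a| * `|v 0 b| *+ 2 <= v 0 a ^+ 2 + v 0 b ^+ 2 by lra.
by rewrite -mulr_natl; lra.
Qed.

Lemma quadratic_le (Q : 'I_n -> 'I_n -> R) (M : R) (v : 'rV[R]_n) : 0 <= M ->
  (forall a b, `|Q a b| <= M) ->
  `|\sum_a \sum_b v 0 a * Q a b * v 0 b| <=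
  n%:R ^+ 2 * (M * (K * (x y ^+ 2 * inner (h y) v v))).
Proof.
move=> M0 QM; have -> : n%:R ^+ 2 * (M * (K * (x y ^+ 2 * inner (h y) v v))) =
    \sum_(a < n) \sum_(b < n) M * (K * (x y ^+ 2 * inner (h y) v v)).
  by move: (M * (K * _)) => S; rewrite !sum_ord_const mulrA expr2.
apply: le_trans (ler_norm_sum _ _ _) _; apply: ler_sum => a _.
apply: le_trans (ler_norm_sum _ _ _) _; apply: ler_sum => b _.
rewrite !normrM mulrAC mulrC.
by apply: ler_pM => //; exact: coord_product_le.
Qed.

Lemma gam_entry k (a b : 'I_n) : gam h y a b 0 k = 2^-1 * \sum_l invmx (h y) k l *
  (pd a (fun z => h z b l) y + pd b (fun z => h z a l) y - pd l (fun z => h z a b) y).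
Proof. by rewrite -christoffelL /christoffel partialL. Qed.

(** Differentiating hbar = x^2 h gives x^3 dh = x d hbar - 2 dx hbar, of size at most K + 2 K^2, and
    K <= K^2 because K >= 1. *)
Lemma pd_metric_le c a b : x y ^+ 3 * `|pd c (fun z => h z a b) y| <= 3 * K ^+ 2.
Proof.
have sxx := smooth_atM sx sx.
have sh := mh.2 a b.
have E : \forall z \near y, hbar z a b = (x z * x z) * h z a b.
  by apply: filterS hb => z ->; rewrite mxE expr2.
have := pd_near c E; rewrite (pdM c sxx sh) (pdM c sx sx) => Ed.
have -> : x y ^+ 3 * `|pd c (fun z => h z a b) y| =
    `|x y ^+ 3 * pd c (fun z => h z a b) y|.
  by rewrite normrM ger0_norm // exprn_ge0 // ltW.
have -> : x y ^+ 3 * pd c (fun z => h z a b) y =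
    x y * pd c (fun z => hbar z a b) y - 2 * (pd c x y * hbar y a b).
  have -> : hbar y a b = x y ^+ 2 * h y a b by rewrite hyE mxE.
  by rewrite Ed; ring.
apply: le_trans (ler_normB _ _) _.
rewrite !normrM (ger0_norm (ltW x0)) [`|2|]ger0_norm //.
have h1 := Kd c a b.
have h2 : `|pd c x y| * `|hbar y a b| <= K * K by exact: ler_pM.
have h3 : K <= K * K by rewrite ler_peMl.
rewrite expr2; lra.
Qed.

(** The inverse metric is x^2 hbar^-1, so the Christoffel symbols are O(1/x). Three derivatives of h
    and the factor 1/2 give 9/2, rounded up to 5. *)
Lemma gam_le k (a b : 'I_n) : x y * `|gam h y a b 0 k| <= 5 * n%:R * K ^+ 3.
Proof.
have x3 : 0 < x y ^+ 3 by exact: exprn_gt0.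
have hi l : `|invmx (h y) k l| <= x y ^+ 2 * K.
  have -> : invmx (h y) = x y ^+ 2 *: invmx (hbar y).
    have ub := posdef_unit pb.
    by rewrite hyE invmxZ -?hyE // scalerA divff ?scale1r // expf_neq0 // gt_eqF.
  rewrite mxE normrM ger0_norm ?sqr_ge0 // ler_wpM2l ?sqr_ge0 //; exact: Ki.
have t l : x y * `|invmx (h y) k l * (pd a (fun z => h z b l) y +
    pd b (fun z => h z a l) y - pd l (fun z => h z a b) y)| <= 9 * K ^+ 3.
  have h1 := pd_metric_le a b l; have h2 := pd_metric_le b a l.
  have h3 := pd_metric_le l a b.
  set A := pd a _ y in h1 *; set B := pd b _ y in h2 *; set D := pd l _ y in h3 *.
  have H : x y ^+ 3 * `|A + B - D| <= 9 * K ^+ 2.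
    apply: (@le_trans _ _ (x y ^+ 3 * (`|A| + `|B| + `|D|))).
      rewrite ler_pM2l //; apply: le_trans (ler_normB _ _) _.
      by rewrite lerD2r ler_normD.
    by rewrite !mulrDr; lra.
  rewrite normrM mulrA; apply: (@le_trans _ _ (K * (x y ^+ 3 * `|A + B - D|))).
    rewrite [leRHS]mulrA ler_wpM2r //.
    rewrite exprS mulrCA ler_pM2l // mulrC; exact: hi.
  have -> : 9 * K ^+ 3 = K * (9 * K ^+ 2) by ring.
  by rewrite ler_wpM2l.
rewrite gam_entry normrM [`|2^-1|]ger0_norm ?invr_ge0 //.
have H : x y * `|\sum_l invmx (h y) k l * (pd a (fun z => h z b l) y +
    pd b (fun z => h z a l) y - pd l (fun z => h z a b) y)| <= n%:R * (9 * K ^+ 3).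
  have -> : n%:R * (9 * K ^+ 3) = \sum_(l < n) 9 * K ^+ 3.
    by rewrite sum_ord_const.
  apply: le_trans (_ : _ <= x y * \sum_l `|_|) _.
    by rewrite ler_pM2l //; exact: ler_norm_sum.
  by rewrite mulr_sumr; apply: ler_sum => l _; exact: t.
have P0 : 0 <= n%:R * K ^+ 3 by rewrite mulr_ge0 // exprn_ge0.
by rewrite mulrCA; lra.
Qed.

Definition barrier_constant : R :=
  n%:R ^+ 2 * K ^+ 3 + n%:R ^+ 2 * (K ^+ 2 + 5 * n%:R ^+ 2 * K ^+ 4) * K.

(** The coordinate components of the Hessian are only O(1/x), but [quadratic_le] brings a factor
    x^2, which leaves x h(v, v). The constant is the sum of those of the two estimates. *)
Lemma barrier_bounds_at : barrier_bounds h x barrier_constant y.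
Proof.
pose M := K ^+ 2 + 5 * n%:R ^+ 2 * K ^+ 4.
have M0 : 0 <= M by rewrite addr_ge0 ?mulr_ge0 ?exprn_ge0.
have A0 : 0 <= n%:R ^+ 2 * K ^+ 3 by rewrite mulr_ge0 ?exprn_ge0.
have B0 : 0 <= n%:R ^+ 2 * M * K by rewrite !mulr_ge0 ?exprn_ge0.
have hp := nbhs_singleton mh.1.
split=> v; have N0 := posdef_inner_ge0 v hp.
  have -> : lincomb (fun a => pd a x y) v ^+ 2 =
      \sum_a \sum_b v 0 a * (pd a x y * pd b x y) * v 0 b.
    rewrite expr2 /lincomb mulr_suml; apply: eq_bigr => a _.
    by rewrite mulr_sumr; apply: eq_bigr => b _; ring.
  apply: le_trans (ler_norm _) _.
  apply: le_trans (@quadratic_le _ (K * K) v _ _) _; first exact: mulr_ge0.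
    by move=> a b; rewrite normrM; exact: ler_pM.
  have -> : n%:R ^+ 2 * (K * K * (K * (x y ^+ 2 * inner (h y) v v))) =
    n%:R ^+ 2 * K ^+ 3 * (x y ^+ 2 * inner (h y) v v) by ring.
  rewrite -[leRHS]mulrA ler_wpM2r ?(mulr_ge0 (sqr_ge0 _) N0) //.
  by rewrite /barrier_constant -/M lerDl.
set Q := \matrix_(b, a) _.
have QM b a : `|Q b a| <= M / x y.
  rewrite ler_pdivlMr // mulrC mxE.
  apply: le_trans (_ : _ <= x y * (`|pd b (pd a x) y| +
    \sum_k `|gam h y b a 0 k| * `|pd k x y|)) _.
    rewrite ler_pM2l //; apply: le_trans (ler_normB _ _) _; rewrite lerD2l.
    apply: le_trans (ler_norm_sum _ _ _) _.
    by apply: ler_sum => k _; rewrite normrM.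
  rewrite mulrDr; apply: lerD; first by rewrite expr2; apply: ler_pM => //; exact: ltW.
  have -> : 5 * n%:R ^+ 2 * K ^+ 4 = \sum_(k < n) 5 * n%:R * K ^+ 3 * K.
    by rewrite sum_ord_const; ring.
  rewrite mulr_sumr; apply: ler_sum => k _; rewrite mulrA.
  by apply: ler_pM => //; [rewrite mulr_ge0 // ltW|exact: gam_le].
rewrite lerNl; apply: le_trans (ler_norm _) _; rewrite normrN innerE.
apply: le_trans (@quadratic_le Q (M / x y) v _ QM) _.
  by rewrite divr_ge0 // ltW.
have -> : n%:R ^+ 2 * (M / x y * (K * (x y ^+ 2 * inner (h y) v v))) =
    n%:R ^+ 2 * M * K * (x y * inner (h y) v v).
  by field; rewrite gt_eqF.
rewrite -[leRHS]mulrA ler_wpM2r ?(mulr_ge0 (ltW x0) N0) //.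
by rewrite /barrier_constant -/M lerDr.
Qed.

End PointwiseEstimate.

Lemma barrier_constant_ge0 (R : realType) n (K : R) :
  0 <= K -> 0 <= @barrier_constant R n K.
Proof.
move=> K0; have P j : 0 <= K ^+ j := exprn_ge0 j K0.
have Q j : 0 <= n%:R ^+ j :> R := exprn_ge0 j (ler0n R n).
apply: addr_ge0; first exact: mulr_ge0.
by do 2![apply: mulr_ge0 => //]; apply: addr_ge0 => //; do 2![apply: mulr_ge0 => //].
Qed.

Section EventualEstimate.
Context {R : realType} {n : nat}.
Variables (A : set 'rV[R]_n) (h hbar : 'rV[R]_n -> 'M[R]_n) (x : 'rV[R]_n -> R)
  (p : 'rV[R]_n).
Local Notation U := (A `&` halfspace n).
Hypotheses (oA : open A) (Up : U p).

Lemma ev_and (P Q : 'rV[R]_n -> Prop) :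
  ev p P -> ev p Q -> ev p (fun q => P q /\ Q q).
Proof. by move=> eP eQ; refine (ev2 eP eQ _). Qed.

Lemma ev_dom : ev p U.
Proof.
have := open_nbhs_nbhs (conj oA Up.1).
by apply: filterS => q Aq q0; split=> //; exact: ltW.
Qed.

Lemma bd_smooth f : smooth_at f p -> bd p f.
Proof.
move=> sf; exists (`|f p| + 1).
have /cvgrPdist_le/(_ _ ltr01) := smooth_at_continuous sf.
apply: filterS => q hq _; rewrite addrC -lerBlDr.
by apply: le_trans (lerB_dist _ _) _; rewrite distrC.
Qed.

Lemma bd_within (f : 'rV[R]_n -> R) :
  {for (p : subspace U), continuous (f : subspace U -> R)} -> bd p f.
Proof.
move=> cf; exists (`|f p| + 1).
have : nbhs (p : subspace U) [set q | `|f p - f q| <= 1].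
  by have /cvgrPdist_le/(_ _ ltr01) := cf.
case: (nbhs_subspaceP U p) => // _ H.
refine (ev2 ev_dom (_ : ev p (fun q => U q -> `|f p - f q| <= 1)) _).
  by rewrite /ev; move: H; rewrite /within /=; apply: filterS => q hq _.
move=> q _ Uq /(_ Uq) hq; rewrite addrC -lerBlDr.
by apply: le_trans (lerB_dist _ _) _; rewrite distrC.
Qed.

Lemma bd_finite (I : finType) (f : I -> 'rV[R]_n -> R) :
  (forall i, bd p (f i)) ->
  exists2 K : R, 1 <= K & ev p (fun q => forall i, `|f i q| <= K).
Proof.
move=> /choice[C CP]; exists (1 + \sum_i `|C i|).
  by rewrite lerDl sumr_ge0.
have H e : e \in enum I -> ev p (fun q => `|f e q| <= C e) by move=> _; exact: CP.
refine (ev1 (ev_all H) _) => q _ Hq i.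
apply: le_trans (Hq i (mem_enum _ _)) _; apply: le_trans (ler_norm _) _.
rewrite (bigD1 i) //= addrCA lerDl addr_ge0 // sumr_ge0 //.
Qed.

(** [hbar] is merely continuous on the half-space, so inversion is treated as a smooth germ [J] on
    the space of matrices, written as row vectors, and composed with [hbar]. *)
Lemma bd_invmx a b : posdef (hbar p) ->
  (forall a b, {within U, continuous (fun q => hbar q a b)}) ->
  bd p (fun q => invmx (hbar q) a b).
Proof.
move=> ph ch; apply: bd_within.
pose G (v : 'rV[R]_(n * n)) : 'M[R]_n := vec_mx v.
have sG v : smooth_mx G v.
  move=> a' b'; rewrite (_ : (fun q => _) = fun v : 'rV[R]_(n * n) => v 0 (mxvec_index a' b')).
    exact: smooth_at_coord.
  by apply/funext => w; rewrite /G mxE.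
have [J sJ EJ] : exists2 J : 'rV[R]_(n * n) -> R, smooth_at J (mxvec (hbar p)) &
    (fun q => invmx (hbar q) a b) = fun q => J (mxvec (hbar q)).
  exists (fun v => invmx (G v) a b); last by apply/funext => q; rewrite /G mxvecK.
  have uG : G (mxvec (hbar p)) \in unitmx by rewrite /G mxvecK; exact: posdef_unit.
  exact: (smooth_invmx (sG _) uG).
have comp (L : 'rV[R]_(n * n) -> R) (H : 'rV[R]_n -> 'rV[R]_(n * n)) :
    {for H p, continuous L} ->
    {for (p : subspace U), continuous (H : subspace U -> 'rV[R]_(n * n))} ->
    {for (p : subspace U), continuous ((fun q => L (H q)) : subspace U -> R)}.
  by move=> cL cH; exact: (@continuous_comp (subspace U) _ _ H L p cH cL).
have cH : {for (p : subspace U),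
    continuous ((fun q => mxvec (hbar q)) : subspace U -> 'rV[R]_(n * n))}.
  apply: (@continuous_rV _ (subspace U)) => k.
  case/mxvec_indexP: k => i j.
  rewrite (_ : (fun q => _) = fun q => hbar q i j); first exact: ch.
  by apply/funext => q; rewrite mxvecE.
by rewrite EJ; exact: (comp J _ (smooth_at_continuous sJ) cH).
Qed.

Hypotheses (sx : smooth_upto U x) (xge : forall q, U q -> 0 <= x q)
  (x0 : forall q, U q -> bcoord q = 0 -> x q = 0).

(** Equality on a full neighbourhood of each interior q is what transfers derivatives from F to x; U
    is a neighbourhood of its points with positive boundary coordinate. *)
Lemma smooth_extension : exists F, [/\ smooth_at F p,
  \forall q \near p, U q -> F q = x q & ev p (fun q => {near q, F =1 x})].
Proof.
have [F [W [oW Wp sF WF]]] := sx Up.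
have H : \forall q \near p, U q -> F q = x q.
  have := open_nbhs_nbhs (conj oW Wp); apply: filterS => q Wq Uq; exact: WF.
exists F; split=> //; first exact: SmoothAt oW Wp sF.
apply: eqv_near; refine (ev2 ev_dom (_ : ev p (fun q => U q -> F q = x q)) _) => //.
  by rewrite /ev; apply: filterS H => q Hq _.
by move=> q _ Uq; exact.
Qed.

(** Polyhomogeneity controls derivatives weighted by the boundary coordinate, whereas the estimates
    need the weight x. At a boundary point the mean value theorem along the normal axis compares the
    two, since x vanishes on the boundary. *)
Lemma bdf_le_bcoord : exists2 K : R, 0 <= K & ev p (fun q => x q <= K * bcoord q).
Proof.
have [F [sF EF Enear]] := smooth_extension.
have [p0|p0] := ltP 0 (bcoord p).
  have [C HC] := bd_smooth sF; exists (2 * `|C| / bcoord p).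
    by rewrite divr_ge0 ?mulr_ge0 // ltW.
  have hb : ev p (fun q => bcoord p / 2 <= bcoord q).
    have : \forall q \near p, bcoord p / 2 < bcoord q.
      apply: (cvgr_gt _ (@continuous_bcoord _ _ p)).
      by rewrite gtr_pMr // invf_lt1 // ltr1n.
    by apply: filterS => q /ltW.
  refine (ev2 (ev_and Enear HC) hb _) => q q0 [/nbhs_singleton E HF] hq.
  rewrite -E; apply: le_trans (ler_norm _) _; apply: le_trans HF _.
  apply: le_trans (ler_norm _) _.
  rewrite [leLHS](_ : _ = 2 * `|C| / bcoord p * (bcoord p / 2)); last first.
    by field; rewrite gt_eqF.
  by rewrite ler_wpM2l // divr_ge0 ?mulr_ge0 // ltW.
have {}p0 : bcoord p = 0 by apply/eqP; rewrite eq_le p0 Up.2.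
have [[i0 bE iE]|bE] := @bcoordP R n; last first.
  by move: p0; rewrite bE => /eqP; rewrite oner_eq0.
have sd := smooth_pd i0 sF.
pose C := `|pd i0 F p| + 1.
have HC : \forall q \near p, `|pd i0 F q| <= C.
  have /cvgrPdist_le/(_ _ ltr01) := smooth_at_continuous sd.
  apply: filterS => q hq; rewrite /C addrC -lerBlDr.
  by apply: le_trans (lerB_dist _ _) _; rewrite distrC.
have HD : \forall q \near p, derivable F q (delta_mx 0 i0).
  by apply: filterS (smooth_at_nbhs sF) => q [B oB Bq sB]; exact: Ck_derivable (sB 1%N) Bq.
have HA := open_nbhs_nbhs (conj oA Up.1).
have /nbhs_ballP[r /= r0 Hr] : \forall q \near p, [/\ `|pd i0 F q| <= C,
    derivable F q (delta_mx 0 i0), A q & U q -> F q = x q].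
  by near=> q; split; near: q.
exists C; first by rewrite addr_ge0.
have nr : \forall q \near p, `|q - p| < r / 2.
  apply: filterS (nbhsx_ballx p (r / 2) _) => [q|]; last by rewrite divr_gt0.
  by rewrite mx_norm_ball /ball_ /= distrC.
apply: filterS nr => q qr q0; have bq := bcoord_le_norm p0 q.
have inb s : `|s| <= bcoord q -> ball p r (q + s *: delta_mx 0 i0).
  move=> sb; rewrite mx_norm_ball /ball_ /= distrC addrAC.
  apply: le_lt_trans (ler_normD _ _) _; rewrite normrZ.
  have h1 : `|s| * `|delta_mx 0 i0 : 'rV[R]_n| <= `|s| by rewrite ler_piMr // norm_delta_le.
  lra.
have [|s sb E] := @line_mean_value R _ F q (delta_mx 0 i0) (- bcoord q).
  by rewrite normrN gtr0_norm // => s /inb/Hr[].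
have {}sb : `|s| <= bcoord q by move: sb; rewrite normrN (gtr0_norm q0).
have [hC _ _ _] := Hr _ (inb s sb).
(* The foot of q on the boundary hyperplane. *)
pose z := q + (- bcoord q) *: delta_mx 0 i0 : 'rV[R]_n.
have nb : `|- bcoord q| <= bcoord q by rewrite normrN (gtr0_norm q0).
have [_ _ Az Ez] := Hr z (inb _ nb).
have bz : bcoord z = 0.
  by rewrite (bcoord_translate i0 p0) /normal_index -iE eqxx mul1r subrr.
have Uz : U z by split=> //; rewrite /halfspace /= bz.
have ballq : ball p r q.
  by have := inb 0; rewrite scale0r addr0 normr0; apply; exact: ltW.
have [_ _ Aq Eq] := Hr q ballq.
have Uq : U q by split=> //; exact: ltW.
move: E; rewrite -/z (Ez Uz) (x0 Uz bz) (Eq Uq) sub0r mulNr => /oppr_inj ->.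
rewrite mulrC ler_wpM2r ?(ltW q0) //; apply: le_trans (ler_norm _) _.
by move: hC; rewrite -partialL.
Unshelve. all: by end_near. Qed.

Lemma barrier_bounds_near :
  (forall q, U q -> 0 < bcoord q -> 0 < x q) ->
  (forall q, U q -> 0 < bcoord q -> metric_at h q) ->
  (forall q, U q -> posdef (hbar q)) ->
  (forall a b, {within U, continuous (fun q => hbar q a b)}) ->
  (forall q, U q -> 0 < bcoord q -> hbar q = x q ^+ 2 *: h q) ->
  (forall a b, phg_at U (fun q => hbar q a b) p) ->
  exists2 C : R, 0 <= C & ev p (fun q => barrier_bounds h x C q).
Proof.
move=> xpos mh ph ch hE phg.
have [F [sF _ EF]] := smooth_extension.
have [K0 K00 H0] := bdf_le_bcoord.
have [K1 K11 H1] : exists2 K : R, 1 <= K & ev p (fun q => forall i : 'I_1, `|F q| <= K).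
  by apply: (bd_finite (f := fun _ => F)) => _; exact: bd_smooth.
have [K2 K21 H2] : exists2 K : R, 1 <= K &
    ev p (fun q => forall a, `|pd a F q| <= K).
  by apply: (bd_finite (f := fun a => pd a F)) => a; exact: bd_smooth (smooth_pd a sF).
have [K3 K31 H3] : exists2 K : R, 1 <= K &
    ev p (fun q => forall c : 'I_n * 'I_n, `|pd c.1 (pd c.2 F) q| <= K).
  apply: (bd_finite (f := fun c => pd c.1 (pd c.2 F))) => c.
  exact: bd_smooth (smooth_pd c.1 (smooth_pd c.2 sF)).
have [K4 K41 H4] : exists2 K : R, 1 <= K &
    ev p (fun q => forall c : 'I_n * 'I_n, `|hbar q c.1 c.2| <= K).
  apply: (bd_finite (f := fun c q => hbar q c.1 c.2)) => c.
  by apply: bd_within; exact: ch.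
have [K5 K51 H5] : exists2 K : R, 1 <= K &
    ev p (fun q => forall c : 'I_n * 'I_n, `|invmx (hbar q) c.1 c.2| <= K).
  apply: (bd_finite (f := fun c q => invmx (hbar q) c.1 c.2)) => c.
  exact: bd_invmx (ph p Up) ch.
have [K6 K61 H6] : exists2 K : R, 1 <= K &
    ev p (fun q => forall c : 'I_n * ('I_n * 'I_n),
      `|bcoord q * pd c.1 (fun q => hbar q c.2.1 c.2.2) q| <= K).
  apply: (bd_finite (f := fun (c : 'I_n * ('I_n * 'I_n)) q =>
    bcoord q * pd c.1 (fun q => hbar q c.2.1 c.2.2) q)) => c.
  exact: (phg_bcoord_derivative c.1 oA Up (phg c.2.1 c.2.2)).
(* The last summand bounds x |d hbar|: x is at most K0 times the boundary coordinate, whose product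
   with |d hbar| is at most K6. *)
pose K := K1 + K2 + K3 + K4 + K5 + K0 * K6.
have K06 : 0 <= K0 * K6 by rewrite mulr_ge0 // (le_trans ler01).
have KK : 1 <= K by rewrite /K; lra.
have k1 : K1 <= K by rewrite /K; lra.
have k2 : K2 <= K by rewrite /K; lra.
have k3 : K3 <= K by rewrite /K; lra.
have k4 : K4 <= K by rewrite /K; lra.
have k5 : K5 <= K by rewrite /K; lra.
have k6 : K0 * K6 <= K by rewrite /K; lra.
exists (@barrier_constant R n K).
  exact: barrier_constant_ge0 (le_trans ler01 KK).
have hEn : ev p (fun q => \forall z \near q, hbar z = x z ^+ 2 *: h z).
  have : nbhs p A := open_nbhs_nbhs (conj oA Up.1).
  move=> /nbhs_interior; rewrite /ev; apply: filterS => q Aq q0.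
  apply: filterS2 Aq (near_bcoord_gt0 q0) => z Az z0.
  by apply: hE => //; split=> //; exact: ltW.
have sFn : ev p (fun q => smooth_at F q).
  by rewrite /ev; apply: filterS (smooth_at_nbhs sF).
refine (ev2 (ev_and (ev_and (ev_and H0 H1) (ev_and H2 H3)) (ev_and (ev_and H4 H5) H6))
  (ev_and (ev_and ev_dom hEn) (ev_and EF sFn)) _).
move=> q q0 [[[h0 h1] [h2 h3]] [[h4 h5] h6]] [[Uq hq] [Fx sFq]].
have dF a : {near q, pd a F =1 pd a x}.
  by rewrite -partialL; exact: near_partial_eq.
have xq := xpos q Uq q0.
apply: (@barrier_bounds_at _ _ h hbar x K q (mh q Uq q0) (smooth_at_eq Fx sFq) xq (ph q Uq) hq KK).
- rewrite -(nbhs_singleton Fx); apply: le_trans (ler_norm _) _.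
  exact: le_trans (h1 0) k1.
- by move=> a; rewrite -(nbhs_singleton (dF a)); exact: le_trans (h2 a) k2.
- by move=> a b; rewrite -(pd_near a (dF b)); exact: le_trans (h3 (a, b)) k3.
- by move=> a b; exact: le_trans (h4 (a, b)) k4.
- by move=> a b; exact: le_trans (h5 (a, b)) k5.
- move=> c a b; have := h6 (c, (a, b)); rewrite normrM (gtr0_norm q0) /= => h7.
  apply: le_trans _ k6.
  apply: (@le_trans _ _ (K0 * (bcoord q * `|pd c (fun q => hbar q a b) q|))).
    by rewrite mulrA ler_wpM2r.
  by rewrite ler_wpM2l.
Qed.

End EventualEstimate.

(** * Local expressions at interior points *)

Section Charts.
Context {R : realType} {n : nat}.
Implicit Types (N : cmanifold R n).

Lemma chart_cont_at (T : topologicalType) (k : chart R T n) p :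
  cdom k p -> {for p, continuous (cphi k)}.
Proof.
have := @cphi_cont _ _ _ k; rewrite continuous_open_subspace; last exact: cdom_open.
by move=> H kp; apply: H; rewrite inE.
Qed.

Lemma chart_dom_near (T : topologicalType) (k : chart R T n) p :
  cdom k p -> \forall z \near p, cdom k z.
Proof. by move=> kp; apply: open_nbhs_nbhs; split=> //; exact: cdom_open. Qed.

Lemma bcoord_interior N (k : chart R N n) (p : N) : chart_at p k ->
  manifold_interior p -> 0 < bcoord (cphi k p).
Proof.
move=> [ak kp] ip; rewrite lt_def; apply/andP; split.
  by apply/eqP => b0; apply: ip; exists k.
by have := cphi_img kp; have [A oA ->] := cimg_open k => -[].
Qed.

Lemma open_chart_interior N (k : chart R N n) : open (chart_interior k).
Proof.
rewrite /chart_interior; have [A oA ->] := cimg_open k.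
rewrite (_ : _ `&` _ = A `&` [set q | 0 < bcoord q]).
  by apply: openI => //; exact: open_bcoord_gt0.
by apply/seteqP; split=> q [] => [[? ?] ?|? q0]; do ?split=> //; exact: ltW.
Qed.

Lemma chart_interior_img N (k : chart R N n) (p : N) : chart_at p k ->
  manifold_interior p -> chart_interior k (cphi k p).
Proof.
by move=> kp ip; split; [exact: cphi_img kp.2|exact: bcoord_interior].
Qed.

Lemma chart_metric_at N (h : components N) (k : chart R N n) q :
  riemannian_metric h -> atlas k -> chart_interior k q -> metric_at (h k) q.
Proof.
move=> [ph sh _] ak kq; have oC := @open_chart_interior _ k.
split; last by move=> a b; exact: (SmoothAt oC kq (sh k ak a b)).
by have := open_nbhs_nbhs (conj oC kq); apply: filterS => z; exact: ph.
Qed.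

Lemma jacobian_dmx m (f : 'rV[R]_m -> 'rV[R]_n) q :
  smooth_rV f q -> 'J f q = dmx f q.
Proof.
move=> sf; apply/matrixP => i a; rewrite jacobian_pd // mxE.
by rewrite partialL.
Qed.

End Charts.

Section LocalDomain.
Context {R : realType} {m n : nat} {S T : topologicalType}.
Variables (k : chart R S m) (k' : chart R T n) (u : S -> T).
Hypothesis cu : continuous u.

Lemma local_dom_open :
  exists2 A, open A & local_dom k k' u = A `&` halfspace m.
Proof.
have [B oB EB] := cimg_open k.
have cuk : {within cimg k, continuous (fun q => u (cpsi k q))}.
  move=> q; have H := @cpsi_cont _ _ _ k q.
  by move=> W /cu; exact: H.
have oK : open ((fun q => u (cpsi k q)) @^-1` cdom k' : set (subspace (cimg k))).
  by move/continuousP : cuk; apply; exact: cdom_open.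
have [V oV EV] := (open_subspaceP _ _).1 oK.
exists (B `&` V); first exact: openI.
rewrite setIAC -EB setIC EV setIC /local_dom.
by apply/seteqP; split=> q [].
Qed.

Lemma local_dom_at p : cdom k p -> cdom k' (u p) -> local_dom k k' u (cphi k p).
Proof. by move=> kp kup; split; [exact: cphi_img|rewrite cphiK]. Qed.

Lemma local_dom_near q : local_dom k k' u q -> 0 < bcoord q ->
  \forall z \near q, local_dom k k' u z /\ 0 < bcoord z.
Proof.
have [A oA ->] := local_dom_open => -[Aq _] q0.
have hA : \forall z \near q, A z by exact: open_nbhs_nbhs.
apply: filterS2 hA (near_bcoord_gt0 q0) => z Az z0.
by do !split=> //; exact: ltW.
Qed.

Lemma smooth_upto_interior f q : smooth_upto (local_dom k k' u) f ->
  local_dom k k' u q -> 0 < bcoord q -> smooth_at f q.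
Proof.
move=> sf Uq q0; have [F [W [oW Wq sF WF]]] := sf q Uq.
have hW : \forall z \near q, W z by exact: open_nbhs_nbhs.
apply: smooth_at_eq (SmoothAt oW Wq sF).
by apply: filterS2 hW (local_dom_near Uq q0) => z Wz [Uz _]; exact: WF.
Qed.

End LocalDomain.

Section BoundaryDefining.
Context {R : realType} {n : nat} (N : cmanifold R n) (x : N -> R).
Hypothesis bx : boundary_defining x.

Lemma interior_bdf (p : N) : manifold_interior p <-> 0 < x p.
Proof.
have [_ x0 xb _] := bx; rewrite /manifold_interior /setC /=; split.
  move=> ip; rewrite lt_def x0 andbT; apply/eqP => /xb; exact: ip.
by move=> xp /xb E; move: xp; rewrite E ltxx.
Qed.

Lemma continuous_bdf : continuous x.
Proof.
move=> p; have [k ak kp] := atlas_cover p; have [sx _ _ _] := bx.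
have [F [W [oW Wp sF WF]]] := sx k ak (cphi k p) (cphi_img kp).
have cF : {for p, continuous (fun z => F (cphi k z))}.
  apply: continuous_comp (chart_cont_at kp) _.
  exact: smooth_at_continuous (SmoothAt oW Wp sF).
have H : \forall z \near p, F (cphi k z) = x z.
  have hW : \forall z \near p, W (cphi k z).
    by apply: (chart_cont_at kp); exact: open_nbhs_nbhs.
  apply: filterS2 hW (chart_dom_near kp) => z Wz kz.
  by rewrite WF ?cphiK //; exact: cphi_img.
rewrite /continuous_at -(nbhs_singleton H).
exact: cvg_trans (near_eq_cvg H) cF.
Qed.

Lemma smooth_bdf k (p : N) : chart_at p k -> manifold_interior p ->
  smooth_at (fun q => x (cpsi k q)) (cphi k p).
Proof.
move=> kp ip; have [sx _ _ _] := bx.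
have [F [W [oW Wp sF WF]]] := sx k kp.1 (cphi k p) (cphi_img kp.2).
have hW : \forall q \near cphi k p, W q by exact: open_nbhs_nbhs.
have hC : \forall q \near cphi k p, chart_interior k q.
  apply: open_nbhs_nbhs; split; first exact: open_chart_interior.
  exact: chart_interior_img.
apply: smooth_at_eq (SmoothAt oW Wp sF).
by apply: filterS2 hW hC => q Wq [kq _]; exact: WF.
Qed.

Lemma interior_chart_near k (p : N) : chart_at p k -> manifold_interior p ->
  \forall q \near cphi k p, chart_interior k q /\ manifold_interior (cpsi k q).
Proof.
move=> kp ip; have sx := smooth_bdf kp ip.
have hC : \forall q \near cphi k p, chart_interior k q.
  apply: open_nbhs_nbhs; split; first exact: open_chart_interior.
  exact: chart_interior_img.
have xp : 0 < x (cpsi k (cphi k p)) by rewrite (cphiK kp.2); exact/interior_bdf.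
have hx : \forall q \near cphi k p, 0 < x (cpsi k q).
  exact: (cvgr_gt _ (smooth_at_continuous sx)).
by apply: filterS2 hC hx => q kq /interior_bdf.
Qed.

Lemma barrier_bounds_le (h : 'rV[R]_n -> 'M[R]_n) (y : 'rV[R]_n -> R) C D z :
  posdef (h z) -> 0 <= y z -> C <= D ->
  barrier_bounds h y C z -> barrier_bounds h y D z.
Proof.
move=> ph yz CD [H1 H2]; split=> v; have N0 := posdef_inner_ge0 v ph.
  apply: le_trans (H1 v) _; rewrite -!mulrA ler_wpM2r //.
  by do 2![apply: mulr_ge0 => //].
by apply: le_trans _ (H2 v); rewrite lerN2 -!mulrA ler_wpM2r // mulr_ge0.
Qed.

Variable h : components N.
Hypothesis h_met : riemannian_metric h.
Hypothesis h_bar : forall k, atlas k -> exists hbar : 'rV[R]_n -> 'M[R]_n,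
  [/\ forall q, cimg k q -> posdef (hbar q),
      forall a b, {within cimg k, continuous (fun q => hbar q a b)},
      forall q, chart_interior k q -> hbar q = x (cpsi k q) ^+ 2 *: h k q &
      forall a b q, cimg k q -> phg_at (cimg k) (fun q' => hbar q' a b) q].

(* A boundary point cannot be interior in some other chart: there
   [hbar = x ^+ 2 *: h] would vanish. *)
Lemma chart_bdf_pos k q : atlas k -> chart_interior k q -> 0 < x (cpsi k q).
Proof.
move=> ak [kq q0]; have [_ x0 xb _] := bx.
rewrite lt_def x0 andbT; apply/eqP => E.
have [[i0 bE iE]|bE] := @bcoordP R n; last first.
  by have [k' [_ _]] := (xb _).1 E; rewrite bE => /eqP; rewrite oner_eq0.
have [hbar [pb _ hE _]] := h_bar ak.
have d0 : delta_mx 0 i0 != 0 :> 'rV[R]_n.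
  by apply/eqP => /rowP/(_ i0); rewrite !mxE !eqxx => /eqP; rewrite oner_eq0.
have := (pb q kq).2 _ d0; rewrite hE // E expr0n /= scale0r.
by rewrite /inner mulmx0 mul0mx mxE ltxx.
Qed.

(** Compactness of N makes the local constants uniform. The chart may vary with the point and is
    only asserted to exist. *)
Lemma uniform_barrier_bounds : exists2 C : R, 0 <= C & forall p : N,
  manifold_interior p -> exists2 k, chart_at p k &
    barrier_bounds (h k) (fun q => x (cpsi k q)) C (cphi k p).
Proof.
have [sx x0 xb _] := bx.
have loc (p : N) : exists2 C : R, 0 <= C & \forall z \near p,
    manifold_interior z -> exists2 k, chart_at z k &
    barrier_bounds (h k) (fun q => x (cpsi k q)) C (cphi k z).
  have [k ak kp] := atlas_cover p; have [hbar [pb cb hE pg]] := h_bar ak.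
  have [A oA EA] := cimg_open k.
  have HC q : (A `&` halfspace n) q -> 0 < bcoord q -> chart_interior k q.
    by rewrite -EA => kq q0.
  have [|||||||||C C0 HC'] := @barrier_bounds_near R n A (h k) hbar
      (fun q => x (cpsi k q)) (cphi k p) oA.
  - by rewrite -EA; exact: cphi_img.
  - by rewrite -EA; exact: sx.
  - rewrite -EA => q kq q0; apply/xb; exists k; rewrite cpsiK //; split=> //.
    exact: cpsi_dom.
  - by move=> q Uq q0; apply: chart_bdf_pos => //; exact: HC.
  - by move=> q Uq q0; apply: chart_metric_at => //; exact: HC.
  - by rewrite -EA.
  - by rewrite -EA.
  - by move=> q Uq q0; apply: hE; exact: HC.
  - by rewrite -EA => a b; apply: pg; exact: cphi_img.
  exists C => //.
  have H : \forall z \near p, 0 < bcoord (cphi k z) ->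
      barrier_bounds (h k) (fun q => x (cpsi k q)) C (cphi k z).
    exact: (chart_cont_at kp HC').
  apply: filterS2 H (chart_dom_near kp) => z Hz kz iz.
  by exists k => //; apply: Hz; exact: bcoord_interior.
have /compact_near_coveringP ncov := @carrier_compact _ _ N.
(* Near-covering compactness along C -> +oo: a bound with some constant persists for all larger
   ones, so the finite choice of a maximal constant is implicit. *)
have [] := ncov R (pinfty_nbhs R) (fun C z => manifold_interior z ->
    exists2 k, chart_at z k &
    barrier_bounds (h k) (fun q => x (cpsi k q)) C (cphi k z)) _.
  move=> p _; have [C C0 HC] := loc p.
  exists ([set z | manifold_interior z -> exists2 k, chart_at z k &
      barrier_bounds (h k) (fun q => x (cpsi k q)) C (cphi k z)], [set D | C < D]).
    by split=> //=; exists C; split=> //; exact: num_real.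
  move=> [z D] [/= Hz CD] iz; have [k kz Bz] := Hz iz; exists k => //.
  apply: barrier_bounds_le (ltW CD) Bz; last by exact: x0.
  exact: nbhs_singleton (chart_metric_at h_met kz.1 (chart_interior_img kz iz)).1.
move=> C [_ HC]; exists (`|C| + 1) => [|p ip]; first exact: addr_ge0.
apply: (HC (`|C| + 1)) => //.
by rewrite (le_lt_trans (ler_norm C)) // ltrDl.
Qed.

End BoundaryDefining.

Section Maps.
Context {R : realType} {m n : nat} (M : cmanifold R m) (N : cmanifold R n).
Variables (h : components N) (u : M -> N) (x : N -> R).
Hypotheses (bx : boundary_defining x) (h_met : riemannian_metric h)
  (u_reg : phg_C1_map u) (u_imm : immersion u)
  (u_bd : forall p : M, boundary p -> boundary (u p))
  (u_int : forall p : M, manifold_interior p -> manifold_interior (u p)).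

Let cu : continuous u := u_reg.1.

Lemma interior_preimage (p : M) : manifold_interior p <-> 0 < x (u p).
Proof.
split=> [/u_int/(interior_bdf bx)//|xp bp].
by have /(interior_bdf bx) := xp; apply; exact: u_bd.
Qed.

Lemma continuous_height : continuous (fun p => x (u p)).
Proof.
move=> p W /(continuous_bdf bx); exact: cu.
Qed.

Lemma transition_smooth k (K : cmanifold R k) (p : K) (j j' : chart R K k) :
  chart_at p j -> chart_at p j' -> manifold_interior p ->
  smooth_rV (local_rep j j' id) (cphi j p).
Proof.
move=> jp jp' ip a; have cid : continuous (id : K -> K) by move=> z.
apply: (smooth_upto_interior cid (atlas_smooth jp.1 jp'.1 a)).
  exact: local_dom_at jp.2 jp'.2.
exact: bcoord_interior.
Qed.

Section AtPoint.
Variables (p : M) (k : chart R M m) (k' : chart R N n).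
Hypotheses (ip : manifold_interior p) (kp : chart_at p k)
  (kup : chart_at (u p) k').
Local Notation f := (local_rep k k' u).

Lemma local_repE : f (cphi k p) = cphi k' (u p).
Proof. by rewrite /local_rep (cphiK kp.2). Qed.

Lemma rep_near : \forall q \near cphi k p, [/\ local_dom k k' u q, 0 < bcoord q,
  chart_at (cpsi k q) k, chart_at (u (cpsi k q)) k' & cphi k (cpsi k q) = q].
Proof.
have Up := local_dom_at kp.2 kup.2.
have p0 := bcoord_interior kp ip.
apply: filterS (local_dom_near cu Up p0) => q [[kq kuq] q0].
split=> //; last exact: cpsiK.
  by split; [exact: kp.1|exact: cpsi_dom].
by split=> //; exact: kup.1.
Qed.

Lemma smooth_local_rep : smooth_rV f (cphi k p).
Proof.
move=> a; have [A oA EA] := local_dom_open k k' cu.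
have [+ _] := u_reg.2 p k k' kp kup a; rewrite EA.
have := local_dom_at kp.2 kup.2; rewrite EA => -[Ap _].
apply: phg_interior_smooth => //; exact: bcoord_interior.
Qed.

Lemma local_rep_immersion : local_immersion (h k') f (cphi k p).
Proof.
split; first exact: smooth_local_rep.
  rewrite local_repE; apply: chart_metric_at => //; first exact: kup.1.
  exact: chart_interior_img (u_int ip).
apply: filterS2 rep_near (smooth_rV_near smooth_local_rep).
move=> q [Uq q0 kq kuq qK] sq.
(* At an interior point the local expression is its own C^1 extension, so [immersion] applies to its
   Jacobian. *)
apply: (u_imm kq kuq); exists f; split.
  move=> a; rewrite qK; have [A oA Aq sA] := sq a.
  by exists A; split=> //; exact: sA.
by rewrite qK (jacobian_dmx sq).
Qed.

End AtPoint.

Lemma tension_norm_charts p k k' j j' : manifold_interior p ->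
  chart_at p k -> chart_at (u p) k' -> chart_at p j -> chart_at (u p) j' ->
  inner (h k' (local_rep k k' u (cphi k p)))
    (tens (h k') (local_rep k k' u) (cphi k p))
    (tens (h k') (local_rep k k' u) (cphi k p)) =
  inner (h j' (local_rep j j' u (cphi j p)))
    (tens (h j') (local_rep j j' u) (cphi j p))
    (tens (h j') (local_rep j j' u) (cphi j p)).
Proof.
move=> ip kp kup jp jup.
have iup := u_int ip.
have spsi := transition_smooth kp jp ip.
have schi := transition_smooth kup jup iup.
have psiE : local_rep k j id (cphi k p) = cphi j p by rewrite /local_rep (cphiK kp.2).
have L1 := local_rep_immersion ip kp kup.
have L2 := local_rep_immersion ip jp jup.
rewrite -psiE; apply: (tens_norm_chart (chi := local_rep k' j' id)) => //.
- by rewrite (local_repE k' kp).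
- by rewrite psiE.
- have cidM : continuous (id : M -> M) by move=> z.
  have Hj := local_dom_near cidM (local_dom_at (u := id) kp.2 jp.2) (bcoord_interior kp ip).
  apply: filterS2 Hj (rep_near ip kp kup) => q [[kq jq] _] [Uq q0 kq' kuq' _].
  by rewrite /local_rep (cphiK kuq'.2) (cphiK jq).
rewrite (local_repE k' kp).
have cidN : continuous (id : N -> N) by move=> z.
have Hj := local_dom_near cidN (local_dom_at (u := id) kup.2 jup.2) (bcoord_interior kup iup).
have Hi := interior_chart_near bx kup iup.
apply: filterS3 Hj Hi (smooth_rV_near schi) => y [[ky jy] y0] [[_ _] iy] sy.
have ky' : chart_at (cpsi k' y) k' by split; [exact: kup.1|exact: cpsi_dom].
have jy' : chart_at (cpsi k' y) j' by split; [exact: jup.1|].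
have [_ _ /(_ _ _ _ iy ky' jy')] := h_met.
by rewrite cpsiK // (jacobian_dmx sy).
Qed.

End Maps.

(** * The maximum principle on M *)

Section MaximumPrinciple.
Context {R : realType} {m n : nat} (M : cmanifold R m) (N : cmanifold R n).
Variables (h : components N) (u : M -> N) (x : N -> R).
Hypotheses (bx : boundary_defining x) (h_met : riemannian_metric h)
  (u_reg : phg_C1_map u) (u_imm : immersion u)
  (u_bd : forall p : M, boundary p -> boundary (u p))
  (u_int : forall p : M, manifold_interior p -> manifold_interior (u p)).

Local Notation w p := (x (u p)).
Let cw : continuous (fun p => w p) := continuous_height bx u_reg.
Let int_w := interior_preimage bx u_bd u_int.

Definition tension_norm (k : chart R M m) (k' : chart R N n) q : R :=
  let f := local_rep k k' u in
  inner (h k' (f q)) (tens (h k') f q) (tens (h k') f q).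

(** Charts are chosen at every point; independence of the choice turns the local expressions of
    |tau|^2 into one function whose maximum can be sought on M. *)
Lemma tension_norm_global : exists G : M -> R, forall p k k',
  manifold_interior p -> chart_at p k -> chart_at (u p) k' ->
  tension_norm k k' (cphi k p) = G p.
Proof.
have ch j (K : cmanifold R j) : exists c, forall p : K, chart_at p (c p).
  have /choice[c cP] : forall p : K, exists k, chart_at p k.
    by move=> p; have [k ak kp] := atlas_cover p; exists k.
  by exists c.
have [c cP] := ch _ M; have [c' cP'] := ch _ N.
exists (fun p => tension_norm (c p) (c' (u p)) (cphi (c p) p)).
move=> p k k' ip kp kup.
exact: (tension_norm_charts bx h_met u_reg u_imm u_int ip kp kup (cP p) (cP' (u p))).
Qed.

Lemma smooth_tension_norm p k k' : manifold_interior p -> chart_at p k ->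
  chart_at (u p) k' -> smooth_at (tension_norm k k') (cphi k p).
Proof.
move=> ip kp kup; have L := local_rep_immersion h_met u_reg u_imm u_int ip kp kup.
apply: smooth_inner (immersion_smooth L) (immersion_metric L).2 _ _;
  exact: smooth_tens.
Qed.

Lemma height_rep p k k' : manifold_interior p -> chart_at p k ->
  chart_at (u p) k' ->
  \forall q \near cphi k p, x (cpsi k' (local_rep k k' u q)) = w (cpsi k q).
Proof.
move=> ip kp kup; apply: filterS (rep_near u_reg ip kp kup) => q [_ _ _ kuq _].
by rewrite /local_rep (cphiK kuq.2).
Qed.

Lemma smooth_height p k k' : manifold_interior p -> chart_at p k ->
  chart_at (u p) k' ->
  smooth_at (fun q => x (cpsi k' (local_rep k k' u q))) (cphi k p).
Proof.
move=> ip kp kup; apply: (smooth_at_comp (phi := fun y => x (cpsi k' y))).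
  exact: (smooth_local_rep u_reg ip kp kup).
rewrite (local_repE _ _ kp); apply: (smooth_bdf bx) => //; exact: u_int.
Qed.

Lemma height_gt_near p k k' a : manifold_interior p -> chart_at p k ->
  chart_at (u p) k' -> a < w p -> \forall q \near cphi k p, a < w (cpsi k q).
Proof.
move=> ip kp kup aw; have E := height_rep ip kp kup.
have H : \forall q \near cphi k p, a < x (cpsi k' (local_rep k k' u q)).
  apply: (cvgr_gt _ (smooth_at_continuous (smooth_height ip kp kup))).
  by rewrite (nbhs_singleton E) (cphiK kp.2).
by apply: filterS2 E H => q ->.
Qed.

Variable G : M -> R.
Hypothesis GE : forall p k k', manifold_interior p -> chart_at p k ->
  chart_at (u p) k' -> tension_norm k k' (cphi k p) = G p.

Lemma tension_norm_near p k k' : manifold_interior p -> chart_at p k ->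
  chart_at (u p) k' -> \forall q \near cphi k p, tension_norm k k' q = G (cpsi k q).
Proof.
move=> ip kp kup; have wp := (int_w p).1 ip.
apply: filterS2 (rep_near u_reg ip kp kup) (height_gt_near ip kp kup wp).
by move=> q [_ _ kq kuq qK] /int_w iq; rewrite -(GE iq kq kuq) qK.
Qed.

Lemma tension_norm_continuous p : manifold_interior p -> {for p, continuous G}.
Proof.
move=> ip; have [k ak kp'] := atlas_cover p; have [k' ak' kup'] := atlas_cover (u p).
have kp : chart_at p k by [].
have kup : chart_at (u p) k' by [].
have c1 : {for p, continuous (fun z => tension_norm k k' (cphi k z))}.
  apply: continuous_comp (chart_cont_at kp') _.
  exact: smooth_at_continuous (smooth_tension_norm ip kp kup).
have hz : \forall z \near p, tension_norm k k' (cphi k z) = G z.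
  have hi : \forall z \near p, 0 < w z.
    by apply: (cvgr_gt _ (@cw p)); exact/int_w.
  have hu : \forall z \near p, cdom k' (u z).
    by apply: (u_reg.1 p); exact: chart_dom_near.
  by apply: filterS3 hi hu (chart_dom_near kp') => z /int_w iz kuz kz; exact: GE.
rewrite /prop_for /continuous_at -(nbhs_singleton hz); exact: cvg_trans (near_eq_cvg hz) c1.
Qed.

Lemma tension_norm_ge0 p : manifold_interior p -> 0 <= G p.
Proof.
move=> ip; have [k ak kp] := atlas_cover p; have [k' ak' kup] := atlas_cover (u p).
have L := local_rep_immersion (k := k) (k' := k') h_met u_reg u_imm u_int ip (conj ak kp) (conj ak' kup).
rewrite -(GE ip (conj ak kp) (conj ak' kup)); apply: posdef_inner_ge0.
exact: nbhs_singleton (immersion_metric L).1.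
Qed.

Hypotheses (m0 : (0 < m)%N) (h_npc : nonpositive_curvature h)
  (bih : biharmonic h u).
Variable C : R.
Hypotheses (C0 : 0 <= C) (HC : forall y : N, manifold_interior y ->
  exists2 k, chart_at y k &
    barrier_bounds (h k) (fun q => x (cpsi k q)) C (cphi k y)).

(** The chart of N is the one provided by [HC], the chart of M is arbitrary; [GE] converts the
    maximality of G phi^2 into these charts. *)
Lemma barrier_at_max (p : M) (e : R) : manifold_interior p -> 0 < e -> e <= 1 ->
  0 < 1 + e * ln (w p) -> e * ln (w p) <= 1 -> 0 < G p ->
  (forall z, expR (- e^-1) < w z ->
    G z * (1 + e * ln (w z)) ^+ 2 <= G p * (1 + e * ln (w p)) ^+ 2) ->
  (2 / m%:R - e * C) * (G p * (1 + e * ln (w p)) ^+ 2) <= e * (14 * C * m%:R + 1).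
Proof.
move=> ip e0 e1 phi0 phi2 Gp maxp.
have [k ak kp'] := atlas_cover p; have kp : chart_at p k by [].
have [k' kup [B1 B2]] := HC (u_int ip).
have wp := (int_w p).1 ip.
have L := local_rep_immersion h_met u_reg u_imm u_int ip kp kup.
have fE := local_repE u k' kp.
set f := local_rep k k' u in L fE *.
pose X q := x (cpsi k' q).
have Xf : X (f (cphi k p)) = w p by rewrite fE /X (cphiK kup.2).
have sX : smooth_at X (f (cphi k p)).
  by rewrite fE; apply: (smooth_bdf bx) => //; exact: u_int.
(* This restates phi(p) > 0. Being an open condition, it puts all nearby points into the region
   where [p] is known to be maximal. *)
have lep : expR (- e^-1) < w p.
  rewrite -(lnK wp) ltr_expR -(ltr_pM2l e0) mulrN divff ?gt_eqF //.
  by rewrite -subr_gt0 opprK addrC.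
have maxq : \forall q \near cphi k p,
    tension_norm k k' q * (1 + e * ln (X (f q))) ^+ 2 <=
    tension_norm k k' (cphi k p) * (1 + e * ln (X (f (cphi k p)))) ^+ 2.
  rewrite (GE ip kp kup) Xf.
  apply: filterS3 (tension_norm_near ip kp kup) (height_rep ip kp kup)
    (height_gt_near ip kp kup lep).
  by move=> q -> E wq; rewrite /X E; exact: maxp.
have curv v z : 0 <= inner (h k' (f (cphi k p))) (riem (h k') (f (cphi k p)) v z v) z.
  apply: nonpositive_curvature_form.
    exact: nbhs_singleton (immersion_metric L).1.
  move=> v' z'; rewrite fE; apply: h_npc; first exact: kup.1.
  exact: chart_interior_img (u_int ip).
have J : jacobi (h k') f (tens (h k') f) (cphi k p) = 0.
  have -> : tens (h k') f = tension (h k') f by rewrite tens.unlock.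
  exact: bih ip kp kup.
have lapF := bochner_inequality L m0 curv J.
rewrite -Xf -(GE ip kp kup).
apply: (barrier L) maxq => //.
- by rewrite Xf.
- exact: smooth_tension_norm.
- by rewrite Xf.
- by rewrite Xf; move: phi2; lra.
- by rewrite (GE ip kp kup).
- by move=> v; have := B1 v; rewrite -fE.
- by move=> v; have := B2 v; rewrite -fE.
Qed.

(** The set [A], where w > 0 and phi >= 0, is closed in M and avoids the boundary, so it is compact
    and G is continuous on it. The estimate at a maximum point bounds the value at every other
    point. *)
Lemma weighted_tension_le (p : M) (e : R) : manifold_interior p -> 0 < e -> e <= 1 ->
  e * C <= 2 / m%:R -> 0 < 1 + e * ln (w p) ->
  (forall z, manifold_interior z -> e * ln (w z) <= 1) ->
  (2 / m%:R - e * C) * (G p * (1 + e * ln (w p)) ^+ 2) <= e * (14 * C * m%:R + 1).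
Proof.
move=> ip e0 e1 eC phi0 lnw.
have wp := (int_w p).1 ip.
have RHS0 : 0 <= e * (14 * C * m%:R + 1).
  by rewrite mulr_ge0 ?(ltW e0) // addr_ge0 // !mulr_ge0.
have c0 : 0 <= 2 / m%:R - e * C by rewrite subr_ge0.
pose H z := G z * (1 + e * ln (w z)) ^+ 2.
(* In the first case the claim is trivial. In the second the maximum of H is positive, which forces
   phi > 0 and G > 0 there and keeps it off the edge of [A]. *)
have [Hp|Hp] := leP (H p) 0.
  by apply: le_trans RHS0; rewrite mulr_ge0_le0.
pose A : set M := [set z | expR (- e^-1) <= w z].
have inA z : 0 < w z -> A z = (0 <= 1 + e * ln (w z)) :> Prop.
  move=> wz; rewrite /A /= (_ : (expR (- e^-1) <= w z) = (0 <= 1 + e * ln (w z))) //.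
  rewrite -{1}(lnK wz) ler_expR -(ler_pM2l e0) mulrN divff ?gt_eqF //.
  by rewrite -lerBlDl sub0r.
have wA z : A z -> 0 < w z by apply: lt_le_trans; exact: expR_gt0.
have cA : compact A.
  apply: (@subclosed_compact _ _ setT) => //; last exact: carrier_compact.
  apply: (closed_comp (f := fun z => w z)) (@closed_ge _ _) => z _; exact: cw.
have cH : {within A, continuous H}.
  apply: continuous_in_subspaceT => z /set_mem Az.
  have iz : manifold_interior z by apply/int_w; exact: wA.
  have cl : {for z, continuous (fun z => 1 + e * ln (w z))}.
    apply: continuous_atD; first exact: continuous_at_cst.
    apply: continuous_atM; first exact: continuous_at_cst.
    by move=> W /(continuous_ln (wA z Az)); exact: cw.
  have cG := tension_norm_continuous iz.
  rewrite (_ : H = fun z => G z * ((1 + e * ln (w z)) * (1 + e * ln (w z)))).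
    exact: continuous_atM cG (continuous_atM cl cl).
  by apply/funext => y; rewrite /H expr2.
have [|z /set_mem Az maxz] := @compact_EVT_max M R H A _ cA cH.
  by exists p; rewrite inA // ltW.
have Hz : H p <= H z by apply: maxz; rewrite inE inA // ltW.
have Hz0 : 0 < H z := lt_le_trans Hp Hz.
have wz := wA z Az; have iz : manifold_interior z by apply/int_w.
have phz : 0 < 1 + e * ln (w z).
  have phz0 : 0 <= 1 + e * ln (w z) by move: Az; rewrite inA.
  rewrite lt_def phz0 andbT; apply/eqP => E.
  by move: Hz0; rewrite /H E expr0n /= mulr0 ltxx.
have Gz : 0 < G z.
  rewrite lt_def tension_norm_ge0 // andbT; apply/eqP => E.
  by move: Hz0; rewrite /H E mul0r ltxx.
apply: (@le_trans _ _ ((2 / m%:R - e * C) * H z)); first by rewrite ler_wpM2l.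
apply: barrier_at_max => //; first exact: lnw.
by move=> y yA; apply: maxz; rewrite inE; exact: (ltW yA).
Qed.

Lemma tension_norm_eq0 (p : M) : manifold_interior p -> G p = 0.
Proof.
move=> ip; apply/eqP; rewrite eq_le tension_norm_ge0 // andbT.
rewrite leNgt; apply/negP => Gp.
(* The maximum of w over M gives an upper bound for ln w, hence phi <= 2 for small e. *)
have [z _ zmax] := @compact_EVT_max M R (fun z => w z) setT (ex_intro _ p I)
  (@carrier_compact _ _ M) (continuous_subspaceT cw).
pose B := `|ln (w z)|; pose a := `|ln (w p)|.
pose c : R := 2 / m%:R.
have c0 : 0 < c by rewrite divr_gt0 // ltr0n.
pose D := 14 * C * m%:R + 1.
have D0 : 0 <= D by rewrite addr_ge0 // !mulr_ge0.
(* With e = 1/E the summands yield in turn e <= 1, e ln w <= 1 on the interior, phi(p) >= 1/2, e C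
   <= c/2, and e D < c G(p)/8. The last contradicts [weighted_tension_le], whose left side is at
   least (c/2) G(p)/4. *)
pose E := 1 + B + 2 * a + 2 * C / c + 8 * D / (c * G p).
have B0 : 0 <= B by exact: normr_ge0.
have a0 : 0 <= a by exact: normr_ge0.
have q1 : 0 <= 2 * C / c by rewrite divr_ge0 ?mulr_ge0 // ltW.
have q2 : 0 <= 8 * D / (c * G p) by rewrite divr_ge0 ?mulr_ge0 // ltW.
have E0 : 0 < E by rewrite /E; move: B0 a0 q1 q2; lra.
pose e := E^-1; have e0 : 0 < e by rewrite invr_gt0.
have eE : e * E = 1 by rewrite /e mulVf // gt_eqF.
have le_e t : t <= E -> e * t <= 1 by move=> tE; rewrite -eE ler_wpM2l // ltW.
have e1 : e <= 1 by rewrite -[leLHS]mulr1; apply: le_e; rewrite /E; move: B0 a0 q1 q2; lra.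
have eB : e * B <= 1 by apply: le_e; rewrite /E; move: B0 a0 q1 q2; lra.
have ea : e * (2 * a) <= 1 by apply: le_e; rewrite /E; move: B0 a0 q1 q2; lra.
have eC : e * (2 * C / c) <= 1 by apply: le_e; rewrite /E; move: B0 a0 q1 q2; lra.
have eD : e * (8 * D / (c * G p)) < 1.
  by rewrite -[ltRHS]eE ltr_pM2l // /E; move: B0 a0 q1 q2; lra.
have {}eC : e * C <= c / 2.
  by move: eC; rewrite mulrA ler_pdivrMr // mulrCA; lra.
have {}eD : 8 * (e * D) < c * G p.
  have X0 : 0 < c * G p by exact: mulr_gt0.
  rewrite -[ltRHS]mul1r -(ltr_pdivrMr _ _ X0); apply: le_lt_trans eD.
  by rewrite !mulrA [8 * e]mulrC.
have phl : 2^-1 <= 1 + e * ln (w p).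
  have : e * - ln (w p) <= e * a by rewrite ler_pM2l // /a -normrN ler_norm.
  by rewrite mulrN; move: ea; rewrite mulrCA; lra.
have := @weighted_tension_le p e ip e0 e1.
have ec : e * C <= 2 / m%:R by rewrite -/c; move: eC c0; lra.
have ph0 : 0 < 1 + e * ln (w p) by move: phl; lra.
have lnw (y : M) : manifold_interior y -> e * ln (w y) <= 1.
  move=> iy; apply: le_trans eB; rewrite ler_pM2l //.
  apply: le_trans (ler_norm _).
  have yz : w y <= w z by apply: zmax; rewrite inE.
  have wy := (int_w y).1 iy.
  by rewrite ler_ln ?posrE // (lt_le_trans wy yz).
move=> /(_ ec ph0 lnw); rewrite -/c -/D.
have : c / 2 * (G p * (2^-1) ^+ 2) <= (c - e * C) * (G p * (1 + e * ln (w p)) ^+ 2).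
  apply: ler_pM.
  - by rewrite divr_ge0 // ltW.
  - by rewrite mulr_ge0 ?sqr_ge0 // ltW.
  - by move: eC; lra.
  - by rewrite ler_pM2l // ler_sqr ?nnegrE ?invr_ge0 // ltW.
have -> : c / 2 * (G p * (2^-1) ^+ 2) = c * G p / 8 by field.
move: eD; lra.
Qed.

End MaximumPrinciple.

(** * Vanishing tension and the equivalence *)

Section ZeroSection.
Context {R : realType} {m n : nat}.
Variables (h : 'rV[R]_n -> 'M[R]_n) (u S : 'rV[R]_m -> 'rV[R]_n).

Lemma nab0 i p : nab h u (fun=> 0) i p = 0.
Proof.
rewrite nabE big1 ?addr0 => [|b _]; last first.
  by rewrite big1 // => c _; rewrite mxE mulr0 scale0r.
apply/rowP => a; rewrite -[LHS]/(rowfun (dvec (fun=> 0) i) a p) rowfun_dvec.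
rewrite (_ : rowfun _ a = fun=> 0) ?pd_cst ?mxE //.
by apply/funext => q; rewrite /rowfun mxE.
Qed.

Lemma jacobi_near0 p : (\forall q \near p, S q = 0) -> jacobi h u S p = 0.
Proof.
move=> S0; have nS0 i : \forall q \near p, nab h u S i q = 0.
  move/nbhs_interior: S0; apply: filterS => q Sq.
  by rewrite (nab_near h u i Sq) nab0.
rewrite jacobiE.
have z2 (B : 'I_m -> 'I_m -> 'rV[R]_n) : (forall i j, B i j = 0) ->
    \sum_i \sum_j invmx (pull h u p) i j *: B i j = 0.
  by move=> B0; rewrite big1 // => i _; rewrite big1 // => j _; rewrite B0 scaler0.
rewrite z2 => [|i j]; last first.
  rewrite nformE (nab_near h u i (nS0 j)) nab0 big1 ?subrr // => k _.
  by rewrite (nbhs_singleton (nS0 k)) scaler0.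
rewrite z2 ?oppr0 ?addr0 // => i j.
rewrite (nbhs_singleton S0) riemE; apply/rowP => a; rewrite [LHS]mxE [RHS]mxE.
rewrite big1 // => b _; rewrite big1 // => c _; rewrite big1 // => d _.
by rewrite [X in _ * X]mxE mulr0.
Qed.

End ZeroSection.

Section TensionMinimal.
Context {R : realType} {m n : nat} (M : cmanifold R m) (N : cmanifold R n).
Variables (h : components N) (u : M -> N).

Definition tension_free : Prop := forall (p : M) k k', manifold_interior p ->
  chart_at p k -> chart_at (u p) k' ->
  tens (h k') (local_rep k k' u) (cphi k p) = 0.

Lemma tension_free_minimal :
  (forall (p : M) k k', manifold_interior p -> chart_at p k -> chart_at (u p) k' ->
    local_immersion (h k') (local_rep k k' u) (cphi k p)) ->
  (0 < m)%N -> minimal h u <-> tension_free.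
Proof.
move=> L m0; split=> H p k k' ip kp kup; have := H p k k' ip kp kup;
  rewrite (mean_curvatureE (L p k k' ip kp kup)); last by move=> ->; rewrite scaler0.
by move=> /eqP; rewrite scaler_eq0 invr_eq0 pnatr_eq0 eqn0Ngt m0 => /eqP.
Qed.

End TensionMinimal.
Theorem corollary2 (R : realType) (m n : nat)
    (M : cmanifold R m) (N : cmanifold R n) (h : components N) (u : M -> N)
    (h_cc : conformally_compact h)
    (h_npc : nonpositive_curvature h)
    (u_reg : phg_C1_map u)
    (u_imm : immersion u)
    (u_bd : forall p : M, boundary p -> boundary (u p))
    (u_int : forall p : M, manifold_interior p -> manifold_interior (u p))
    (u_transv : transversal_to_boundary u) :
  biharmonic h u <-> minimal h u.
Proof.
have [h_met [x [bx h_bar]]] := h_cc.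
(* In dimension 0 all traces are empty sums and both conditions hold; the remaining argument divides
   by m. *)
have [m0|m0] := posnP m.
  have empty (i : 'I_m) : False by move: (ltn_ord i); rewrite [X in (_ < X)%N]m0.
  have tens0 (B : 'I_m -> 'rV[R]_n) : \sum_i B i = 0.
    by rewrite big1 // => i; case: (empty i).
  split=> _ p k k' ip kp kup /=.
    by rewrite /mean_curvature /trace_g tens0 scaler0.
  by rewrite /jacobi /rough_laplacian /nabla_adjoint /trace_g !tens0 oppr0 addr0.
have L p k k' ip kp kup :=
  @local_rep_immersion R m n M N h u h_met u_reg u_imm u_int p k k' ip kp kup.
rewrite (tension_free_minimal L m0); split=> [bih|tf] p k k' ip kp kup.
  have [G GE] := tension_norm_global bx h_met u_reg u_imm u_int.
  have [C C0 HC] := uniform_barrier_bounds bx h_met h_bar.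
  have Gp := tension_norm_eq0 bx h_met u_reg u_imm u_bd u_int GE m0 h_npc bih C0 HC ip.
  have := GE p k k' ip kp kup; rewrite Gp; apply: posdef_inner_eq0.
  exact: nbhs_singleton (immersion_metric (L p k k' ip kp kup)).1.
rewrite /= -[tension]/(@tension R m n) (_ : tension (h k') (local_rep k k' u) =
  tens (h k') (local_rep k k' u)); last by rewrite tens.unlock.
apply: jacobi_near0.
(* The Jacobi operator differentiates the tension, so vanishing is needed near [p]; nearby points
   are interior because w > 0 is an open condition. *)
have wp := (interior_preimage bx u_bd u_int p).1 ip.
apply: filterS2 (rep_near u_reg ip kp kup)
  (height_gt_near bx u_reg u_int ip kp kup wp).
move=> q [_ _ kq kuq qK] /(interior_preimage bx u_bd u_int) iq.
by rewrite -[q]qK; exact: tf.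
Qed.
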